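(* The map $\mathcal C_{\alpha,\lambda}\to\big(\mathrm{Mat}(d,\mathbb C)\otimes\mathcal P\big)^{d+1}$ which assigns to $(X,Y,v_i,w_i)$ the elements $$L=MyM^{-1},\quad R_\gamma=ME_\gamma M^{-1}\ (\gamma=1,\dots,d),\qquad M=1-\sum_{i,j\in I}\epsilon_iw_i(X-x1_V)^{-1}(Y-y1_V)^{-1}v_j\epsilon_j,$$ sends the Hamiltonian flows $$\dot X=-\sum_{l=0}^{m-1}\sum_{a=0}^{k-1}Y^av_lE_\beta w_{l-k}Y^{k-a-1},\quad\dot Y=0,\quad\dot w_i=E_\beta w_{i-k}Y^k,\quad\dot v_j=-Y^kv_{j+k}E_\beta$$ ($i,j\in I$, dot $=\partial/\partial t_{k\beta}$, $k=0,1,\dots$, $\beta=1,\dots,d$) to the flows of the matrix hierarchy $$\frac{\partial L}{\partial t_{k\beta}}=\big[(L^kR_\beta)_+,L\big],\qquad\frac{\partial R_\gamma}{\partial t_{k\beta}}=\big[(L^kR_\beta)_+,R_\gamma\big].$$ Therefore solutions of the hierarchy can be found by integrating these Hamiltonian flows with an arbitrary initial point in $\mathcal C_{\alpha,\lambda}$.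
   Context: **Ring $\mathcal P$.** Fix $m,d\ge1$, $I=\mathbb Z/m\mathbb Z=\{0,\dots,m-1\}$ (indices mod $m$), the cyclic group $\Gamma=\{e,s,\dots,s^{m-1}\}$ and a primitive $m$-th root of unity $\mu$. $\Gamma$ acts on $\mathbb C(x)$ by $s(f)(x)=f(\mu^{-1}x)$; $\mathbb C(x)*\Gamma$ is the crossed product ($\gamma a=\gamma(a)\gamma$). Put $\epsilon_i=\frac1m\sum_{r=0}^{m-1}\mu^{-ir}s^r$. Fix $\tau\in\mathbb C\setminus\{0\}$, $\varkappa_0,\dots,\varkappa_{m-1}\in\mathbb C$, and define $c_\gamma$ by $\sum_i m\varkappa_i\epsilon_i=\sum_{\gamma\in\Gamma}c_\gamma\gamma$. Let $\theta$ be the automorphism of $\mathbb C(x)*\Gamma$ with $\theta(x)=x$, $\theta(s)=\mu s$, and $D(f)=\tau\partial(f)-\sum_{\gamma\ne e}c_\gamma x^{-1}(\gamma f-f\gamma)$, where $\partial(\sum a_\gamma\gamma)=\sum\frac{da_\gamma}{dx}\gamma$. $\mathcal P$ is the associative ring of formal series $\sum_{j\ge0}f_jy^{N-j}$ ($N\in\mathbb Z$, $f_j\in\mathbb C(x)*\Gamma$), with multiplication extending that of $\mathbb C(x)*\Gamma$ and determined by $yf=\theta^{-1}(f)y+D(f)$, $y^{-1}f=\sum_{p\ge0}(-1)^p(\theta D)^p\theta(f)y^{-1-p}$. ($y$ plays the role of the Dunkl operator $\tau\frac d{dx}-\frac1x\sum_im\varkappa_i\epsilon_i$.) One has $xy-yx=\sum_i\lambda_i\epsilon_i$,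 $\lambda_i=m(\varkappa_{i-1}-\varkappa_i)-\tau$. For $S=\sum_jf_jy^{N-j}$, $S_+$ is the part with non-negative powers of $y$; this is applied entrywise on $\mathrm{Mat}(d,\mathbb C)\otimes\mathcal P$. $E_\gamma$ is the diagonal $d\times d$ matrix with $(E_\gamma)_{\beta\beta}=\delta_{\gamma\beta}$. Time derivatives are taken coefficientwise. **The hierarchy** is considered on elements $L=y+\sum_{l\ge0}f_ly^{-l}$, $R_\gamma=E_\gamma+\sum_{l\ge1}r_{l\gamma}y^{-l}$ of $\mathrm{Mat}(d,\mathbb C)\otimes\mathcal P$ satisfying $[L,R_\gamma]=0$, $R_\gamma R_\beta=\delta_{\gamma\beta}R_\gamma$, $\sum_\gamma R_\gamma=1$ (automatic for $L,R_\gamma$ of the form $L=MyM^{-1}$, $R_\gamma=ME_\gamma M^{-1}$, where $M\in\mathrm{Mat}(d,\mathbb C)\otimes\mathcal P$ is $1$ plus a series in negative powers of $y$). **Regularity.** With $|\lambda|=\sum_i\lambda_i$, $\lambda$ is assumed regular: $|\lambda|\neq0$ and $\lambda_i+\dots+\lambda_{j-1}\ne n|\lambda|$ for all $n\in\mathbb Z$, $1\le i<j\le m$. **Calogero--Moser space.** For $\alpha\in\mathbb N_0^m$ let $V_i=\mathbb C^{\alpha_i}$, $V=\bigoplus_iV_i$. Let $R$ be the vector space of collections of linear maps $X_i:V_i\to V_{i+1}$, $Y_i:V_{i+1}\to V_i$, $v_i:\mathbb C^d\to V_i$, $w_i:V_i\to\mathbb C^d$ ($i\in I$), with symplectic form $\omega=\sum_i(\mathrm{tr}(\mathrm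 dY_i\wedge\mathrm dX_i)+\mathrm{tr}(\mathrm dw_i\wedge\mathrm dv_i))$. All maps are extended by zero to $V$; $X=\sum X_i$, $Y=\sum Y_i$. $\mathcal C_{\alpha,\lambda}$ is the quotient of $\{Y_iX_i-X_{i-1}Y_{i-1}-v_iw_i=\lambda_i1_{V_i}\}\subset R$ by $\prod_i\mathrm{GL}(\alpha_i,\mathbb C)$ acting by $(X,Y,v_i,w_i)\mapsto(gXg^{-1},gYg^{-1},gv_i,w_ig^{-1})$, with the symplectic structure given by Hamiltonian reduction. The flows in the claim are the (pairwise commuting) Hamiltonian flows of $H_{k,\beta}=-\sum_{i\in I}\mathrm{tr}(E_\beta w_iY^kv_{i+k})$; they descend to $\mathcal C_{\alpha,\lambda}$. **Interpretation.** Elements of $\mathcal P$ commute with linear maps between $V$ and $\mathbb C^d$; $(X-x1_V)^{-1}\in\mathbb C(x)\otimes\mathrm{End}\,V$, $(Y-y1_V)^{-1}:=-\sum_{k\ge0}Y^ky^{-k-1}$. Thus $\epsilon_iw_i(X-x1_V)^{-1}(Y-y1_V)^{-1}v_j\epsilon_j=-\sum_{k\ge0}\epsilon_i\big(w_i(X-x1_V)^{-1}Y^kv_j\big)y^{-k-1}\epsilon_j\in\mathrm{Mat}(d,\mathbb C)\otimes\mathcal P$. $M$ is $1$ plus a series in negative powers of $y$, hence invertible. *)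

(* Defs.v *)
From HB Require Import structures.
From mathcomp Require Import all_boot all_order all_algebra.
From mathcomp Require Import zify ring.
From mathcomp Require Import all_classical all_reals all_analysis.
From mathcomp Require Export complex.
Set Implicit Arguments. Unset Strict Implicit. Unset Printing Implicit Defensive.
Import Order.TTheory GRing.Theory Num.Theory.
Import numFieldNormedType.Exports.
Local Open Scope classical_set_scope.
Local Open Scope ring_scope.

Section SumLemmas.
Variable V : nmodType.
Implicit Type G : nat -> nat -> V.

Lemma sum_triangle k G :
  \sum_(0 <= e < k.+1) \sum_(0 <= j < e.+1) G e j
  = \sum_(0 <= j < k.+1) \sum_(0 <= e < (k - j).+1) G (e + j)%N j.
Proof.
elim: k => [|k IH]; first by rewrite !big_nat1.
rewrite big_nat_recr //= IH [RHS]big_nat_recr //= subnn big_nat1 add0n.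
rewrite [X in _ + X]big_nat_recr //= addrA -big_split /=; congr (_ + _).
apply: eq_big_nat => j /andP[_ jk].
by rewrite subSn // [RHS]big_nat_recr //= addSn subnK.
Qed.

Lemma sum_triangleC k G :
  \sum_(0 <= e < k.+1) \sum_(0 <= r < (k - e).+1) G e r
  = \sum_(0 <= r < k.+1) \sum_(0 <= e < (k - r).+1) G e r.
Proof.
have split_last n H :
    \sum_(0 <= e < n.+1) \sum_(0 <= r < (n.+1 - e).+1) H e r
    = \sum_(0 <= e < n.+1) \sum_(0 <= r < (n - e).+1) H e r
      + \sum_(0 <= e < n.+1) H e (n.+1 - e)%N :> V.
  rewrite -big_split /=; apply: eq_big_nat => e /andP[_ ek].
  by rewrite subSn // big_nat_recr.
elim: k => [|k IH]; first by rewrite !big_nat1.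
rewrite big_nat_recr //= [RHS]big_nat_recr //= !subnn !big_nat1.
rewrite split_last (split_last k (fun r e => G e r)) IH -!addrA; congr (_ + _).
have -> : G k.+1 0%N = G k.+1 (k.+1 - k.+1)%N by rewrite subnn.
have -> : G 0%N k.+1 = G (k.+1 - k.+1)%N k.+1 by rewrite subnn.
rewrite -(big_nat_recr k.+1 0%N (fun e => G e (k.+1 - e)%N)) //=.
rewrite -(big_nat_recr k.+1 0%N (fun e => G (k.+1 - e)%N e)) //=.
rewrite big_nat_rev /=; apply: eq_big_nat => e /andP[_ ek].
by rewrite add0n subSS subKn.
Qed.
End SumLemmas.

(* Data of the commutation rule y f = ore_sg f y + ore_d f, with ore_th inverse
   to ore_sg. *)
Record ore_data (A : pzRingType) := OreData {
  ore_sg : A -> A;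
  ore_th : A -> A;
  ore_d : A -> A;
  ore_sgD : {morph ore_sg : f g / f + g};
  ore_sgM : {morph ore_sg : f g / f * g};
  ore_sgK : cancel ore_sg ore_th;
  ore_thK : cancel ore_th ore_sg;
  ore_dD : {morph ore_d : f g / f + g};
  ore_dM : forall f g, ore_d (f * g) = ore_d f * g + ore_sg f * ore_d g }.

Section YPow.
Variables (A : pzRingType) (S : ore_data A).
Local Notation sg := (ore_sg S).
Local Notation th := (ore_th S).
Local Notation dl := (ore_d S).

(* y^a f = \sum_(p >= 0) ypow a p f y^(a - p), obtained by iterating
   y f = sg f y + d f and y^-1 f = \sum_(p >= 0) (-1)^p (th d)^p (th f) y^(-1 - p);
   ystep and ystepV are these two rules, ycomp composes them. *)
Definition ystep (p : nat) (f : A) : A :=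
  match p with 0 => sg f | 1 => dl f | _ => 0 end.
Definition ystepV (p : nat) (f : A) : A :=
  (-1) ^+ p * iter p (fun g => th (dl g)) (th f).
Definition yid (p : nat) (f : A) : A := if p is 0 then f else 0.
Definition ycomp (u v : nat -> A -> A) (p : nat) (f : A) : A :=
  \sum_(0 <= q < p.+1) u q (v (p - q)%N f).
Definition ypow (a : int) : nat -> A -> A :=
  match a with
  | Posz n => iter n (ycomp ystep) yid
  | Negz n => iter n.+1 (ycomp ystepV) yid
  end.

Definition yadd (u : nat -> A -> A) := forall p, {morph u p : f g / f + g}.

Lemma morph0 (u : A -> A) : {morph u : f g / f + g} -> u 0 = 0.
Proof. by move=> uD; apply: (addrI (u 0)); rewrite -uD !addr0. Qed.
Lemma morph_sum (u : A -> A) : {morph u : f g / f + g} ->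
  forall m n (F : nat -> A),
  u (\sum_(m <= i < n) F i) = \sum_(m <= i < n) u (F i).
Proof. by move=> uD m n F; apply: big_morph => //; exact: morph0. Qed.
Lemma morphN (u : A -> A) : {morph u : f g / f + g} -> {morph u : f / - f}.
Proof. by move=> uD f; apply: (addrI (u f)); rewrite -uD !subrr morph0. Qed.

Lemma ore_thD : {morph th : f g / f + g}.
Proof. by move=> f g; rewrite -{1}[f](ore_thK S) -{1}[g](ore_thK S) -ore_sgD ore_sgK. Qed.

Lemma ystep_add : yadd ystep.
Proof.
move=> [|[|p]] f g /=; rewrite ?addr0 //; [exact: ore_sgD | exact: ore_dD].
Qed.
Lemma ystepV_add : yadd ystepV.
Proof.
move=> p f g; rewrite /ystepV -mulrDr; congr (_ * _).
elim: p => [|p IH] /=; first exact: ore_thD.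
by rewrite IH ore_dD ore_thD.
Qed.
Lemma yid_add : yadd yid.
Proof. by case=> [|p] f g //=; rewrite addr0. Qed.
Lemma ycomp_add u v : yadd u -> yadd v -> yadd (ycomp u v).
Proof.
move=> uD vD p f g; rewrite /ycomp -big_split /=.
by apply: eq_bigr => q _; rewrite vD uD.
Qed.
Lemma ypow_add a : yadd (ypow a).
Proof.
have iter_add u : yadd u -> forall n, yadd (iter n (ycomp u) yid).
  by move=> uD; elim=> [|n IH]; [exact: yid_add | exact: ycomp_add].
by case: a => n; apply: iter_add; [exact: ystep_add | exact: ystepV_add].
Qed.

Lemma ycompA u v w : yadd u ->
  forall p f, ycomp (ycomp u v) w p f = ycomp u (ycomp v w) p f.
Proof.
move=> uD p f; rewrite /ycomp.
rewrite (sum_triangle _ (fun q j => u j (v (q - j)%N (w (p - q)%N f)))).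
apply: eq_bigr => j _; rewrite morph_sum //.
by apply: eq_bigr => e _; rewrite addnK subnDA subnAC.
Qed.
Lemma ycomp1 u : yadd u -> forall p f, ycomp u yid p f = u p f.
Proof.
move=> uD p f; rewrite /ycomp big_nat_recr //= subnn big_nat_cond big1 ?add0r //.
by move=> q /andP[/andP[_ qp] _]; rewrite -(subnSK qp) /= morph0.
Qed.
Lemma ycompI v : forall p f, ycomp yid v p f = v p f.
Proof. by move=> p f; rewrite /ycomp big_nat_recl //= subn0 big1 ?addr0. Qed.
Lemma eq_ycomp u u' v v' : (forall p f, u p f = u' p f) ->
  (forall p f, v p f = v' p f) -> forall p f, ycomp u v p f = ycomp u' v' p f.
Proof. by move=> eu ev p f; apply: eq_bigr => q _; rewrite eu ev. Qed.

Lemma ystepK p f : ycomp ystep ystepV p f = yid p f.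
Proof.
rewrite /ycomp; case: p => [|p]; first by rewrite big_nat1 /= /ystepV expr0 mul1r ore_thK.
rewrite big_nat_recl //= big_nat_recl //= big1 ?addr0 // subn0 subSS subn0.
rewrite /ystepV /= exprS -mulrA mulN1r morphN; last exact: ore_sgD.
have sgnM (u : A -> A) : {morph u : f g / f + g} ->
    forall g, u ((-1) ^+ p * g) = (-1) ^+ p * u g.
  move=> uD g; elim: (p) => [|k IH]; first by rewrite !expr0 !mul1r.
  by rewrite !exprS -!mulrA !mulN1r morphN // IH.
rewrite (sgnM _ (ore_sgD S)) (sgnM _ (ore_dD S)) ore_thK addNr //.
Qed.

Lemma ystep_inj u v : (forall p f, ycomp ystep u p f = ycomp ystep v p f) ->
  forall p f, u p f = v p f.
Proof.
move=> e; elim=> [|p IH] f.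
  by have := e 0%N f; rewrite /ycomp !big_nat1 /= => /(can_inj (ore_sgK S)).
have := e p.+1 f; rewrite /ycomp !(big_nat_recl p.+1) //= !(big_nat_recl p) //=.
rewrite !big1 // !addr0 !subn0 !subSS !subn0 IH.
by move=> /addIr /(can_inj (ore_sgK S)).
Qed.
Lemma ystepVK p f : ycomp ystepV ystep p f = yid p f.
Proof.
move: p f; apply: ystep_inj => p f.
rewrite -ycompA ?ycomp1; try exact: ystep_add.
by rewrite -[RHS]ycompI; apply: eq_ycomp => // ? ?; exact: ystepK.
Qed.

Lemma ypowS a p f : ypow (a + 1) p f = ycomp ystep (ypow a) p f.
Proof.
case: a => [n|n]; first by rewrite -PoszD addn1.
have -> : Negz n + 1 = - (n%:Z) by rewrite NegzE; lia.
have -> : ypow (- n%:Z) p f = iter n (ycomp ystepV) yid p f.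
  by case: n => [|n] //=; rewrite -NegzE.
rewrite /= -ycompA; last exact: ystep_add.
rewrite -[LHS]ycompI; apply: eq_ycomp => // ? ?; by rewrite ystepK.
Qed.

Lemma ypowD a b p f : ypow (a + b) p f = ycomp (ypow a) (ypow b) p f.
Proof.
elim/int_rec: a p f => [|n IH|n IH] p f.
- by rewrite add0r ycompI.
- rewrite -addn1 PoszD addrAC ypowS -(@eq_ycomp (ycomp ystep (ypow n%:Z)) _ (ypow b) (ypow b)) //.
    rewrite ycompA; last exact: ystep_add.
    exact: eq_ycomp.
  by move=> q g; rewrite -ypowS.
- move: p f; apply: ystep_inj => p f.
  rewrite -ypowS -ycompA; last exact: ystep_add.
  have -> : - (n.+1)%:Z + b + 1 = - n%:Z + b by lia.
  rewrite IH; apply: eq_ycomp => // q g; rewrite -ypowS.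
  by congr (ypow _ q g); lia.
Qed.

Lemma ypow0E a f : ypow (a + 1) 0 f = sg (ypow a 0 f).
Proof. by rewrite ypowS /ycomp big_nat1. Qed.
Lemma ypowSE a p f : ypow (a + 1) p.+1 f = sg (ypow a p.+1 f) + dl (ypow a p f).
Proof.
by rewrite ypowS /ycomp big_nat_recl //= big_nat_recl //= big1 // addr0 subn0 subSS subn0.
Qed.

Definition yleib a p f g :=
  \sum_(0 <= q < p.+1) ypow a q f * ypow (a - q%:Z) (p - q)%N g.

Lemma yleib0 a f g : yleib (a + 1) 0 f g = sg (yleib a 0 f g).
Proof. by rewrite /yleib !big_nat1 /= !subr0 !ypow0E ore_sgM. Qed.
Lemma yleibS a p f g :
  yleib (a + 1) p.+1 f g = sg (yleib a p.+1 f g) + dl (yleib a p f g).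
Proof.
have shift b q h : ypow (b + 1) q h
    = sg (ypow b q h) + (if q is r.+1 then dl (ypow b r h) else 0).
  by case: q => [|q]; rewrite ?ypow0E ?ypowSE ?addr0.
rewrite /yleib (morph_sum (ore_sgD S)) (morph_sum (ore_dD S)).
under eq_bigr => q _ do rewrite shift mulrDl.
under [X in _ = _ + X]eq_bigr => q _ do rewrite ore_dM.
rewrite !big_split /= [X in _ + X = _]big_nat_recl //= mul0r add0r.
have -> : \sum_(0 <= i < p.+1) dl (ypow a i f) * ypow (a + 1 - i.+1%:Z) (p.+1 - i.+1) g
  = \sum_(0 <= i < p.+1) dl (ypow a i f) * ypow (a - i%:Z) (p - i) g.
  apply: eq_bigr => i _; rewrite subSS; congr (_ * ypow _ _ _); lia.
rewrite [RHS]addrCA [LHS]addrC; congr (_ + _).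
under eq_bigr => q _ do rewrite addrAC shift mulrDr.
rewrite big_split /=; congr (_ + _).
  by apply: eq_bigr => q _; rewrite ore_sgM.
rewrite big_nat_recr //= subnn mulr0 addr0.
by apply: eq_big_nat => q /andP[_ qp]; rewrite subSn.
Qed.

Lemma ypow_leib a p f g : ypow a p (f * g) = yleib a p f g.
Proof.
elim/int_rec: a p => [|n IH|n IH] p.
- rewrite /yleib big_nat_recl //= big1 ?addr0; last by move=> *; rewrite mul0r.
  by rewrite subn0; case: p => [|p] //=; rewrite mulr0.
- rewrite -addn1 PoszD; case: p => [|p].
    by rewrite ypow0E IH yleib0.
  by rewrite ypowSE !IH yleibS.
- have eS : - n%:Z = - n.+1%:Z + 1 by lia.
  rewrite eS in IH; elim: p => [|p IHp]; apply: (can_inj (ore_sgK S)).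
    by rewrite -ypow0E IH yleib0.
  by apply: (addIr (dl (yleib (- n.+1%:Z) p f g))); rewrite -{1}IHp -ypowSE IH yleibS.
Qed.
End YPow.

(* The series \sum_n (pcoef n) y^n, with finitely many positive powers of y. *)
Record psdo (A : pzRingType) (S : ore_data A) := Psdo {
  pcoef :> int -> A;
  psdoP : exists N : int, forall n, N < n -> pcoef n = 0 }.

Arguments Psdo {A S}.

HB.instance Definition _ A S := gen_eqMixin (@psdo A S).
HB.instance Definition _ A S := gen_choiceMixin (@psdo A S).

Section PsdoRing.
Variables (A : pzRingType) (S : ore_data A).
Local Notation psdo := (psdo S).
Implicit Types (F G H : psdo) (f g : int -> A) (N M n : int).

Lemma psdo_eq F G : (forall n, F n = G n) -> F = G.
Proof.
case: F G => [f fP] [g gP] /= /funext efg; rewrite efg in fP *.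
by congr Psdo; exact: Prop_irrelevance.
Qed.

Definition pbounded N f := forall n, N < n -> f n = 0.
Lemma pbounded_le N N' f : N <= N' -> pbounded N f -> pbounded N' f.
Proof. by move=> le b n lt; apply: b; exact: le_lt_trans lt. Qed.

Definition pbound F : int := projT1 (cid (psdoP F)).
Lemma pboundP F : pbounded (pbound F) F.
Proof. exact: projT2 (cid (psdoP F)). Qed.

(* Coefficient of y^n in \sum_(j, l) f_(N-j) y^(N-j) g_(M-l) y^(M-l), for f and g
   vanishing above N and M; it does not depend on the choice of N and M. *)
Definition pconv N M f g n : A :=
  if N + M - n is Posz k then
    \sum_(0 <= j < k.+1) \sum_(0 <= l < (k - j).+1)
       f (N - j%:Z) * ypow S (N - j%:Z) (k - j - l) (g (M - l%:Z))
  else 0.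

Lemma ypow0r a p : ypow S a p 0 = 0.
Proof. by apply: morph0; exact: ypow_add. Qed.

Lemma pconvS1 N M f g n : pbounded N f -> pconv (N + 1) M f g n = pconv N M f g n.
Proof.
move=> fN; rewrite /pconv.
have f1 : f (N + 1) = 0 by apply: fN; lia.
case E : (N + M - n) => [k|k].
  have -> : N + 1 + M - n = k.+1 by lia.
  rewrite big_nat_recl //= big1 ?add0r; last by move=> l _; rewrite subr0 f1 mul0r.
  apply: eq_bigr => j _; rewrite subSS.
  by have -> : N + 1 - j.+1%:Z = N - j%:Z by lia.
case: k E => [|k] E.
  have -> : N + 1 + M - n = Posz 0 by lia.
  by rewrite !big_nat1 !subr0 f1 mul0r.
by have -> : N + 1 + M - n = Negz k by lia.
Qed.

Lemma pconvS2 N M f g n : pbounded M g -> pconv N (M + 1) f g n = pconv N M f g n.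
Proof.
move=> gM; rewrite /pconv.
have g1 : g (M + 1) = 0 by apply: gM; lia.
case E : (N + M - n) => [k|k].
  have -> : N + (M + 1) - n = k.+1 by lia.
  rewrite sum_triangleC big_nat_recl //= big1 ?add0r; last first.
    by move=> l _; rewrite subr0 g1 ypow0r mulr0.
  rewrite [RHS]sum_triangleC; apply: eq_bigr => l _; rewrite subSS.
  apply: eq_bigr => j _; congr (_ * ypow _ _ _ _); first by lia.
  by congr (g _); lia.
case: k E => [|k] E.
  have -> : N + (M + 1) - n = Posz 0 by lia.
  by rewrite !big_nat1 !subr0 g1 ypow0r mulr0.
by have -> : N + (M + 1) - n = Negz k by lia.
Qed.

Lemma pconv_le N M N' M' f g n : N <= N' -> M <= M' ->
  pbounded N f -> pbounded M g -> pconv N' M' f g n = pconv N M f g n.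
Proof.
move=> NN' MM' fN gM.
have [a ->] : exists a : nat, N' = N + a%:Z by exists (absz (N' - N)); lia.
have [b ->] : exists b : nat, M' = M + b%:Z by exists (absz (M' - M)); lia.
elim: a => [|a <-].
  rewrite addr0; elim: b => [|b <-]; first by rewrite addr0.
  rewrite -addn1 PoszD addrA pconvS2 //.
  by apply: pbounded_le gM; lia.
rewrite -addn1 PoszD addrA pconvS1 //.
by apply: pbounded_le fN; lia.
Qed.

Lemma pconv_bounded N M f g : pbounded (N + M) (pconv N M f g).
Proof.
move=> n lt; rewrite /pconv; case E: (N + M - n) => [k|//].
by exfalso; move: lt; lia.
Qed.

Lemma pconv_psdoP N M f g :
  exists B : int, forall n, B < n -> pconv N M f g n = 0.
Proof. by exists (N + M); exact: pconv_bounded. Qed.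

Definition pmul F G : psdo := Psdo _ (pconv_psdoP (pbound F) (pbound G) F G).

Lemma pmulE N M F G n : pbounded N F -> pbounded M G ->
  pmul F G n = pconv N M F G n.
Proof.
move=> FN GM /=.
rewrite -(@pconv_le N M (Num.max N (pbound F)) (Num.max M (pbound G))) ?le_max ?lexx //.
by rewrite -(@pconv_le (pbound F) (pbound G) (Num.max N (pbound F)) (Num.max M (pbound G)))
  ?le_max ?lexx ?orbT //; exact: pboundP.
Qed.

Lemma pmul_coef N M F G (k : nat) : pbounded N F -> pbounded M G ->
  pmul F G (N + M - k%:Z) =
    \sum_(0 <= j < k.+1) \sum_(0 <= l < (k - j).+1)
       F (N - j%:Z) * ypow S (N - j%:Z) (k - j - l) (G (M - l%:Z)).
Proof. by move=> FN GM; rewrite (pmulE _ FN GM) /pconv opprB addrC subrK. Qed.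

Lemma pmul_bounded N M F G : pbounded N F -> pbounded M G ->
  pbounded (N + M) (pmul F G).
Proof. by move=> FN GM n; rewrite (pmulE n FN GM); exact: pconv_bounded. Qed.

Definition padd F G : psdo.
Proof.
exists (fun n => F n + G n); exists (Num.max (pbound F) (pbound G)) => n.
by rewrite gt_max => /andP[nF nG]; rewrite !pboundP ?addr0.
Defined.
Definition popp F : psdo.
Proof. by exists (fun n => - F n); exists (pbound F) => n lt; rewrite pboundP ?oppr0. Defined.

(* the series [f y^n] *)
Definition pmon (m : int) (f : A) : psdo.
Proof.
by exists (fun n => if n == m then f else 0); exists m => n lt; rewrite gt_eqF.
Defined.

Lemma paddA : associative padd.
Proof. by move=> F G H; apply: psdo_eq => n /=; rewrite addrA. Qed.
Lemma paddC : commutative padd.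
Proof. by move=> F G; apply: psdo_eq => n /=; rewrite addrC. Qed.
Lemma padd0 : left_id (pmon 0 0) padd.
Proof. by move=> F; apply: psdo_eq => n /=; rewrite if_same add0r. Qed.
Lemma paddN : left_inverse (pmon 0 0) popp padd.
Proof. by move=> F; apply: psdo_eq => n /=; rewrite if_same addNr. Qed.
HB.instance Definition _ := GRing.isZmodule.Build psdo paddA paddC padd0 paddN.

Lemma pbounded_ext F n : exists2 N, pbounded N F & n <= N.
Proof.
exists (Num.max (pbound F) n); last by rewrite le_max lexx orbT.
by apply: pbounded_le (@pboundP F); rewrite le_max lexx.
Qed.

Lemma pmul1 : left_id (pmon 0 1) pmul.
Proof.
move=> F; apply: psdo_eq => n.
have [N FN nN] := pbounded_ext F n.
have b1 : pbounded 0 (pmon 0 1) by move=> i lt /=; rewrite gt_eqF.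
have [k ->] : exists k : nat, n = 0 + N - k%:Z by exists (absz (N - n)); lia.
rewrite (pmul_coef _ b1 FN) big_nat_recl //= [X in _ + X]big1 ?addr0; last first.
  by move=> j _; rewrite big1 // => l _; rewrite mul0r.
rewrite subn0 big_nat_recr //= subnn big_nat_cond big1 ?add0r ?mul1r //.
move=> l /andP[/andP[_ lk] _]; rewrite mul1r.
by rewrite -(subnSK lk) /=.
Qed.

Lemma pmulr1 : right_id (pmon 0 1) pmul.
Proof.
have yp1 a p : ypow S a p 1 = if p is 0 then 1 else 0.
  have sg1 : ore_sg S 1 = 1.
    by rewrite -[LHS]mulr1 -{2}[1](ore_thK S) -ore_sgM mul1r ore_thK.
  have d1 : ore_d S 1 = 0.
    by apply: (addrI (ore_d S 1)); rewrite addr0 -{3}[1]mulr1 ore_dM sg1 mulr1 mul1r.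
  elim/int_rec: a p => [|n IH|n IH] p //.
  - rewrite -addn1 PoszD; case: p => [|p]; first by rewrite ypow0E IH.
    rewrite ypowSE !IH (morph0 (ore_sgD S)) add0r.
    by case: p => [|p] //; rewrite (morph0 (ore_dD S)).
  - have eS : - n%:Z = - n.+1%:Z + 1 by lia.
    rewrite eS in IH; elim: p => [|p IHp]; apply: (can_inj (ore_sgK S)).
      by rewrite -ypow0E IH sg1.
    rewrite (morph0 (ore_sgD S)); have := IH p.+1; rewrite ypowSE IHp.
    by case: (p) => [|q]; rewrite ?d1 ?(morph0 (ore_dD S)) addr0.
move=> F; apply: psdo_eq => n.
have [N FN nN] := pbounded_ext F n.
have b1 : pbounded 0 (pmon 0 1) by move=> i lt /=; rewrite gt_eqF.
have [k ->] : exists k : nat, n = N + 0 - k%:Z by exists (absz (N - n)); lia.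
rewrite (pmul_coef _ FN b1) sum_triangleC big_nat_recl //= [X in _ + X]big1 ?addr0; last first.
  by move=> l _; rewrite big1 // => j _; rewrite ypow0r mulr0.
rewrite subn0 big_nat_recr //= !subnn big_nat_cond big1 ?add0r ?yp1 ?mulr1 //.
move=> j /andP[/andP[_ jk] _].
by rewrite yp1 subn0 -(subnSK jk) mulr0.
Qed.

Lemma pmulDl : left_distributive pmul +%R.
Proof.
move=> F G H; apply: psdo_eq => n.
have [N FN nN] := pbounded_ext F (pbound G).
have GN := pbounded_le nN (@pboundP G).
have FGN : pbounded N (F + G) by move=> i lt /=; rewrite FN ?GN ?addr0.
have HM := @pboundP H; rewrite (pmulE n FGN HM).
change (pconv N (pbound H) (padd F G) H n = pmul F H n + pmul G H n).
rewrite (pmulE n FN HM) (pmulE n GN HM).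
rewrite /pconv; case: (_ - n) => [k|k]; last by rewrite addr0.
rewrite -big_split /=; apply: eq_bigr => j _; rewrite -big_split /=.
by apply: eq_bigr => l _; rewrite mulrDl.
Qed.

Lemma pmulDr : right_distributive pmul +%R.
Proof.
move=> H F G; apply: psdo_eq => n.
have [N FN nN] := pbounded_ext F (pbound G).
have GN := pbounded_le nN (@pboundP G).
have FGN : pbounded N (F + G) by move=> i lt /=; rewrite FN ?GN ?addr0.
have HM := @pboundP H; rewrite (pmulE n HM FGN).
change (pconv (pbound H) N H (padd F G) n = pmul H F n + pmul H G n).
rewrite (pmulE n HM FN) (pmulE n HM GN).
rewrite /pconv; case: (_ - n) => [k|k]; last by rewrite addr0.
rewrite -big_split /=; apply: eq_bigr => j _; rewrite -big_split /=.
by apply: eq_bigr => l _; rewrite ypow_add mulrDr.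
Qed.

Lemma pmulA : associative pmul.
Proof.
move=> F G H; apply: psdo_eq => n.
have [N FN _] := pbounded_ext F 0.
have [M GM _] := pbounded_ext G 0.
have [K HK nK] := pbounded_ext H (n - N - M).
have FG := pmul_bounded FN GM; have GH := pmul_bounded GM HK.
have [k] : exists k : nat, n = N + (M + K) - k%:Z.
  by exists (absz (N + (M + K) - n)%R); lia.
move=> ->; rewrite (pmul_coef _ FN GH) addrA (pmul_coef _ FG HK).
have expandl j : (j < k.+1)%N ->
  \sum_(0 <= e < (k - j).+1)
     F (N - j%:Z) * ypow S (N - j%:Z) (k - j - e) (pmul G H (M + K - e%:Z))
  = \sum_(0 <= l < (k - j).+1) \sum_(0 <= r < (k - j - l).+1)
    \sum_(0 <= q < (k - j - l - r).+1)
      F (N - j%:Z) * (ypow S (N - j%:Z) q (G (M - l%:Z)) *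
      ypow S (N + M - j%:Z - l%:Z - q%:Z) (k - j - l - r - q) (H (K - r%:Z))).
  move=> jk.
  under eq_bigr => e _.
    rewrite (pmul_coef _ GM HK) (morph_sum (@ypow_add _ S _ _)) mulr_sumr.
    over.
  rewrite (sum_triangle _ (fun e l => F (N - j%:Z) * ypow S (N - j%:Z) (k - j - e)
     (\sum_(0 <= r < (e - l).+1) G (M - l%:Z) * ypow S (M - l%:Z) (e - l - r) (H (K - r%:Z))))).
  apply: eq_bigr => l _.
  under eq_bigr => e _.
    rewrite addnK (morph_sum (@ypow_add _ S _ _)) mulr_sumr; over.
  rewrite sum_triangle; apply: eq_bigr => r _.
  under eq_bigr => e _.
    rewrite ypow_leib /yleib mulr_sumr addnK.
    have -> : (k - j - (e + r + l) = k - j - l - r - e)%N by lia.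
    over.
  rewrite sum_triangleC; apply: eq_bigr => q _.
  rewrite -mulr_sumr; congr (_ * _); rewrite -mulr_sumr; congr (_ * _).
  have -> : N + M - j%:Z - l%:Z - q%:Z = (N - j%:Z - q%:Z) + (M - l%:Z) by lia.
  rewrite ypowD /ycomp [RHS]big_nat_rev /= add0n.
  apply: eq_big_nat => e /andP[_ le].
  rewrite subSS subKn //; congr (ypow _ _ _ _); lia.
rewrite (eq_big_nat _ _ (fun j (jk : (0 <= j < k.+1)%N) => expandl j (proj2 (andP jk)))) {expandl}.
have expandr r : (r < k.+1)%N ->
  \sum_(0 <= e < (k - r).+1)
     pmul F G (N + M - e%:Z) * ypow S (N + M - e%:Z) (k - e - r) (H (K - r%:Z))
  = \sum_(0 <= j < (k - r).+1) \sum_(0 <= l < (k - j - r).+1)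
    \sum_(0 <= q < (k - j - l - r).+1)
      F (N - j%:Z) * (ypow S (N - j%:Z) q (G (M - l%:Z)) *
      ypow S (N + M - j%:Z - l%:Z - q%:Z) (k - j - l - r - q) (H (K - r%:Z))).
  move=> rk.
  under eq_bigr => e _.
    rewrite (pmul_coef _ FN GM) mulr_suml; over.
  rewrite (sum_triangle _ (fun e j => (\sum_(0 <= l < (e - j).+1)
     F (N - j%:Z) * ypow S (N - j%:Z) (e - j - l) (G (M - l%:Z))) *
     ypow S (N + M - e%:Z) (k - e - r) (H (K - r%:Z)))).
  apply: eq_bigr => j _.
  under eq_bigr => e _.
    rewrite addnK mulr_suml; over.
  have -> : (k - j - r = k - r - j)%N by lia.
  rewrite sum_triangle; apply: eq_bigr => l _.
  have -> : (k - r - j - l = k - j - l - r)%N by lia.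
  apply: eq_bigr => q _; rewrite addnK mulrA; congr (_ * ypow _ _ _ _); lia.
rewrite [in RHS]sum_triangleC.
rewrite [RHS](eq_big_nat _ _ (fun r (rk : (0 <= r < k.+1)%N) => expandr r (proj2 (andP rk)))) {expandr}.
rewrite [in RHS]sum_triangleC; apply: eq_bigr => j _.
by rewrite sum_triangleC; apply: eq_bigr.
Qed.

HB.instance Definition _ := GRing.Zmodule_isPzRing.Build psdo
  pmulA pmul1 pmulr1 pmulDl pmulDr.
End PsdoRing.

Section PsdoRules.
Variables (A : pzRingType) (S : ore_data A).

Lemma pmon_mul (a b : int) (f g : A) (p : nat) :
  (pmon S a f * pmon S b g) (a + b - p%:Z) = f * ypow S a p g.
Proof.
have ba c h : pbounded c (pmon S c h) by move=> i lt /=; rewrite gt_eqF.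
rewrite (pmul_coef _ (ba a f) (ba b g)) big_nat_recl //= [X in _ + X]big1 ?addr0; last first.
  move=> j _; rewrite big1 // => l _.
  by case: eqP => [e|_]; rewrite ?mul0r //; exfalso; move: e; lia.
rewrite subn0 big_nat_recl //= [X in _ + X]big1 ?addr0; last first.
  move=> l _; case: (b - _ =P b) => [e|_]; first by exfalso; move: e; lia.
  by rewrite ypow0r mulr0.
by rewrite !eqxx subn0.
Qed.

Lemma psdo_y_mul (f : A) :
  pmon S 1 1 * pmon S 0 f = pmon S 1 (ore_sg S f) + pmon S 0 (ore_d S f).
Proof.
apply: psdo_eq => n /=; case: (ltrP 1 n) => [lt|le].
  have b1 : pbounded 1 (pmon S 1 1) by move=> i ? /=; rewrite gt_eqF.
  have b0 : pbounded 0 (pmon S 0 f) by move=> i ? /=; rewrite gt_eqF.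
  rewrite [LHS](pmul_bounded b1 b0) ?addr0 // !gt_eqF ?addr0 //.
  exact: lt_trans lt.
have [p ->] : exists p : nat, n = 1 + 0 - p%:Z by exists (absz (1 - n)%R); lia.
rewrite [LHS]pmon_mul mul1r.
have -> q : ypow S 1 q f = ystep S q f by rewrite /= ycomp1 //; exact: ystep_add.
by case: p => [|[|p]] //=; rewrite ?addr0 ?add0r.
Qed.

Lemma psdo_yV_mul (f : A) (p : nat) :
  (pmon S (-1) 1 * pmon S 0 f) (- 1 - p%:Z)
  = (-1) ^+ p * iter p (fun g => ore_th S (ore_d S g)) (ore_th S f).
Proof.
have := @pmon_mul (-1) 0 1 f p; rewrite addr0 mul1r => ->.
by rewrite [ypow _ _ _ _]ycomp1 //; exact: ystepV_add.
Qed.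

(* [S_+] *)
Definition pplus (F : psdo S) : psdo S.
Proof.
exists (fun n => if 0 <= n then F n else 0).
by exists (pbound F) => n lt; rewrite pboundP // if_same.
Defined.
End PsdoRules.

Section RationalFunctions.
Variable K : fieldType.
Local Notation ratfun := {fraction {poly K}}.

Definition ratc (c : K) : ratfun := tofrac c%:P.
Definition ratx : ratfun := tofrac 'X.
(* numerator and denominator of some representative of f *)
Definition ratnum (f : ratfun) : {poly K} := (repr f).1.
Definition ratden (f : ratfun) : {poly K} := (repr f).2.

(* f |-> f (c x), for c != 0; see ratscale_frac *)
Definition ratscale (c : K) (f : ratfun) : ratfun :=
  tofrac (ratnum f \Po (c *: 'X)) / tofrac (ratden f \Po (c *: 'X)).
Definition ratder (f : ratfun) : ratfun :=
  tofrac ((ratnum f)^`() * ratden f - ratnum f * (ratden f)^`())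
  / tofrac (ratden f ^+ 2).

(* z is not a pole of f and f z = v *)
Definition rateval (f : ratfun) (z v : K) : Prop :=
  exists p q : {poly K}, [/\ q.[z] != 0, f = tofrac p / tofrac q & v = p.[z] / q.[z]].

Lemma ratden_neq0 f : ratden f != 0.
Proof. exact: denom_ratioP. Qed.

Lemma tofrac_neq0 (p : {poly K}) : p != 0 -> tofrac p != 0 :> ratfun.
Proof. by rewrite tofrac_eq0. Qed.

Lemma ratE f : f = tofrac (ratnum f) / tofrac (ratden f).
Proof.
apply: (mulIf (tofrac_neq0 (ratden_neq0 f))); rewrite divfK ?tofrac_neq0 ?ratden_neq0 //.
rewrite /ratnum /ratden -{1}[f]reprK; unlock FracField.tofrac.
rewrite -[LHS]FracField.pi_mul; apply/eqP; rewrite eqmodE /=.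
rewrite FracField.equivfE /FracField.mulf.
by rewrite !numden_Ratio ?mulr1 ?oner_neq0 ?mulf_neq0 ?denom_ratioP // mulrC.
Qed.

Lemma tofrac_frac_eq (a b c d : {poly K}) : b != 0 -> d != 0 ->
  (tofrac a / tofrac b == tofrac c / tofrac d :> ratfun) = (a * d == c * b).
Proof. by move=> b0 d0; rewrite eqr_div ?tofrac_neq0 // -!rmorphM tofrac_eq. Qed.

Lemma ratscale_frac c (p q : {poly K}) : c != 0 -> q != 0 ->
  ratscale c (tofrac p / tofrac q) = tofrac (p \Po (c *: 'X)) / tofrac (q \Po (c *: 'X)).
Proof.
move=> c0 q0; set f := _ / _; apply/eqP.
have := ratE f; rewrite {1}/f => /eqP.
have sc0 r : r != 0 -> r \Po (c *: 'X) != 0 :> {poly K}.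
  move=> r0; apply: contra r0 => /eqP rc0; apply/eqP.
  have : (r \Po (c *: 'X)) \Po (c^-1 *: 'X) = 0 by rewrite rc0 comp_poly0.
  by rewrite -comp_polyA linearZ /= comp_polyX scalerA divff // scale1r comp_polyXr.
rewrite !tofrac_frac_eq ?sc0 ?ratden_neq0 // => /eqP e.
by rewrite -!rmorphM /= [X in _ == X \Po _]e.
Qed.
End RationalFunctions.

Section RationalFunctionsTheory.
Variable K : fieldType.
Local Notation ratfun := {fraction {poly K}}.
Implicit Types (f g : ratfun) (c : K).

Variant rat_spec : ratfun -> Prop :=
  RatSpec (p q : {poly K}) of q != 0 : rat_spec (tofrac p / tofrac q).
Lemma ratP f : rat_spec f.
Proof. by rewrite [f]ratE; apply: RatSpec; exact: ratden_neq0. Qed.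

Lemma scaleX_neq0 c (q : {poly K}) : c != 0 -> q != 0 -> q \Po (c *: 'X) != 0.
Proof.
move=> c0; apply: contra => /eqP qc0; apply/eqP.
have : (q \Po (c *: 'X)) \Po (c^-1 *: 'X) = 0 by rewrite qc0 comp_poly0.
by rewrite -comp_polyA linearZ /= comp_polyX scalerA divff // scale1r comp_polyXr.
Qed.

Lemma ratscaleD c : c != 0 -> {morph ratscale c : f g / f + g}.
Proof.
move=> c0 f g; case/ratP: f => p q q0; case/ratP: g => r s s0.
have sq := scaleX_neq0 c0 q0; have ss := scaleX_neq0 c0 s0.
rewrite addf_div ?tofrac_neq0 // -!tofracM -tofracD /= !ratscale_frac ?mulf_neq0 //.
by rewrite addf_div ?tofrac_neq0 // -!tofracM -tofracD comp_polyD !comp_polyM.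
Qed.

Lemma ratscaleM c : c != 0 -> {morph ratscale c : f g / f * g}.
Proof.
move=> c0 f g; case/ratP: f => p q q0; case/ratP: g => r s s0.
by rewrite mulf_div -!rmorphM /= !ratscale_frac ?mulf_neq0 // mulf_div -!tofracM !comp_polyM.
Qed.

Lemma ratscale_poly c (p : {poly K}) : c != 0 ->
  ratscale c (tofrac p) = tofrac (p \Po (c *: 'X)).
Proof.
move=> c0; have := @ratscale_frac _ c p 1 c0 (oner_neq0 _).
by rewrite !tofrac1 !divr1 => ->; rewrite comp_polyC tofrac1 divr1.
Qed.

Lemma ratscale_const c d : c != 0 -> ratscale c (ratc d) = ratc d.
Proof. by move=> c0; rewrite /ratc ratscale_poly // comp_polyC. Qed.
Lemma ratscale0 c : c != 0 -> ratscale c 0 = 0.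
Proof. by move=> c0; rewrite -tofrac0 ratscale_poly // comp_poly0. Qed.
Lemma ratscale1 c : c != 0 -> ratscale c 1 = 1.
Proof. by move=> c0; rewrite -tofrac1 ratscale_poly // -polyC1 comp_polyC. Qed.
Lemma ratscaleN c : c != 0 -> {morph ratscale c : f / - f}.
Proof.
move=> c0 f; apply: (addrI (ratscale c f)).
by rewrite -ratscaleD // !subrr ratscale0.
Qed.
Lemma ratscale_x c : c != 0 -> ratscale c (ratx K) = ratc c * ratx K.
Proof. by move=> c0; rewrite ratscale_poly // comp_polyX -mul_polyC rmorphM. Qed.
Lemma ratx_neq0 : ratx K != 0.
Proof. by rewrite tofrac_neq0 // polyX_eq0. Qed.
Lemma ratscale_xV c : c != 0 -> ratscale c (ratx K)^-1 = (ratc c)^-1 * (ratx K)^-1.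
Proof.
move=> c0; have cf0 : ratc c != 0 by rewrite tofrac_neq0 // polyC_eq0.
apply: (mulfI (mulf_neq0 cf0 ratx_neq0)).
by rewrite -ratscale_x // -ratscaleM // divff ?ratx_neq0 // ratscale1 // ratscale_x //
  mulrACA divff // divff ?ratx_neq0 // mulr1.
Qed.

Lemma ratscale_comp c d f : c != 0 -> d != 0 ->
  ratscale c (ratscale d f) = ratscale (c * d) f.
Proof.
move=> c0 d0; case/ratP: f => p q q0.
rewrite !ratscale_frac ?mulf_neq0 ?scaleX_neq0 //.
by rewrite -!comp_polyA comp_polyZ comp_polyX scalerA [d * c]mulrC.
Qed.

Lemma ratscale_id f : ratscale 1 f = f.
Proof.
case/ratP: f => p q q0.
by rewrite !ratscale_frac ?oner_neq0 // scale1r !comp_polyXr.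
Qed.

Lemma ratscale_sum c (I : Type) (r : seq I) (F : I -> ratfun) : c != 0 ->
  ratscale c (\sum_(i <- r) F i) = \sum_(i <- r) ratscale c (F i).
Proof.
move=> c0; apply: big_morph; [exact: ratscaleD | exact: ratscale0].
Qed.

Lemma ratder_frac (p q : {poly K}) : q != 0 ->
  ratder (tofrac p / tofrac q)
  = tofrac (p^`() * q - p * q^`()) / tofrac (q ^+ 2).
Proof.
move=> q0; set f := _ / _; apply/eqP.
have := ratE f; rewrite {1}/f => /eqP.
have d0 := ratden_neq0 f; rewrite /ratder.
move: (ratnum f) (ratden f) d0 => r s s0; clear f.
rewrite !tofrac_frac_eq ?expf_neq0 // => /eqP e; apply/eqP.
have := congr1 (@deriv _) e; rewrite !derivM => e'.
have -> : (r^`() * s - r * s^`()) * q ^+ 2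
    = (r^`() * q + r * q^`()) * (s * q) - (r * q) * (s^`() * q + s * q^`()) by ring.
have -> : (p^`() * q - p * q^`()) * s ^+ 2
    = (p^`() * s + p * s^`()) * (q * s) - (p * s) * (s^`() * q + s * q^`()) by ring.
by rewrite e e' [s * q]mulrC.
Qed.

Lemma ratderD : {morph @ratder K : f g / f + g}.
Proof.
move=> f g; case/ratP: f => p q q0; case/ratP: g => r s s0.
rewrite addf_div ?tofrac_neq0 // -!tofracM -tofracD /= !ratder_frac ?mulf_neq0 //.
rewrite addf_div ?tofrac_neq0 ?expf_neq0 // -!tofracM -tofracD.
congr (_ / _); congr tofrac; rewrite ?derivD ?derivM; ring.
Qed.

Lemma ratderM f g : ratder (f * g) = ratder f * g + f * ratder g.
Proof.
case/ratP: f => p q q0; case/ratP: g => r s s0.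
rewrite mulf_div -!rmorphM /= !ratder_frac ?mulf_neq0 //.
rewrite !mulf_div -!rmorphM addf_div ?tofrac_neq0 ?mulf_neq0 ?expf_neq0 // -!tofracM -tofracD.
apply/eqP; rewrite tofrac_frac_eq ?mulf_neq0 ?expf_neq0 //; apply/eqP.
rewrite !derivM; ring.
Qed.

Lemma ratder_scale c f : c != 0 ->
  ratder (ratscale c f) = ratc c * ratscale c (ratder f).
Proof.
move=> c0; case/ratP: f => p q q0.
have sq := scaleX_neq0 c0 q0.
rewrite ratder_frac // !ratscale_frac ?expf_neq0 // ratder_frac //.
rewrite mulrA -rmorphM; congr (tofrac _ / tofrac _); last first.
  by rewrite rmorphXn.
rewrite !deriv_comp !derivZ !derivX !alg_polyC rmorphB !rmorphM /=; ring.
Qed.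

Lemma ratder0 : ratder (0 : ratfun) = 0.
Proof. by apply: (addrI (ratder 0)); rewrite -ratderD !addr0. Qed.

Lemma ratder_sum (I : Type) (r : seq I) (F : I -> ratfun) :
  ratder (\sum_(i <- r) F i) = \sum_(i <- r) ratder (F i).
Proof. by apply: big_morph; [exact: ratderD | exact: ratder0]. Qed.
End RationalFunctionsTheory.

(* K(x) * Gamma, with a standing for \sum_i (a i) s^i; the action is
   s^i (f) (x) = f (mu^-i x). *)
Definition crossed (K : fieldType) (n : nat) (mu : K)
  (hmu : n.+1.-primitive_root mu) := {ffun 'I_n.+1 -> {fraction {poly K}}}.

Section Crossed.
Variables (K : fieldType) (n : nat) (mu : K) (hmu : n.+1.-primitive_root mu).
Local Notation ratfun := {fraction {poly K}}.
Local Notation crossed := (crossed hmu).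
Implicit Types (a b : crossed) (i j k : 'I_n.+1).

HB.instance Definition _ := GRing.Zmodule.on crossed.

Definition cmul a b : crossed :=
  [ffun k : 'I_n.+1 => \sum_i a i * ratscale (mu ^- i) (b (k - i))].
Definition cemb (f : ratfun) : crossed := [ffun k : 'I_n.+1 => if k == 0 then f else 0].
Definition cgam i : crossed := [ffun k : 'I_n.+1 => (k == i)%:R].

Lemma mu_neq0 : mu != 0.
Proof.
apply/eqP => mu0; have /eqP := prim_expr_order hmu.
by rewrite mu0 expr0n /= eq_sym oner_eq0.
Qed.
Lemma muV_neq0 k : mu ^- k != 0.
Proof. by rewrite invr_eq0 expf_neq0 ?mu_neq0. Qed.
Lemma muD i j : mu ^+ (i + j)%R = mu ^+ i * mu ^+ j.
Proof. by rewrite /= (prim_expr_mod hmu) exprD. Qed.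
Lemma muVD i j : mu ^- (i + j)%R = mu ^- i * mu ^- j.
Proof. by rewrite muD invfM. Qed.

Lemma ordDK i j : i + (j - i) = j.
Proof. by rewrite [LHS]addrC subrK. Qed.
Lemma ordBB k i j : k - i - (j - i) = k - j.
Proof. by rewrite opprB addrA subrK. Qed.

Lemma cmulA : associative cmul.
Proof.
move=> a b c; apply/ffunP => k; rewrite !ffunE.
under eq_bigr => i _.
  rewrite ffunE ratscale_sum ?muV_neq0 // mulr_sumr.
  rewrite (reindex_inj (addIr (- i))).
  under eq_bigr => j _.
    rewrite ratscaleM ?muV_neq0 // ratscale_comp ?muV_neq0 // -muVD.
    rewrite ordDK ordBB mulrA; over.
  over.
rewrite exchange_big /=; apply: eq_bigr => j _.
by rewrite ffunE mulr_suml.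
Qed.

Lemma cemb_mulE f a k : cmul (cemb f) a k = f * a k.
Proof.
rewrite ffunE (bigD1 0) //= big1 ?addr0 => [|i /negPf i0].
  by rewrite ffunE eqxx expr0 invr1 ratscale_id subr0.
by rewrite ffunE i0 mul0r.
Qed.
Lemma mul_cembE f a k : cmul a (cemb f) k = a k * ratscale (mu ^- k) f.
Proof.
rewrite ffunE (bigD1 k) //= big1 ?addr0 => [|i ik].
  by rewrite ffunE subrr eqxx.
by rewrite ffunE subr_eq0 eq_sym (negPf ik) ratscale0 ?muV_neq0 // mulr0.
Qed.

Lemma cmul1 : left_id (cemb 1) cmul.
Proof. by move=> a; apply/ffunP => k; rewrite cemb_mulE mul1r. Qed.
Lemma cmulr1 : right_id (cemb 1) cmul.
Proof. by move=> a; apply/ffunP => k; rewrite mul_cembE ratscale1 ?muV_neq0 // mulr1. Qed.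
Lemma cmulDl : left_distributive cmul +%R.
Proof.
move=> a b c; apply/ffunP => k; rewrite !ffunE -big_split /=.
by apply: eq_bigr => i _; rewrite !ffunE mulrDl.
Qed.
Lemma cmulDr : right_distributive cmul +%R.
Proof.
move=> a b c; apply/ffunP => k; rewrite !ffunE -big_split /=.
by apply: eq_bigr => i _; rewrite !ffunE ratscaleD ?muV_neq0 // mulrDr.
Qed.

HB.instance Definition _ := GRing.Zmodule_isPzRing.Build crossed
  cmulA cmul1 cmulr1 cmulDl cmulDr.

Definition ceps i : crossed :=
  \sum_(r < n.+1) cemb (ratc (n.+1%:R^-1 * mu ^- (i * r)%N)) * cgam r.

(* theta, its inverse and the coefficientwise d/dx *)
Definition cth a : crossed := [ffun k : 'I_n.+1 => ratc (mu ^+ k) * a k].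
Definition cthV a : crossed := [ffun k : 'I_n.+1 => ratc (mu ^- k) * a k].
Definition cder a : crossed := [ffun k : 'I_n.+1 => ratder (a k)].

Variables (tau : K) (kappa : 'I_n.+1 -> K).

(* c_(s^r), that is, the coefficient of s^r in \sum_i m kappa_i eps_i; see dunklcE. *)
Definition dunklc (r : 'I_n.+1) : K :=
  \sum_i n.+1%:R * kappa i * (n.+1%:R^-1 * mu ^- (i * r)%N).
Definition cdunkl a : crossed :=
  cemb (ratc tau) * cder a
  - \sum_(r | r != 0) cemb (ratc (dunklc r)) * cemb (ratx K)^-1 *
      (cgam r * a - a * cgam r).

Lemma cgam_def r f : cgam r * cemb f = cemb (ratscale (mu ^- r) f) * cgam r.
Proof.
apply/ffunP => k; rewrite [LHS]mul_cembE [RHS]cemb_mulE !ffunE.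
by case: eqP => [->|_]; rewrite ?mul0r ?mulr0 // mulrC.
Qed.

Lemma cgamD i j : cgam i * cgam j = cgam (i + j).
Proof.
apply/ffunP => k; rewrite ffunE (bigD1 i) //= big1 ?addr0 => [|l li].
  rewrite !ffunE eqxx mul1r subr_eq addrC.
  by case: eqP; rewrite ?ratscale1 ?ratscale0 ?muV_neq0.
by rewrite ffunE (negPf li) mul0r.
Qed.

Lemma dunklcE :
  \sum_i cemb (ratc (n.+1%:R * kappa i)) * ceps i
  = \sum_r cemb (ratc (dunklc r)) * cgam r.
Proof.
have cembD f g : cemb (f + g) = cemb f + cemb g.
  by apply/ffunP => k; rewrite !ffunE; case: ifP; rewrite ?addr0.
have cemb0 : cemb 0 = 0 by apply/ffunP => k; rewrite !ffunE if_same.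
have cembM f g : cemb (f * g) = cemb f * cemb g.
  by apply/ffunP => k; rewrite [RHS]cemb_mulE !ffunE; case: ifP; rewrite ?mulr0.
under eq_bigr => i _.
  rewrite mulr_sumr; under eq_bigr => r _ do rewrite mulrA -cembM -rmorphM -rmorphM /=.
  over.
rewrite exchange_big /=; apply: eq_bigr => r _.
by rewrite -mulr_suml -(big_morph cemb cembD cemb0) -!rmorph_sum.
Qed.

Lemma ratc_neq0 (c : K) : c != 0 -> ratc c != 0.
Proof. by move=> c0; rewrite tofrac_neq0 // polyC_eq0. Qed.
Lemma ratcM (c d : K) : ratc (c * d) = ratc c * ratc d.
Proof. by rewrite /ratc !rmorphM. Qed.
Lemma ratc1 : ratc (1 : K) = 1.
Proof. by rewrite /ratc !rmorph1. Qed.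

Lemma cthK : cancel cthV cth.
Proof.
move=> a; apply/ffunP => k; rewrite !ffunE mulrA -ratcM divff ?expf_neq0 ?mu_neq0 //.
by rewrite ratc1 mul1r.
Qed.
Lemma cthVK : cancel cth cthV.
Proof.
move=> a; apply/ffunP => k; rewrite !ffunE mulrA -ratcM mulVf ?expf_neq0 ?mu_neq0 //.
by rewrite ratc1 mul1r.
Qed.
Lemma cthVD : {morph cthV : a b / a + b}.
Proof. by move=> a b; apply/ffunP => k; rewrite !ffunE mulrDr. Qed.
Lemma cthVM : {morph cthV : a b / a * b}.
Proof.
move=> a b; apply/ffunP => k; rewrite !ffunE mulr_sumr; apply: eq_bigr => i _.
rewrite !ffunE ratscaleM ?muV_neq0 // ratscale_const ?muV_neq0 // mulrACA.
by rewrite -ratcM -muVD ordDK.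
Qed.

Lemma cderD : {morph cder : a b / a + b}.
Proof. by move=> a b; apply/ffunP => k; rewrite !ffunE ratderD. Qed.
Lemma cderM a b : cder (a * b) = cder a * b + cthV a * cder b.
Proof.
apply/ffunP => k; rewrite !ffunE ratder_sum -big_split /=; apply: eq_bigr => i _.
rewrite !ffunE ratderM ratder_scale ?muV_neq0 //; congr (_ + _).
by rewrite mulrA [a i * _]mulrC.
Qed.

Lemma cthV_const c a : cthV a * cemb (ratc c) = cemb (ratc c) * cthV a.
Proof.
by apply/ffunP => k; rewrite [LHS]mul_cembE [RHS]cemb_mulE ratscale_const ?muV_neq0 // mulrC.
Qed.
Lemma cthV_xV a : cthV a * cemb (ratx K)^-1 = cemb (ratx K)^-1 * a.
Proof.
apply/ffunP => k; rewrite [LHS]mul_cembE [RHS]cemb_mulE ratscale_xV ?muV_neq0 // ffunE.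
rewrite mulrACA divff ?ratc_neq0 ?muV_neq0 // mul1r.
by rewrite mulrC.
Qed.

Lemma cdunklD : {morph cdunkl : a b / a + b}.
Proof.
move=> a b; rewrite /cdunkl cderD mulrDr [RHS]addrACA -opprD -big_split /=.
congr (_ - _); apply: eq_bigr => r _.
by rewrite -mulrDr; congr (_ * _); rewrite mulrDr mulrDl opprD addrACA.
Qed.

Lemma cdunklM a b : cdunkl (a * b) = cdunkl a * b + cthV a * cdunkl b.
Proof.
rewrite /cdunkl cderM mulrDr mulrBl mulrBr [RHS]addrACA -opprD.
rewrite -!mulrA; congr (_ + _ - _).
  by rewrite !mulrA cthV_const.
rewrite mulr_suml mulr_sumr -big_split /=; apply: eq_bigr => r _.
rewrite [X in _ = _ + X]mulrA [cthV a * _]mulrA cthV_const.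
rewrite -[cemb _ * cthV a * _]mulrA cthV_xV -!mulrA -!mulrDr; congr (_ * (_ * _)).
by rewrite mulrBl mulrBr !mulrA addrA subrK.
Qed.

Definition cdata : ore_data crossed :=
  OreData cthVD cthVM cthK cthVK cdunklD cdunklM.
End Crossed.

Section CalogeroMoser.
Variables (K : fieldType) (n d : nat) (al : 'I_n.+1 -> nat).

(* V_i = K^(al i); column vectors, so that maps compose by [*m]. *)
Record quiver_rep := QuiverRep {
  repX : forall i, 'M[K]_(al (i + inZp 1), al i);
  repY : forall i, 'M[K]_(al i, al (i + inZp 1));
  repv : forall i, 'M[K]_(al i, d);
  repw : forall i, 'M[K]_(d, al i) }.

HB.instance Definition _ := gen_eqMixin quiver_rep.
HB.instance Definition _ := gen_choiceMixin quiver_rep.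

Implicit Types (p q : quiver_rep).

(* Extensions by zero to V; [conform_mx] only casts along i = j + 1, resp. i = j. *)
Definition totX p : 'M[K]_(\sum_i al i) :=
  \mxblock_(i, j) (if i == j + inZp 1 then conform_mx 0 (repX p j) else 0).
Definition totY p : 'M[K]_(\sum_i al i) :=
  \mxblock_(i, j) (if j == i + inZp 1 then conform_mx 0 (repY p i) else 0).
Definition totv p i : 'M[K]_(\sum_i al i, d) :=
  \mxcol_j (if j == i then conform_mx 0 (repv p i) else 0).
Definition totw p i : 'M[K]_(d, \sum_i al i) :=
  \mxrow_j (if j == i then conform_mx 0 (repw p i) else 0).

(* The equation at the vertex i + 1, which needs no cast. *)
Definition moment_eq (lam : 'I_n.+1 -> K) p : Prop := forall i,
  repY p (i + inZp 1) *m repX p (i + inZp 1) - repX p i *m repY p i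
    - repv p (i + inZp 1) *m repw p (i + inZp 1) = (lam (i + inZp 1))%:M.

Definition gl_equiv p q : Prop :=
  exists2 g : forall i, 'M[K]_(al i), forall i, g i \in unitmx &
    forall i, [/\ repX q i = g (i + inZp 1) *m repX p i *m invmx (g i),
                  repY q i = g i *m repY p i *m invmx (g (i + inZp 1)),
                  repv q i = g i *m repv p i
                & repw q i = repw p i *m invmx (g i)].

Lemma gl_equiv_refl p : gl_equiv p p.
Proof.
exists (fun i => 1%:M) => i; first exact: unitmx1.
by rewrite !invmx1 !mul1mx !mulmx1.
Qed.

Lemma gl_equiv_sym p q : gl_equiv p q -> gl_equiv q p.
Proof.
case=> g gu e; exists (fun i => invmx (g i)) => i; first by rewrite unitmx_inv.
have [-> -> -> ->] := e i; rewrite !invmxK; split.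
- by rewrite -!mulmxA mulVmx // mulmx1 mulKmx.
- by rewrite -!mulmxA mulVmx // mulmx1 mulKmx.
- by rewrite mulKmx.
- by rewrite mulmxKV.
Qed.

Lemma gl_equiv_trans p q r : gl_equiv p q -> gl_equiv q r -> gl_equiv p r.
Proof.
case=> g gu e [h hu f]; exists (fun i => h i *m g i) => i; first by rewrite unitmx_mul hu gu.
have invM j : invmx (h j *m g j) = invmx (g j) *m invmx (h j).
  have U : h j *m g j \in unitmx by rewrite unitmx_mul hu gu.
  by rewrite -[RHS](mulKmx U) [_ *m (invmx _ *m _)]mulmxA mulmxK // mulmxV // mulmx1.
have [-> -> -> ->] := f i; have [-> -> -> ->] := e i.
by rewrite !invM !mulmxA.
Qed.

Variable lam : 'I_n.+1 -> K.

Definition cm_level := {p : quiver_rep | `[< moment_eq lam p >]}.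
HB.instance Definition _ := Choice.on cm_level.

Definition cm_equiv (p q : cm_level) : bool := `[< gl_equiv (val p) (val q) >].

Lemma cm_equiv_refl : reflexive cm_equiv.
Proof. by move=> p; apply/asboolP; exact: gl_equiv_refl. Qed.
Lemma cm_equiv_sym : symmetric cm_equiv.
Proof. by move=> p q; apply/asboolP/asboolP; exact: gl_equiv_sym. Qed.
Lemma cm_equiv_trans : transitive cm_equiv.
Proof.
move=> q p r /asboolP pq /asboolP qr; apply/asboolP; exact: gl_equiv_trans pq qr.
Qed.

Canonical cm_equiv_rel := EquivRel cm_equiv cm_equiv_refl cm_equiv_sym cm_equiv_trans.

Definition cm_space := {eq_quot cm_equiv}%qT.
Definition cm_class (p : cm_level) : cm_space := (\pi_cm_space p)%qT.
End CalogeroMoser.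

Section LaxMap.
Variables (K : fieldType) (n d : nat) (mu : K) (hmu : n.+1.-primitive_root mu).
Variables (tau : K) (kappa : 'I_n.+1 -> K) (al : 'I_n.+1 -> nat).
Local Notation ratfun := {fraction {poly K}}.
Local Notation S := (cdata hmu tau kappa).
Local Notation P := (psdo S).

Definition lambda (i : 'I_n.+1) : K :=
  n.+1%:R * (kappa (i - inZp 1) - kappa i) - tau.

(* The index l runs over 1, ..., m - 1, as in the text. *)
Definition regular (lam : 'I_n.+1 -> K) : Prop :=
  \sum_i lam i != 0 /\
  forall (z : int) (i j : nat), (1 <= i)%N -> (i < j)%N -> (j <= n.+1)%N ->
    \sum_(i <= l < j) lam (inZp l) != z%:~R * \sum_i lam i.

Definition pcemb (a : crossed hmu) : P := pmon S 0 a.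
Definition py : P := pmon S 1 1.

(* \sum_(k >= 0) c k y^(- k - 1); note that Negz k = - (k + 1) *)
Definition pnegser (c : nat -> crossed hmu) : P.
Proof.
by exists (fun z => if z is Negz k then c k else 0); exists 0 => -[].
Defined.

Implicit Types (p : quiver_rep K d al).

Definition resolventX p : 'M[ratfun]_(\sum_i al i) :=
  invmx (map_mx (@ratc K) (totX p) - (ratx K)%:M).

(* w_i (X - x)^-1 Y^k v_j *)
Definition wXYv p i j (k : nat) : 'M[ratfun]_d :=
  map_mx (@ratc K) (totw p i) *m resolventX p
    *m map_mx (@ratc K) (totY p ^+ k *m totv p j).

(* w_i (X - x)^-1 (Y - y)^-1 v_j *)
Definition wXYv_series p i j : 'M[P]_d :=
  \matrix_(a, b) (- pnegser (fun k => cemb hmu (wXYv p i j k a b))).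

Definition waveM p : 'M[P]_d :=
  1%:M - \sum_i \sum_j
    (pcemb (ceps hmu i))%:M *m wXYv_series p i j *m (pcemb (ceps hmu j))%:M.

Definition mxinv (A : 'M[P]_d) : 'M[P]_d :=
  xget 0 [set B | A *m B = 1%:M /\ B *m A = 1%:M].

Definition laxL p : 'M[P]_d := waveM p *m py%:M *m mxinv (waveM p).
Definition laxR p (g : 'I_d) : 'M[P]_d :=
  waveM p *m delta_mx g g *m mxinv (waveM p).

Definition lie (A B : 'M[P]_d) : 'M[P]_d := A *m B - B *m A.
Definition mxplus : 'M[P]_d -> 'M[P]_d := map_mx (@pplus _ S).

(* A = 1 + series in negative powers of y *)
Definition wave_form (A : 'M[P]_d) : Prop := forall a b (z : int),
  0 <= z -> A a b z = (a == b)%:R *+ (z == 0).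

Definition hier_space (L : 'M[P]_d) (R : 'I_d -> 'M[P]_d) : Prop :=
  [/\ forall a b (z : int), 1 <= z -> L a b z = (a == b)%:R *+ (z == 1),
      forall g a b (z : int), 0 <= z ->
        R g a b z = ((a == g) && (b == g))%:R *+ (z == 0),
      forall g, lie L (R g) = 0,
      forall g b, R g *m R b = if g == b then R g else 0
    & \sum_g R g = 1%:M].

Definition cm_space_lax (q : cm_space d al lambda) :
    'M[P]_d * ('I_d -> 'M[P]_d) :=
  (laxL (val (repr q)), laxR (val (repr q))).

(* H_(k, b) *)
Definition ham (k : nat) (b : 'I_d) p : K :=
  - \sum_i \tr (delta_mx b b *m totw p i *m totY p ^+ k *m totv p (i + inZp k)).

Definition rep_shift p (s : K) (xi : quiver_rep K d al) : quiver_rep K d al :=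
  QuiverRep (fun i => repX p i + s *: repX xi i) (fun i => repY p i + s *: repY xi i)
            (fun i => repv p i + s *: repv xi i) (fun i => repw p i + s *: repw xi i).

(* omega = \sum_i tr (dY_i /\ dX_i) + tr (dw_i /\ dv_i) *)
Definition omega (xi eta : quiver_rep K d al) : K :=
  \sum_i (\tr (repY xi i *m repX eta i) - \tr (repY eta i *m repX xi i)
        + (\tr (repw xi i *m repv eta i) - \tr (repw eta i *m repv xi i))).
End LaxMap.

Section Flows.
Variables (K : numClosedFieldType) (n d : nat) (mu : K).
Variables (hmu : n.+1.-primitive_root mu).
Variables (tau : K) (kappa : 'I_n.+1 -> K) (al : 'I_n.+1 -> nat).
Local Notation ratfun := {fraction {poly K}}.
Local Notation P := (psdo (cdata hmu tau kappa)).
Local Notation rep := (quiver_rep K d al).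

Definition is_mxderive r c (F : K -> 'M[K]_(r, c)) (t0 : K) (G : 'M[K]_(r, c)) : Prop :=
  forall a b, is_derive t0 1 (fun t => F t a b) (G a b).

(* Derivative of a curve of rational functions, pointwise in x: off a finite
   set of points z, z is no pole of F t for t near t0 and d/dt (F t z) = G z. *)
Definition is_ratderive (F : K -> ratfun) (t0 : K) (G : ratfun) : Prop :=
  exists s : seq K, forall z, z \notin s -> exists (u : K -> K) (v : K),
    [/\ \forall t \near t0, rateval (F t) z (u t), rateval G z v
      & is_derive t0 1 u v].

Definition is_psdoderive (F : K -> 'M[P]_d) (t0 : K) (G : 'M[P]_d) : Prop :=
  forall a b (z : int) (r : 'I_n.+1),
    is_ratderive (fun t => F t a b z r) t0 (G a b z r).

Definition is_repderive (p : K -> rep) (t0 : K) (V : rep) : Prop :=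
  forall i, [/\ is_mxderive (fun t => repX (p t) i) t0 (repX V i),
                is_mxderive (fun t => repY (p t) i) t0 (repY V i),
                is_mxderive (fun t => repv (p t) i) t0 (repv V i)
              & is_mxderive (fun t => repw (p t) i) t0 (repw V i)].

Definition rep_flow (k : nat) (b : 'I_d) (p : K -> rep) (t0 : K) : Prop :=
  let E := delta_mx b b : 'M[K]_d in
  let Y := totY (p t0) in let v := totv (p t0) in let w := totw (p t0) in
  [/\ is_mxderive (fun t => totX (p t)) t0
        (- \sum_l \sum_(a < k)
             Y ^+ a *m v l *m E *m w (l - inZp k) *m Y ^+ (k - a - 1)),
      is_mxderive (fun t => totY (p t)) t0 0,
      forall i, is_mxderive (fun t => totw (p t) i) t0
        (E *m w (i - inZp k) *m Y ^+ k)
    & forall j, is_mxderive (fun t => totv (p t) j) t0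
        (- (Y ^+ k *m v (j + inZp k) *m E))].

(* The flow induced on the quotient: c lifts, near t0, to a curve in the level
   set of the moment map that is tangent at t0 to the Hamiltonian field. *)
Definition cm_flow (lam : 'I_n.+1 -> K) (k : nat) (b : 'I_d)
    (c : K -> cm_space d al lam) (t0 : K) : Prop :=
  exists2 p : K -> cm_level d al lam,
    \forall t \near t0, c t = cm_class (p t) & rep_flow k b (fun t => val (p t)) t0.

Definition hier_flow (k : nat) (b : 'I_d)
    (LR : K -> 'M[P]_d * ('I_d -> 'M[P]_d)) (t0 : K) : Prop :=
  let B := mxplus ((LR t0).1 ^+ k *m (LR t0).2 b) in
  is_psdoderive (fun t => (LR t).1) t0 (lie B (LR t0).1) /\
  forall g, is_psdoderive (fun t => (LR t).2 g) t0 (lie B ((LR t0).2 g)).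
End Flows.

Definition complexF (R : realType) : numClosedFieldType := R[i].

(* Main.v *)
(* Put A = X - x, B = Y - y, V = \sum_j v_j eps_j and W = \sum_i eps_i w_i, so that
   M = 1 - W A^-1 B^-1 V. The moment map equation and the relation between x and y give
   [B, A] e = V W, where e = \sum_i 1_(V_i) eps_i fixes V. Hence V W Z V = [B, A] Z V
   for every Z commuting with e, and Z = A^-1 B^-1, B^-1 A^-1 give
   M^-1 = 1 + W B^-1 A^-1 V.
   Along the flow of H_(k, b) the same identity shows that M' M^-1 + M E_b y^k M^-1 has
   only non-negative powers of y. As M' M^-1 has only negative ones and
   M E_b y^k M^-1 = L^k R_b, this means M' M^-1 = (L^k R_b)_+ - L^k R_b, and the second
   term commutes with L and R_g.
   Hamilton's equations come from the gradient of H_(k, b) and the non-degeneracy of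
   omega. The flows are integrated explicitly by exponentials of Y: X is corrected by
   the off-diagonal block of the exponential of a block triangular matrix. *)
From HB Require Import structures.
From mathcomp Require Import all_boot all_order all_algebra.
From mathcomp Require Import zify ring.
From mathcomp Require Import all_classical all_reals all_analysis.
Require Import Defs.
Set Implicit Arguments. Unset Strict Implicit. Unset Printing Implicit Defensive.
Import Order.TTheory GRing.Theory Num.Theory.
Import numFieldNormedType.Exports.
Local Open Scope classical_set_scope.
Local Open Scope ring_scope.

(** * Derivatives of curves *)

(** Two obstacles shape the algebra. The moment map yields \sum_i lambda_i 1_(V_i) while [x, y]
    yields \sum_i lambda_i eps_i, and these agree only after multiplication by e. So the grading has
    to be tracked: with e_c = \sum_i 1_(V_(i+c)) eps_i one has X e_c = e_(c+1) X and Y e_(c+1) = e_c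
    Y, likewise for x and y, and products such as A^-1 B^-1 commute with e = e_0. The absence of
    negative powers in M' M^-1 + M E_b y^k M^-1 is not visible term by term, because B^-1 is an
    infinite series. It rests on the telescoping identity y^-j Y^j = 1 + B U_j with U_j = \sum_(a <
    j) y^(-1-a) Y^a: after multiplication by M^-1 the factor B meets B^-1 and cancels it, and the
    finite sum U_j, with no power below y^-j, is absorbed by y^k. In the integration, exponentials
    of Y mix the vertices; the solution is therefore cut out of the integrated matrices as their
    homogeneous components, and the moment map equation survives because Y is homogeneous. *)

Section MatrixCurves.
Variable K : numClosedFieldType.
Implicit Types (f g : K -> K).

Lemma is_derive_addf (t0 : K) f g df dg : is_derive t0 1 f df -> is_derive t0 1 g dg ->
  is_derive t0 1 (fun t => f t + g t) (df + dg).
Proof. by move=> ff gg; exact: is_deriveD. Qed.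
Lemma is_derive_mulf (t0 : K) f g df dg : is_derive t0 1 f df -> is_derive t0 1 g dg ->
  is_derive t0 1 (fun t => f t * g t) (df * g t0 + f t0 * dg).
Proof.
move=> ff gg; have := is_deriveM ff gg; rewrite addrC => h.
by apply: (is_derive_eq h); rewrite [df * _]mulrC.
Qed.
Lemma is_derive_oppf (t0 : K) f df : is_derive t0 1 f df -> is_derive t0 1 (fun t => - f t) (- df).
Proof. by move=> ff; exact: is_deriveN. Qed.
Lemma is_derive_cstf (t0 : K) (c : K) : is_derive t0 1 (fun _ : K => c) 0.
Proof. exact: is_derive_cst. Qed.
Lemma is_derive_sumf (t0 : K) (I : Type) (r : seq I) (P : pred I) (F : I -> K -> K) dF :
  (forall i, P i -> is_derive t0 1 (F i) (dF i)) ->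
  is_derive t0 1 (fun t => \sum_(i <- r | P i) F i t) (\sum_(i <- r | P i) dF i).
Proof.
move=> h; elim: r => [|i r IH].
  by rewrite big_nil; under eq_fun do rewrite big_nil; exact: is_derive_cst.
rewrite big_cons; under eq_fun do rewrite big_cons.
by case: ifP => // Pi; apply: is_derive_addf => //; exact: h.
Qed.
Lemma is_derive_unique (t0 : K) f df dg : is_derive t0 1 f df -> is_derive t0 1 f dg -> df = dg.
Proof. by move=> ff gg; rewrite -(@derive_val _ _ _ _ _ _ _ ff) -(@derive_val _ _ _ _ _ _ _ gg). Qed.

Lemma is_mxderiveD r c t0 (F G : K -> 'M[K]_(r, c)) dF dG :
  is_mxderive F t0 dF -> is_mxderive G t0 dG ->
  is_mxderive (fun t => F t + G t) t0 (dF + dG).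
Proof.
move=> fF gG a b; rewrite mxE; under eq_fun do rewrite mxE; exact: is_derive_addf.
Qed.
Lemma is_mxderiveM r c s t0 (F : K -> 'M[K]_(r, c)) (G : K -> 'M[K]_(c, s)) dF dG :
  is_mxderive F t0 dF -> is_mxderive G t0 dG ->
  is_mxderive (fun t => F t *m G t) t0 (dF *m G t0 + F t0 *m dG).
Proof.
move=> fF gG a b; rewrite !mxE -big_split /=; under eq_fun do rewrite mxE.
apply: is_derive_sumf => i _; exact: is_derive_mulf.
Qed.
Lemma is_mxderiveN r c t0 (F : K -> 'M[K]_(r, c)) dF :
  is_mxderive F t0 dF -> is_mxderive (fun t => - F t) t0 (- dF).
Proof. move=> fF a b; rewrite mxE; under eq_fun do rewrite mxE; exact: is_derive_oppf. Qed.
Lemma is_mxderive_cst r c t0 (A : 'M[K]_(r, c)) : is_mxderive (fun=> A) t0 0.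
Proof. by move=> a b; rewrite mxE; exact: is_derive_cst. Qed.
Lemma is_mxderive_sum r c t0 (I : Type) (s : seq I) (P : pred I)
    (F : I -> K -> 'M[K]_(r, c)) dF :
  (forall i, P i -> is_mxderive (F i) t0 (dF i)) ->
  is_mxderive (fun t => \sum_(i <- s | P i) F i t) t0 (\sum_(i <- s | P i) dF i).
Proof.
move=> h a b; rewrite summxE; under eq_fun do rewrite summxE.
by apply: is_derive_sumf => i Pi; exact: h.
Qed.
Lemma is_mxderive_unique r c t0 (F : K -> 'M[K]_(r, c)) dF dG :
  is_mxderive F t0 dF -> is_mxderive F t0 dG -> dF = dG.
Proof. by move=> fF gG; apply/matrixP => a b; exact: is_derive_unique (fF a b) (gG a b). Qed.
Lemma is_mxderive_eq r c t0 (F : K -> 'M[K]_(r, c)) dF dG :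
  is_mxderive F t0 dF -> dF = dG -> is_mxderive F t0 dG.
Proof. by move=> ? <-. Qed.
Lemma is_mxderiveX r t0 (F : K -> 'M[K]_r) dF k :
  is_mxderive F t0 dF ->
  is_mxderive (fun t => F t ^+ k) t0
    (\sum_(a < k) F t0 ^+ a *m dF *m F t0 ^+ (k - a - 1)).
Proof.
move=> fF; elim: k => [|k IH].
  by rewrite big_ord0; under eq_fun do rewrite expr0; exact: is_mxderive_cst.
under eq_fun do rewrite exprSr; apply: (is_mxderive_eq (is_mxderiveM IH fF)).
rewrite big_ord_recr /=; have -> : (k.+1 - k - 1 = 0)%N by lia.
rewrite expr0 mulmx1; congr (_ + _).
rewrite mulmx_suml; apply: eq_bigr => a _.
have -> : (k.+1 - a - 1 = (k - a - 1).+1)%N by have := ltn_ord a; lia.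
by rewrite exprSr -!mulmxA.
Qed.
Lemma is_derive_mxtrace r t0 (F : K -> 'M[K]_r) dF :
  is_mxderive F t0 dF -> is_derive t0 1 (fun t => \tr (F t)) (\tr dF).
Proof. by move=> fF; apply: is_derive_sumf => i _; exact: fF. Qed.
End MatrixCurves.

(** * Curves of polynomials *)

Section FractionCurves.
Variable K : numClosedFieldType.
Local Notation ratfun := {fraction {poly K}}.
Implicit Types (p q : K -> {poly K}) (F G : K -> ratfun).

(** The bound on the sizes, uniform in t, makes evaluation at a point a sum of fixed length, which
    can be differentiated term by term. *)
Definition is_polyderive p (t0 : K) (dp : {poly K}) : Prop :=
  (exists N, forall t, (size (p t) <= N)%N) /\
  forall i, is_derive t0 1 (fun t => (p t)`_i) dp`_i.

Lemma is_polyderiveD p q (t0 : K) dp dq : is_polyderive p t0 dp -> is_polyderive q t0 dq ->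
  is_polyderive (fun t => p t + q t) t0 (dp + dq).
Proof.
move=> [[N pN] hp] [[M qM] hq]; split=> [|i].
  exists (maxn N M) => t; apply: leq_trans (size_polyD _ _) _.
  by rewrite geq_max !leq_max pN qM orbT.
rewrite coefD; under eq_fun do rewrite coefD; exact: is_derive_addf.
Qed.
Lemma is_polyderiveN p (t0 : K) dp : is_polyderive p t0 dp ->
  is_polyderive (fun t => - p t) t0 (- dp).
Proof.
move=> [[N pN] hp]; split=> [|i]; first by exists N => t; rewrite size_polyN.
rewrite coefN; under eq_fun do rewrite coefN; exact: is_derive_oppf.
Qed.
Lemma is_polyderiveM p q (t0 : K) dp dq : is_polyderive p t0 dp -> is_polyderive q t0 dq ->
  is_polyderive (fun t => p t * q t) t0 (dp * q t0 + p t0 * dq).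
Proof.
move=> [[N pN] hp] [[M qM] hq]; split=> [|i].
  exists (N + M)%N => t; apply: leq_trans (size_polyMleq _ _) _.
  by apply: leq_trans (leq_pred _) _; exact: leq_add.
rewrite coefD !coefM -big_split /=; under eq_fun do rewrite coefM.
apply: is_derive_sumf => j _; exact: is_derive_mulf.
Qed.
Lemma is_polyderive_cst (t0 : K) (r : {poly K}) : is_polyderive (fun=> r) t0 0.
Proof. by split=> [|i]; [exists (size r) | rewrite coef0; exact: is_derive_cst]. Qed.
Lemma is_polyderiveC (t0 : K) (f : K -> K) df : is_derive t0 1 f df ->
  is_polyderive (fun t => (f t)%:P) t0 df%:P.
Proof.
move=> h; split=> [|i]; first by exists 1%N => t; exact: size_polyC_leq1.
rewrite coefC; under eq_fun do rewrite coefC; case: eqP => // _; exact: is_derive_cst.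
Qed.
Lemma is_polyderive_deriv p (t0 : K) dp : is_polyderive p t0 dp ->
  is_polyderive (fun t => (p t)^`()) t0 dp^`().
Proof.
move=> [[N pN] hp]; split=> [|i].
  by exists N => t; exact: leq_trans (size_poly _ _) (leq_trans (leq_pred _) (pN t)).
rewrite coef_deriv -[_ *+ _]mulr_natr; under eq_fun do rewrite coef_deriv -[_ *+ _]mulr_natr.
by apply: (is_derive_eq (is_derive_mulf (hp _) (is_derive_cstf _ _))); rewrite mulr0 addr0.
Qed.
Lemma coef_comp_scaleX (r : {poly K}) c i : (r \Po (c *: 'X))`_i = r`_i * c ^+ i.
Proof.
rewrite comp_polyE coef_sum.
under eq_bigr => j _ do rewrite coefZ exprZn coefZ coefXn.
case: (ltnP i (size r)) => ir.
  rewrite (bigD1 (Ordinal ir)) //= eqxx mulr1 big1 ?addr0 // => j ji.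
  by rewrite (_ : (i == j) = false) ?mulr0 //; apply: contra_neqF ji => /eqP e; exact/val_inj.
rewrite (nth_default _ ir) mul0r big1 // => j _.
by rewrite (_ : (i == j) = false) ?mulr0 //; apply/eqP => e; have := ltn_ord j; rewrite -e ltnNge ir.
Qed.
Lemma is_polyderive_scaleX p (t0 : K) dp c : is_polyderive p t0 dp ->
  is_polyderive (fun t => p t \Po (c *: 'X)) t0 (dp \Po (c *: 'X)).
Proof.
move=> [[N pN] hp]; split=> [|i].
  exists N => t; apply/leq_sizeP => j Nj; rewrite coef_comp_scaleX.
  by have /leq_sizeP -> := pN t; rewrite ?mul0r.
rewrite coef_comp_scaleX; under eq_fun do rewrite coef_comp_scaleX.
by apply: (is_derive_eq (is_derive_mulf (hp _) (is_derive_cstf _ _))); rewrite mulr0 addr0.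
Qed.
Lemma is_polyderive_unique p q (t0 : K) dp dq : (\forall t \near t0, p t = q t) ->
  is_polyderive p t0 dp -> is_polyderive q t0 dq -> dp = dq.
Proof.
move=> pq [_ hp] [_ hq]; apply/polyP => i; apply: is_derive_unique (hp i) _.
apply: near_eq_is_derive (hq i).
by near=> t; have -> : p t = q t by near: t.
Unshelve. all: by end_near. Qed.
(** Continuity of a single coefficient suffices: the one that is the leading coefficient at t0. *)
Lemma is_polyderive_neq0 p (t0 : K) dp : is_polyderive p t0 dp -> p t0 != 0 ->
  \forall t \near t0, p t != 0.
Proof.
move=> [_ hp] p0; have l0 : (p t0)`_(size (p t0)).-1 != 0 by rewrite -lead_coefE lead_coef_eq0.
have [/derivable1_diffP/differentiable_continuous c _] := hp (size (p t0)).-1.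
have h := cvgr_neq0 _ c l0.
near=> t; have : (p t)`_(size (p t0)).-1 != 0 by near: t; exact: h.
by apply: contra_neq => ->; rewrite coef0.
Unshelve. all: by end_near. Qed.
Lemma is_polyderive_horner p (t0 : K) dp z : is_polyderive p t0 dp ->
  is_derive t0 1 (fun t => (p t).[z]) dp.[z].
Proof.
move=> [[N pN] hp].
(* The derivative inherits the bound, as a coefficient beyond N vanishes for all t. *)
have dN : (size dp <= N)%N.
  apply/leq_sizeP => j Nj; apply: (@is_derive_unique _ t0 (fun t => (p t)`_j)) => //.
  by under eq_fun => t do (have /leq_sizeP -> := pN t => //); exact: is_derive_cst.
rewrite (horner_coef_wide _ dN); under eq_fun do rewrite (horner_coef_wide _ (pN _)).
apply: is_derive_sumf => i _.
by apply: (is_derive_eq (is_derive_mulf (hp _) (is_derive_cstf _ _))); rewrite mulr0 addr0.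
Qed.
End FractionCurves.

(** * Curves of rational functions *)

Section FractionDerivative.
Variable K : numClosedFieldType.
Local Notation ratfun := {fraction {poly K}}.
Implicit Types (F G : K -> ratfun).

(* Unlike [is_ratderive], this notion of derivative commutes with d/dx and has the
   product rule built in: numerator and denominator are differentiated
   coefficientwise. *)
Definition is_fracderive F (t0 : K) (dF : ratfun) : Prop :=
  exists p q dp dq, [/\ q t0 != 0, \forall t \near t0, F t = tofrac (p t) / tofrac (q t),
    is_polyderive p t0 dp, is_polyderive q t0 dq
    & dF = tofrac (dp * q t0 - p t0 * dq) / tofrac (q t0 ^+ 2)].

Lemma is_fracderive_near F G (t0 : K) dF : (\forall t \near t0, F t = G t) ->
  is_fracderive F t0 dF -> is_fracderive G t0 dF.
Proof.
move=> FG [p [q [dp [dq [q0 hF hp hq e]]]]]; exists p, q, dp, dq; split => //.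
near=> t; have <- : F t = G t by near: t.
by near: t.
Unshelve. all: by end_near. Qed.

Lemma is_fracderive_frac (p q : K -> {poly K}) (t0 : K) dp dq : q t0 != 0 ->
  is_polyderive p t0 dp -> is_polyderive q t0 dq ->
  is_fracderive (fun t => tofrac (p t) / tofrac (q t)) t0
    (tofrac (dp * q t0 - p t0 * dq) / tofrac (q t0 ^+ 2)).
Proof. by move=> q0 hp hq; exists p, q, dp, dq; split => //; near=> t.
Unshelve. all: by end_near. Qed.

Lemma is_fracderive_eq F (t0 : K) dF dG :
  is_fracderive F t0 dF -> dF = dG -> is_fracderive F t0 dG.
Proof. by move=> ? <-. Qed.

Lemma is_fracderiveD F G (t0 : K) dF dG : is_fracderive F t0 dF -> is_fracderive G t0 dG ->
  is_fracderive (fun t => F t + G t) t0 (dF + dG).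
Proof.
move=> [p [q [dp [dq [q0 hF hp hq ->]]]]] [r [s [dr [ds [s0 hG hr hs ->]]]]].
have qn := is_polyderive_neq0 hq q0; have sn := is_polyderive_neq0 hs s0.
apply: (@is_fracderive_near (fun t => tofrac (p t * s t + r t * q t) / tofrac (q t * s t))).
  near=> t.
  have -> : F t = tofrac (p t) / tofrac (q t) by near: t.
  have -> : G t = tofrac (r t) / tofrac (s t) by near: t.
  have qt : q t != 0 by near: t.
  have st : s t != 0 by near: t.
  by rewrite addf_div ?tofrac_neq0 // -!tofracM -tofracD.
apply: (is_fracderive_eq (is_fracderive_frac _
  (is_polyderiveD (is_polyderiveM hp hs) (is_polyderiveM hr hq)) (is_polyderiveM hq hs))).
  by rewrite mulf_neq0.
rewrite addf_div ?tofrac_neq0 ?expf_neq0 // -!tofracM -tofracD.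
by congr (tofrac _ / tofrac _); ring.
Unshelve. all: by end_near. Qed.

Lemma is_fracderiveM F G (t0 : K) dF dG : is_fracderive F t0 dF -> is_fracderive G t0 dG ->
  is_fracderive (fun t => F t * G t) t0 (dF * G t0 + F t0 * dG).
Proof.
move=> [p [q [dp [dq [q0 hF hp hq ->]]]]] [r [s [dr [ds [s0 hG hr hs ->]]]]].
have -> : F t0 = tofrac (p t0) / tofrac (q t0) by exact: nbhs_singleton hF.
have -> : G t0 = tofrac (r t0) / tofrac (s t0) by exact: nbhs_singleton hG.
apply: (@is_fracderive_near (fun t => tofrac (p t * r t) / tofrac (q t * s t))).
  near=> t.
  have -> : F t = tofrac (p t) / tofrac (q t) by near: t.
  have -> : G t = tofrac (r t) / tofrac (s t) by near: t.
  by rewrite mulf_div -!tofracM.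
apply: (is_fracderive_eq (is_fracderive_frac _ (is_polyderiveM hp hr) (is_polyderiveM hq hs))).
  by rewrite mulf_neq0.
rewrite !mulf_div addf_div ?mulf_neq0 ?tofrac_neq0 ?expf_neq0 // -!tofracM -tofracD.
apply/eqP; rewrite tofrac_frac_eq ?mulf_neq0 ?expf_neq0 ?mulf_neq0 //; apply/eqP; ring.
Unshelve. all: by end_near. Qed.

(** Existence is enough here: the derivative of an inverse is computed later from the product rule,
    in [is_psmxderiveV]. *)
Lemma is_fracderiveV F (t0 : K) dF : F t0 != 0 -> is_fracderive F t0 dF ->
  exists dG, is_fracderive (fun t => (F t)^-1) t0 dG.
Proof.
move=> F0 [p [q [dp [dq [q0 hF hp hq _]]]]].
have p0 : p t0 != 0.
  by apply: contra_neq F0 => p0; rewrite (nbhs_singleton hF) p0 tofrac0 mul0r.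
eexists; apply: is_fracderive_near (is_fracderive_frac p0 hq hp).
near=> t; have -> : F t = tofrac (p t) / tofrac (q t) by near: t.
by rewrite invf_div.
Unshelve. all: by end_near. Qed.

Lemma is_fracderive_cst (t0 : K) (f : ratfun) : is_fracderive (fun=> f) t0 0.
Proof.
case/ratP: f => p q q0; apply: (is_fracderive_eq (@is_fracderive_frac (fun=> p) (fun=> q) _ _ _ q0
  (is_polyderive_cst _ _) (is_polyderive_cst _ _))).
by rewrite mul0r mulr0 subr0 tofrac0 mul0r.
Qed.

Lemma is_fracderive_ratc (t0 : K) (f : K -> K) df : is_derive t0 1 f df ->
  is_fracderive (fun t => ratc (f t)) t0 (ratc df).
Proof.
move=> h; apply: (@is_fracderive_near (fun t => tofrac (f t)%:P / tofrac 1)).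
  by near=> t; rewrite tofrac1 divr1.
apply: (is_fracderive_eq (is_fracderive_frac _ (is_polyderiveC h) (is_polyderive_cst _ _))).
  exact: oner_neq0.
by rewrite mulr1 mulr0 subr0 expr1n tofrac1 divr1.
Unshelve. all: by end_near. Qed.

Lemma is_fracderiveN F (t0 : K) dF : is_fracderive F t0 dF ->
  is_fracderive (fun t => - F t) t0 (- dF).
Proof.
move=> h; rewrite -[- dF]mulN1r; under eq_fun do rewrite -[- F _]mulN1r.
apply: (is_fracderive_eq (is_fracderiveM (is_fracderive_cst t0 (-1)) h)).
by rewrite mul0r add0r.
Qed.

Lemma is_fracderive_sum (t0 : K) (I : Type) (r : seq I) (P : pred I) (F : I -> K -> ratfun) dF :
  (forall i, P i -> is_fracderive (F i) t0 (dF i)) ->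
  is_fracderive (fun t => \sum_(i <- r | P i) F i t) t0 (\sum_(i <- r | P i) dF i).
Proof.
move=> h; elim: r => [|i r IH].
  by rewrite big_nil; under eq_fun do rewrite big_nil; exact: is_fracderive_cst.
rewrite big_cons; under eq_fun do rewrite big_cons.
by case: ifP => // Pi; apply: is_fracderiveD => //; exact: h.
Qed.

Lemma is_fracderive_ratscale F (t0 : K) dF c : c != 0 -> is_fracderive F t0 dF ->
  is_fracderive (fun t => ratscale c (F t)) t0 (ratscale c dF).
Proof.
move=> c0 [p [q [dp [dq [q0 hF hp hq ->]]]]].
have qn := is_polyderive_neq0 hq q0.
apply: (@is_fracderive_near (fun t => tofrac (p t \Po (c *: 'X)) / tofrac (q t \Po (c *: 'X)))).
  near=> t; have -> : F t = tofrac (p t) / tofrac (q t) by near: t.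
  by rewrite ratscale_frac //; near: t.
apply: (is_fracderive_eq (is_fracderive_frac _ (is_polyderive_scaleX c hp) (is_polyderive_scaleX c hq))).
  exact: scaleX_neq0.
rewrite ratscale_frac ?expf_neq0 //; congr (tofrac _ / tofrac _).
  by rewrite [in RHS]rmorphB /= !comp_polyM.
by rewrite !expr2 comp_polyM.
Unshelve. all: by end_near. Qed.

Lemma is_fracderive_ratder F (t0 : K) dF : is_fracderive F t0 dF ->
  is_fracderive (fun t => ratder (F t)) t0 (ratder dF).
Proof.
move=> [p [q [dp [dq [q0 hF hp hq ->]]]]].
have qn := is_polyderive_neq0 hq q0.
apply: (@is_fracderive_near
    (fun t => tofrac ((p t)^`() * q t - p t * (q t)^`()) / tofrac (q t * q t))).
  near=> t; have -> : F t = tofrac (p t) / tofrac (q t) by near: t.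
  by rewrite ratder_frac ?expr2 //; near: t.
have hp' := is_polyderive_deriv hp; have hq' := is_polyderive_deriv hq.
apply: (is_fracderive_eq (is_fracderive_frac _ (is_polyderiveD (is_polyderiveM hp' hq)
   (is_polyderiveN (is_polyderiveM hp hq'))) (is_polyderiveM hq hq))).
  by rewrite mulf_neq0.
rewrite ratder_frac ?expf_neq0 //; apply/eqP.
rewrite tofrac_frac_eq ?expf_neq0 ?mulf_neq0 //; apply/eqP.
rewrite !expr2 !(derivM, derivB); ring.
Unshelve. all: by end_near. Qed.

(** Two representations satisfy p s = r q near t0. This identity at t0 and its derivative, both
    between polynomials, give the equality of the two quotients. *)
Lemma is_fracderive_unique F (t0 : K) dF dG :
  is_fracderive F t0 dF -> is_fracderive F t0 dG -> dF = dG.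
Proof.
move=> [p [q [dp [dq [q0 hF hp hq ->]]]]] [r [s [dr [ds [s0 hG hr hs ->]]]]].
have qn := is_polyderive_neq0 hq q0; have sn := is_polyderive_neq0 hs s0.
have ps : \forall t \near t0, p t * s t = r t * q t.
  near=> t; have qt : q t != 0 by near: t.
  have st : s t != 0 by near: t.
  apply/eqP; rewrite -tofrac_frac_eq //.
  have <- : F t = tofrac (p t) / tofrac (q t) by near: t.
  by apply/eqP; near: t.
have e := nbhs_singleton ps.
have de := is_polyderive_unique ps (is_polyderiveM hp hs) (is_polyderiveM hr hq).
apply/eqP; rewrite tofrac_frac_eq ?expf_neq0 //; apply/eqP.
have -> : (dp * q t0 - p t0 * dq) * s t0 ^+ 2
  = (dp * s t0 + p t0 * ds) * (q t0 * s t0) - (p t0 * s t0) * (dq * s t0 + q t0 * ds) by ring.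
by rewrite de e; ring.
Unshelve. all: by end_near. Qed.

(** The exceptional points are the roots of the denominator at t0. The neighbourhood of t0 on which
    the denominator does not vanish at z may depend on z. *)
Lemma is_fracderive_ratderive F (t0 : K) dF : is_fracderive F t0 dF -> is_ratderive F t0 dF.
Proof.
move=> [p [q [dp [dq [q0 hF hp hq ->]]]]].
have /= [s sP] := closed_field_poly_normal (q t0).
exists s => z zs; have qz : (q t0).[z] != 0.
  rewrite sP hornerZ mulf_neq0 ?lead_coef_eq0 //.
  by move: zs; rewrite -root_prod_XsubC rootE.
have dpz := is_polyderive_horner z hp; have dqz := is_polyderive_horner z hq.
have qn : \forall t \near t0, (q t).[z] != 0.
  have [/derivable1_diffP/differentiable_continuous c _] := dqz.
  exact: cvgr_neq0 _ c qz.
exists (fun t => (p t).[z] / (q t).[z]), ((dp * q t0 - p t0 * dq).[z] / (q t0 ^+ 2).[z]); split.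
- near=> t; exists (p t), (q t); split => //; by near: t.
- by exists (dp * q t0 - p t0 * dq), (q t0 ^+ 2); split => //; rewrite horner_exp expf_neq0.
- have hV : is_derive t0 1 (fun t => ((q t).[z])^-1) (- (q t0).[z] ^- 2 *: dq.[z]).
    have [dv <-] := dqz; apply: DeriveDef; [exact: derivableV | exact: deriveV].
  apply: (is_derive_eq (is_derive_mulf dpz hV)).
  rewrite !hornerE /=; field; exact: qz.
Unshelve. all: by end_near. Qed.

End FractionDerivative.

(** * Coefficientwise derivatives of curves in P *)

Section PsdoCurves.
Variables (K : numClosedFieldType) (n : nat) (mu : K) (hmu : n.+1.-primitive_root mu).
Variables (tau : K) (kappa : 'I_n.+1 -> K).
Local Notation ratfun := {fraction {poly K}}.
Local Notation A := (crossed hmu).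
Local Notation S := (cdata hmu tau kappa).
Local Notation P := (psdo S).

Definition is_crderive (F : K -> A) (t0 : K) (dF : A) : Prop :=
  forall r, is_fracderive (fun t => F t r) t0 (dF r).

Lemma is_crderive_cst (t0 : K) (a : A) : is_crderive (fun=> a) t0 0.
Proof. by move=> r; rewrite ffunE; exact: is_fracderive_cst. Qed.
Lemma is_crderiveD (t0 : K) (F G : K -> A) dF dG :
  is_crderive F t0 dF -> is_crderive G t0 dG -> is_crderive (fun t => F t + G t) t0 (dF + dG).
Proof.
by move=> hF hG r; rewrite ffunE; under eq_fun do rewrite ffunE; exact: is_fracderiveD.
Qed.
Lemma is_crderiveN (t0 : K) (F : K -> A) dF :
  is_crderive F t0 dF -> is_crderive (fun t => - F t) t0 (- dF).
Proof.
by move=> hF r; rewrite ffunE; under eq_fun do rewrite ffunE; exact: is_fracderiveN.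
Qed.
Lemma is_crderive_sum (t0 : K) (I : Type) (s : seq I) (Q : pred I) (F : I -> K -> A) dF :
  (forall i, Q i -> is_crderive (F i) t0 (dF i)) ->
  is_crderive (fun t => \sum_(i <- s | Q i) F i t) t0 (\sum_(i <- s | Q i) dF i).
Proof.
move=> h; elim: s => [|i s IH].
  by rewrite big_nil; under eq_fun do rewrite big_nil; exact: is_crderive_cst.
rewrite big_cons; under eq_fun do rewrite big_cons.
by case: ifP => // Pi; apply: is_crderiveD => //; exact: h.
Qed.
Lemma is_crderiveM (t0 : K) (F G : K -> A) dF dG :
  is_crderive F t0 dF -> is_crderive G t0 dG ->
  is_crderive (fun t => F t * G t) t0 (dF * G t0 + F t0 * dG).
Proof.
move=> hF hG r; have mE (a b : A) : (a * b) r = \sum_i a i * ratscale (mu ^- i) (b (r - i)) by exact: ffunE.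
rewrite ffunE !mE -big_split /=; under eq_fun do rewrite mE; apply: is_fracderive_sum => i _.
by apply: is_fracderiveM => //; apply: is_fracderive_ratscale => //; exact: muV_neq0.
Qed.
Lemma is_crderive_eq (t0 : K) (F : K -> A) dF dG :
  is_crderive F t0 dF -> dF = dG -> is_crderive F t0 dG.
Proof. by move=> ? <-. Qed.

(** What the product rule for series requires of the operators [ypow]: that they commute with the
    derivative in t. Through D this involves d/dx, hence the use of [is_fracderive]. *)
Definition derive_stable (u : A -> A) := forall (t0 : K) F dF,
  is_crderive F t0 dF -> is_crderive (fun t => u (F t)) t0 (u dF).

Lemma derive_stable_mull (a : A) (u : A -> A) : derive_stable u ->
  derive_stable (fun b => a * u b).
Proof.
move=> su t0 F dF hF; apply: (is_crderive_eq (is_crderiveM (is_crderive_cst t0 a) (su _ _ _ hF))).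
by rewrite mul0r add0r.
Qed.
Lemma derive_stable_mulr (a : A) : derive_stable (fun b => b * a).
Proof.
move=> t0 F dF hF; apply: (is_crderive_eq (is_crderiveM hF (is_crderive_cst t0 a))).
by rewrite mulr0 addr0.
Qed.
Lemma derive_stable_cder : derive_stable (@cder _ _ _ hmu).
Proof.
move=> t0 F dF hF r; rewrite ffunE; under eq_fun do rewrite ffunE.
exact: is_fracderive_ratder.
Qed.
Lemma derive_stable_scale (c : nat -> K) :
  derive_stable (fun a => [ffun k : 'I_n.+1 => ratc (c k) * a k]).
Proof.
move=> t0 F dF hF r; rewrite ffunE; under eq_fun do rewrite ffunE.
apply: (is_fracderive_eq (is_fracderiveM (is_fracderive_cst t0 _) (hF r))).
by rewrite mul0r add0r.
Qed.
Lemma derive_stable_cdunkl : derive_stable (@cdunkl _ _ _ hmu tau kappa).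
Proof.
move=> t0 F dF hF; apply: is_crderiveD.
  exact: (@derive_stable_mull (cemb hmu (ratc tau)) _ derive_stable_cder _ _ _ hF).
apply/is_crderiveN/is_crderive_sum => r _.
apply: (@derive_stable_mull _ (fun a : A => cgam hmu r * a - a * cgam hmu r)) => //.
move=> t1 G dG hG; apply: is_crderiveD; first exact: (@derive_stable_mull _ id).
by apply: is_crderiveN; exact: derive_stable_mulr.
Qed.
Lemma derive_stable_ypow a p : derive_stable (ypow S a p).
Proof.
have s0 : derive_stable (fun=> 0) by move=> t0 F dF _; exact: is_crderive_cst.
have sc u v : (forall q, derive_stable (u q)) -> (forall q, derive_stable (v q)) ->
    forall q, derive_stable (ycomp u v q).
  by move=> su sv q t0 F dF hF; apply: is_crderive_sum => i _; apply: su; exact: sv.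
have si u : (forall q, derive_stable (u q)) ->
    forall k q, derive_stable (iter k (ycomp u) (@yid A) q).
  move=> su; elim=> [|k IH]; last exact: sc.
  by case=> [|q]; [move=> t0 F dF | exact: s0].
case: a => k; apply: si.
  case=> [|[|q]] /=; [exact: (derive_stable_scale (fun k => mu ^- k)) | exact: derive_stable_cdunkl | exact: s0].
move=> q; apply: derive_stable_mull.
elim: q => [|q IH] t0 F dF hF /=; first exact: (derive_stable_scale (fun k => mu ^+ k)).
by apply: (derive_stable_scale (fun k => mu ^+ k)); apply: derive_stable_cdunkl; exact: IH.
Qed.

(** With an order bounded uniformly in t, each coefficient of a product is a finite sum with a range
    independent of t. *)
Definition is_psderive (F : K -> P) (t0 : K) (dF : P) : Prop :=
  (exists N, forall t, pbounded N (F t)) /\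
  forall z, is_crderive (fun t => F t z) t0 (dF z).

Lemma is_psderive_unique (t0 : K) (F : K -> P) dF dG :
  is_psderive F t0 dF -> is_psderive F t0 dG -> dF = dG.
Proof.
move=> [_ hF] [_ hG]; apply: psdo_eq => z; apply/ffunP => r.
exact: is_fracderive_unique (hF z r) (hG z r).
Qed.
(** Applied to M - 1 with bound -1, this shows that M' has only negative powers of y. *)
Lemma is_psderive_bounded (t0 : K) (F : K -> P) dF N :
  (forall t, pbounded N (F t)) -> is_psderive F t0 dF -> pbounded N dF.
Proof.
move=> FN [_ hF] z Nz; apply/ffunP => r; apply: is_fracderive_unique (hF z r) _.
under eq_fun => t do rewrite FN //; rewrite ffunE; exact: is_fracderive_cst.
Qed.
Lemma is_psderive_cst (t0 : K) (f : P) : is_psderive (fun=> f) t0 0.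
Proof.
split=> [|z]; first by exists (pbound f) => _; exact: pboundP.
by rewrite /= if_same; exact: is_crderive_cst.
Qed.
Lemma is_psderiveD (t0 : K) (F G : K -> P) dF dG :
  is_psderive F t0 dF -> is_psderive G t0 dG -> is_psderive (fun t => F t + G t) t0 (dF + dG).
Proof.
move=> [[N FN] hF] [[M GM] hG]; split=> [|z]; last exact: is_crderiveD.
exists (Num.max N M) => t z; rewrite gt_max => /andP[Nz Mz] /=.
by rewrite FN // GM // addr0.
Qed.
Lemma is_psderiveM (t0 : K) (F G : K -> P) dF dG :
  is_psderive F t0 dF -> is_psderive G t0 dG ->
  is_psderive (fun t => F t * G t) t0 (dF * G t0 + F t0 * dG).
Proof.
move=> hF hG; have [[N FN] cF] := hF; have [[M GM] cG] := hG.
have dFN := is_psderive_bounded FN hF; have dGM := is_psderive_bounded GM hG.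
split=> [|z]; first by exists (N + M) => t; exact: pmul_bounded.
case: (ltrP (N + M) z) => [lt|le].
  have -> : (dF * G t0 + F t0 * dG) z = 0.
    by rewrite -[LHS]/(pmul _ _ z + pmul _ _ z) !(pmul_bounded (N := N) (M := M)) ?addr0.
  have -> : (fun t => (F t * G t) z) = fun=> 0.
    by apply/funext => t; exact: (pmul_bounded (FN t) (GM t)).
  exact: is_crderive_cst.
have [k ->] : exists k : nat, z = N + M - k%:Z by exists (absz (N + M - z)%R); lia.
rewrite -[X in is_crderive _ _ X]/(pmul _ _ _ + pmul _ _ _).
rewrite (pmul_coef _ dFN (GM t0)) (pmul_coef _ (FN t0) dGM) -big_split /=.
have -> : (fun t => (F t * G t) (N + M - k%:Z)) = fun t => \sum_(0 <= j < k.+1)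
    \sum_(0 <= l < (k - j).+1)
      F t (N - j%:Z) * ypow S (N - j%:Z) (k - j - l) (G t (M - l%:Z)).
  by apply/funext => t; exact: pmul_coef.
apply: is_crderive_sum => j _; rewrite -big_split /=; apply: is_crderive_sum => l _.
by apply: is_crderiveM => //; exact: derive_stable_ypow.
Qed.
Lemma is_psderive_sum (t0 : K) (I : Type) (s : seq I) (Q : pred I) (F : I -> K -> P) dF :
  (forall i, Q i -> is_psderive (F i) t0 (dF i)) ->
  is_psderive (fun t => \sum_(i <- s | Q i) F i t) t0 (\sum_(i <- s | Q i) dF i).
Proof.
move=> h; elim: s => [|i s IH].
  by rewrite big_nil; under eq_fun do rewrite big_nil; exact: is_psderive_cst.
rewrite big_cons; under eq_fun do rewrite big_cons.
by case: ifP => // Pi; apply: is_psderiveD => //; exact: h.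
Qed.

Definition is_psmxderive r c (F : K -> 'M[P]_(r, c)) (t0 : K) (dF : 'M[P]_(r, c)) : Prop :=
  forall a b, is_psderive (fun t => F t a b) t0 (dF a b).

Lemma is_psmxderive_eq r c (t0 : K) (F : K -> 'M[P]_(r, c)) dF dG :
  is_psmxderive F t0 dF -> dF = dG -> is_psmxderive F t0 dG.
Proof. by move=> ? <-. Qed.
Lemma is_psmxderive_unique r c (t0 : K) (F : K -> 'M[P]_(r, c)) dF dG :
  is_psmxderive F t0 dF -> is_psmxderive F t0 dG -> dF = dG.
Proof. by move=> hF hG; apply/matrixP => a b; exact: is_psderive_unique (hF a b) (hG a b). Qed.
Lemma is_psmxderive_cst r c (t0 : K) (F : 'M[P]_(r, c)) : is_psmxderive (fun=> F) t0 0.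
Proof. by move=> a b; rewrite mxE; exact: is_psderive_cst. Qed.
Lemma is_psmxderiveD r c (t0 : K) (F G : K -> 'M[P]_(r, c)) dF dG :
  is_psmxderive F t0 dF -> is_psmxderive G t0 dG ->
  is_psmxderive (fun t => F t + G t) t0 (dF + dG).
Proof. by move=> hF hG a b; rewrite mxE; under eq_fun do rewrite mxE; exact: is_psderiveD. Qed.
Lemma is_psmxderiveM r c s (t0 : K) (F : K -> 'M[P]_(r, c)) (G : K -> 'M[P]_(c, s)) dF dG :
  is_psmxderive F t0 dF -> is_psmxderive G t0 dG ->
  is_psmxderive (fun t => F t *m G t) t0 (dF *m G t0 + F t0 *m dG).
Proof.
move=> hF hG a b; rewrite !mxE -big_split /=; under eq_fun do rewrite mxE.
by apply: is_psderive_sum => i _; exact: is_psderiveM.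
Qed.
Lemma is_psmxderive_sum r c (t0 : K) (I : Type) (s : seq I) (Q : pred I)
    (F : I -> K -> 'M[P]_(r, c)) dF :
  (forall i, Q i -> is_psmxderive (F i) t0 (dF i)) ->
  is_psmxderive (fun t => \sum_(i <- s | Q i) F i t) t0 (\sum_(i <- s | Q i) dF i).
Proof.
move=> h a b; rewrite summxE; under eq_fun do rewrite summxE.
by apply: is_psderive_sum => i Qi; exact: h.
Qed.
Lemma is_psmxderiveMl r c s (t0 : K) (B : 'M[P]_(r, c)) (F : K -> 'M[P]_(c, s)) dF :
  is_psmxderive F t0 dF -> is_psmxderive (fun t => B *m F t) t0 (B *m dF).
Proof.
move=> hF; apply: (is_psmxderive_eq (is_psmxderiveM (is_psmxderive_cst t0 B) hF)).
by rewrite mul0mx add0r.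
Qed.
Lemma is_psmxderiveMr r c s (t0 : K) (B : 'M[P]_(c, s)) (F : K -> 'M[P]_(r, c)) dF :
  is_psmxderive F t0 dF -> is_psmxderive (fun t => F t *m B) t0 (dF *m B).
Proof.
move=> hF; apply: (is_psmxderive_eq (is_psmxderiveM hF (is_psmxderive_cst t0 B))).
by rewrite mulmx0 addr0.
Qed.

(* Once the inverse is known to be differentiable, its derivative is forced by the
   product rule. *)
Lemma is_psmxderiveV r (t0 : K) (F G : K -> 'M[P]_r) dF :
  (forall t, F t *m G t = 1%:M) -> (forall t, G t *m F t = 1%:M) ->
  is_psmxderive F t0 dF -> (exists dG, is_psmxderive G t0 dG) ->
  is_psmxderive G t0 (- (G t0 *m dF *m G t0)).
Proof.
move=> FG GF hF [dG hG]; apply: (is_psmxderive_eq hG).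
have h := is_psmxderiveM hF hG.
have e : dF *m G t0 + F t0 *m dG = 0.
  apply: is_psmxderive_unique h _; rewrite (_ : (fun t => _) = fun=> 1%:M) ?FG //.
    exact: is_psmxderive_cst.
  exact/funext.
rewrite -[LHS]mul1mx -(GF t0) -mulmxA; move/eqP: e; rewrite addrC addr_eq0 => /eqP ->.
by rewrite mulmxN mulmxA.
Qed.

Lemma is_psmxderive_psdoderive d (t0 : K) (F : K -> 'M[P]_d) dF :
  is_psmxderive F t0 dF -> is_psdoderive F t0 dF.
Proof.
by move=> hF a b z r; apply: is_fracderive_ratderive; case: (hF a b) => _; apply.
Qed.

Lemma is_psdoderive_near d (t0 : K) (F G : K -> 'M[P]_d) dF :
  (\forall t \near t0, F t = G t) -> is_psdoderive F t0 dF -> is_psdoderive G t0 dF.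
Proof.
move=> FG hF a b z r; have [s hs] := hF a b z r; exists s => x /hs[u [v [h hv huv]]].
exists u, v; split => //; near=> t.
have <- : F t = G t by near: t.
by near: t.
Unshelve. all: by end_near. Qed.
End PsdoCurves.

(** * Series in y *)

Section PsdoMonomials.
Variables (A : pzRingType) (S : ore_data A).
Local Notation P := (psdo S).
Implicit Types (F G : P) (f a : A).

(* [a] commutes with y *)
Definition ore_fixed a := ore_sg S a = a /\ ore_d S a = 0.

Lemma ore_fixed1 : ore_fixed 1.
Proof.
have sg1 : ore_sg S 1 = 1.
  by rewrite -[LHS]mulr1 -{2}[1](ore_thK S) -ore_sgM mul1r ore_thK.
split=> //; apply: (addrI (ore_d S 1)).
by rewrite addr0 -{3}[1]mulr1 ore_dM sg1 mulr1 mul1r.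
Qed.

Lemma ypow_fixed b p a : ore_fixed a -> ypow S b p a = if p is 0 then a else 0.
Proof.
move=> [sa da]; elim/int_rec: b p => [|k IH|k IH] p //.
- rewrite -addn1 PoszD; case: p => [|p]; first by rewrite ypow0E IH.
  rewrite ypowSE !IH (morph0 (ore_sgD S)) add0r.
  by case: p => [|p] //; rewrite (morph0 (ore_dD S)).
- have eS : - k%:Z = - k.+1%:Z + 1 by lia.
  rewrite eS in IH; elim: p => [|p IHp]; apply: (can_inj (ore_sgK S)).
    by rewrite -ypow0E IH sa.
  rewrite (morph0 (ore_sgD S)); have := IH p.+1; rewrite ypowSE IHp.
  by case: (p) => [|q]; rewrite ?da ?(morph0 (ore_dD S)) addr0.
Qed.

Lemma pmon_bounded b a : pbounded b (pmon S b a).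
Proof. by move=> i lt /=; rewrite gt_eqF. Qed.

Lemma pmon0_mulE a F z : (pmon S 0 a * F) z = a * F z.
Proof.
have [N FN zN] := pbounded_ext F z.
have [k ->] : exists k : nat, z = 0 + N - k%:Z by exists (absz (N - z)%R); lia.
rewrite [LHS](pmul_coef _ (@pmon_bounded 0 a) FN) big_nat_recl //= [X in _ + X]big1 ?addr0; last first.
  by move=> j _; rewrite big1 // => l _; rewrite mul0r.
rewrite subn0 big_nat_recr //= subnn big_nat_cond big1 ?add0r // => l /andP[/andP[_ lk] _].
by rewrite -(subnSK lk) /= mulr0.
Qed.

Lemma mul_pmonE b a F z : ore_fixed a -> (F * pmon S b a) z = F (z - b) * a.
Proof.
move=> fa; have [N FN zN] := pbounded_ext F (z - b).
have [k ->] : exists k : nat, z = N + b - k%:Z by exists (absz (N - (z - b))%R); lia.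
rewrite [LHS](pmul_coef _ FN (@pmon_bounded b a)) sum_triangleC big_nat_recl //= [X in _ + X]big1 ?addr0; last first.
  move=> l _; rewrite big1 // => j _; case: eqP => [e|_]; first by exfalso; move: e; lia.
  by rewrite ypow0r mulr0.
rewrite subn0 big_nat_recr //= !subnn big_nat_cond big1 ?add0r ?eqxx; last first.
  move=> j /andP[/andP[_ jk] _].
  by rewrite ?eqxx ypow_fixed // subn0 -(subnSK jk) mulr0.
by rewrite ?subr0 ?eqxx ypow_fixed //; congr (F _ * _); lia.
Qed.

Lemma pmon_mulE b F z : (forall i, ore_fixed (F i)) -> (pmon S b 1 * F) z = F (z - b).
Proof.
move=> fF; have [N FN zN] := pbounded_ext F (z - b).
have [k ->] : exists k : nat, z = b + N - k%:Z by exists (absz (N - (z - b))%R); lia.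
rewrite [LHS](pmul_coef _ (@pmon_bounded b 1) FN) big_nat_recl //= [X in _ + X]big1 ?addr0; last first.
  move=> j _; rewrite big1 // => l _; case: eqP => [e|_]; first by exfalso; move: e; lia.
  by rewrite mul0r.
rewrite ?subr0 ?eqxx subn0 big_nat_recr //= subnn big_nat_cond big1 ?add0r; last first.
  by move=> l /andP[/andP[_ lk] _]; rewrite ypow_fixed // -(subnSK lk) mulr0.
by rewrite mul1r ypow_fixed //; congr (F _); lia.
Qed.

Lemma pmonD b c : pmon S b 1 * pmon S c 1 = pmon S (b + c) 1.
Proof.
apply: psdo_eq => z; rewrite mul_pmonE /=; last exact: ore_fixed1.
by rewrite mulr1 subr_eq.
Qed.

Lemma pmon0M a a' : pmon S 0 a * pmon S 0 a' = pmon S 0 (a * a').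
Proof.
by apply: psdo_eq => z; rewrite pmon0_mulE /=; case: eqP; rewrite ?mulr0.
Qed.
Lemma pmonDr b a a' : pmon S b (a + a') = pmon S b a + pmon S b a'.
Proof. by apply: psdo_eq => z /=; case: eqP; rewrite ?addr0. Qed.

Definition pnneg F := forall z : int, z < 0 -> F z = 0.

(** Moving y^k past f lowers the power of y at most k times, so y^k f is a polynomial in y. Hence
    the series without negative powers are closed under multiplication. *)
Lemma ypow_nat_gt (k p : nat) f : (k < p)%N -> ypow S k p f = 0.
Proof.
elim: k p f => [|k IH] [|p] f //; rewrite ltnS => kp.
rewrite -addn1 PoszD ypowSE !IH ?(morph0 (ore_sgD S)) ?(morph0 (ore_dD S)) ?addr0 //.
exact: ltnW.
Qed.

Lemma pnnegM F G : pnneg F -> pnneg G -> pnneg (F * G).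
Proof.
move=> F0 G0 z z0; have [N FN N0] := pbounded_ext F z; have [M GM M0] := pbounded_ext G 0.
have [k kE] : exists k : nat, z = N + M - k%:Z by exists (absz (N + M - z)%R); lia.
rewrite kE in z0 *; rewrite [LHS](pmul_coef _ FN GM) big1_seq // => j.
rewrite mem_index_iota /= => jk; rewrite big1_seq // => l; rewrite mem_index_iota /= => lk.
case: (ltrP (N - j%:Z) 0) => [lt|le]; first by rewrite F0 ?mul0r.
case: (ltrP (M - l%:Z) 0) => [lt|le']; first by rewrite G0 // ypow0r mulr0.
have [a aE] : exists a : nat, N - j%:Z = a by exists (absz (N - j%:Z)%R); lia.
by rewrite aE ypow_nat_gt ?mulr0 //; lia.
Qed.
Lemma pnnegD F G : pnneg F -> pnneg G -> pnneg (F + G).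
Proof. by move=> F0 G0 z z0; rewrite -[LHS]/(F z + G z) F0 // G0 // addr0. Qed.
Lemma pnneg0 : pnneg 0.
Proof. by move=> z _ /=; rewrite if_same. Qed.
Lemma pnneg_mon (b : int) a : 0 <= b -> pnneg (pmon S b a).
Proof. by move=> b0 z z0 /=; case: eqP => // e; move: z0; rewrite e ltNge b0. Qed.
Lemma pnnegN F : pnneg F -> pnneg (- F).
Proof. by move=> F0 z z0; rewrite -[LHS]/(- (F z)) F0 // oppr0. Qed.

Definition mxnneg r c (B : 'M[P]_(r, c)) := forall i j, pnneg (B i j).
Lemma mxnnegM r c s (B : 'M[P]_(r, c)) (C : 'M[P]_(c, s)) :
  mxnneg B -> mxnneg C -> mxnneg (B *m C).
Proof.
move=> B0 C0 i j; rewrite mxE; elim/big_ind: _ => [|? ? ? ?|l _]; first exact: pnneg0.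
  exact: pnnegD.
exact: pnnegM.
Qed.
Lemma mxnnegD r c (B C : 'M[P]_(r, c)) : mxnneg B -> mxnneg C -> mxnneg (B + C).
Proof. by move=> B0 C0 i j; rewrite mxE; exact: pnnegD. Qed.
Lemma mxnnegN r c (B : 'M[P]_(r, c)) : mxnneg B -> mxnneg (- B).
Proof. by move=> B0 i j; rewrite mxE; exact: pnnegN. Qed.
Lemma mxnneg_sum r c (I : Type) (s : seq I) (Q : pred I) (B : I -> 'M[P]_(r, c)) :
  (forall i, Q i -> mxnneg (B i)) -> mxnneg (\sum_(i <- s | Q i) B i).
Proof.
move=> h; elim/big_ind: _ => //; last exact: mxnnegD.
by move=> i j; rewrite mxE; exact: pnneg0.
Qed.
Lemma mxnneg_scalar r F : pnneg F -> mxnneg (F%:M : 'M[P]_r).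
Proof. by move=> F0 i j; rewrite mxE; case: eqP; rewrite ?mulr1n ?mulr0n //; move=> _; exact: pnneg0. Qed.

Definition mxbounded r c N (B : 'M[P]_(r, c)) := forall i j, pbounded N (B i j).
Lemma pbounded0 N : pbounded N (0 : P).
Proof. by move=> z _ /=; rewrite if_same. Qed.
Lemma pboundedD N F G : pbounded N F -> pbounded N G -> pbounded N (F + G).
Proof. by move=> FN GN z zN; rewrite -[LHS]/(F z + G z) FN // GN // addr0. Qed.
Lemma mxboundedM r c s N M (B : 'M[P]_(r, c)) (C : 'M[P]_(c, s)) :
  mxbounded N B -> mxbounded M C -> mxbounded (N + M) (B *m C).
Proof.
move=> BN CM i j; rewrite mxE; elim/big_ind: _ => [|? ? ? ?|l _]; first exact: pbounded0.
  exact: pboundedD.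
exact: pmul_bounded.
Qed.
Lemma mxboundedD r c N (B C : 'M[P]_(r, c)) :
  mxbounded N B -> mxbounded N C -> mxbounded N (B + C).
Proof. by move=> BN CN i j; rewrite mxE; exact: pboundedD. Qed.
Lemma mxboundedN r c N (B : 'M[P]_(r, c)) : mxbounded N B -> mxbounded N (- B).
Proof. by move=> BN i j z zN; rewrite mxE -[LHS]/(- (B i j z)) BN // oppr0. Qed.
Lemma mxbounded_sum r c N (I : Type) (s : seq I) (Q : pred I) (B : I -> 'M[P]_(r, c)) :
  (forall i, Q i -> mxbounded N (B i)) -> mxbounded N (\sum_(i <- s | Q i) B i).
Proof.
move=> h; elim/big_ind: _ => //; last exact: mxboundedD.
by move=> i j; rewrite mxE; exact: pbounded0.
Qed.
Lemma mxbounded_scalar r N F : pbounded N F -> mxbounded N (F%:M : 'M[P]_r).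
Proof. by move=> F0 i j; rewrite mxE; case: eqP; rewrite ?mulr1n ?mulr0n //; move=> _; exact: pbounded0. Qed.
Lemma mxbounded_le r c N M (B : 'M[P]_(r, c)) : N <= M -> mxbounded N B -> mxbounded M B.
Proof. by move=> NM BN i j; exact: pbounded_le (BN i j). Qed.

Lemma mxplus_nneg_add d (B C : 'M[P]_d) : mxnneg B -> mxbounded (-1) C ->
  map_mx (@pplus A S) (B + C) = B.
Proof.
move=> B0 C0; apply/matrixP => i j; rewrite !mxE; apply: psdo_eq => z /=.
case: lerP => z0; last by rewrite B0.
by rewrite C0 ?addr0 //; lia.
Qed.
End PsdoMonomials.

(** * The idempotents eps_i and the commutator of x and y *)

Section CrossedProduct.
Variables (K : fieldType) (n : nat) (mu : K) (hmu : n.+1.-primitive_root mu).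
Variables (tau : K) (kappa : 'I_n.+1 -> K).
Local Notation ratfun := {fraction {poly K}}.
Local Notation A := (crossed hmu).
Local Notation S := (cdata hmu tau kappa).
Local Notation P := (psdo S).
Implicit Types (i j k r : 'I_n.+1) (a b : A) (c : K) (f g : ratfun) (F G : P).

HB.instance Definition _ := GRing.RMorphism.copy (@ratc K) (@tofrac _ \o @polyC K).

Lemma crossed_mulE (a b : A) k : (a * b) k = \sum_i a i * ratscale (mu ^- i) (b (k - i)).
Proof. exact: ffunE. Qed.
Lemma muXV_neq0 (j : nat) : mu ^- j != 0.
Proof. by rewrite invr_eq0 expf_neq0 ?(mu_neq0 hmu). Qed.

Lemma crossed_cemb_mulE f a k : (cemb hmu f * a) k = f * a k.
Proof. exact: cemb_mulE. Qed.
Lemma crossed_mul_cembE f a k : (a * cemb hmu f) k = a k * ratscale (mu ^- k) f.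
Proof. exact: mul_cembE. Qed.

Lemma cemb_is_zmod_morphism : zmod_morphism (cemb hmu).
Proof. by move=> f g; apply/ffunP => k; rewrite !ffunE; case: eqP; rewrite ?subr0. Qed.
Lemma cemb_is_monoid_morphism : monoid_morphism (cemb hmu).
Proof.
split=> [|f g]; apply/ffunP => k; rewrite ?crossed_cemb_mulE !ffunE //.
by case: eqP; rewrite ?mulr0.
Qed.
HB.instance Definition _ := GRing.isZmodMorphism.Build ratfun A (cemb hmu) cemb_is_zmod_morphism.
HB.instance Definition _ := GRing.isMonoidMorphism.Build ratfun A (cemb hmu) cemb_is_monoid_morphism.

Definition prat f : P := pmon S 0 (cemb hmu f).
Definition pconst c : P := prat (ratc c).
Definition peps i : P := pmon S 0 (ceps hmu i).
Local Notation y := (pmon S 1 1 : P).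
Local Notation x := (prat (ratx K)).

Lemma prat_is_zmod_morphism : zmod_morphism prat.
Proof.
move=> f g; apply: psdo_eq => z; rewrite -[RHS]/(prat f z - prat g z) /= rmorphB.
by case: eqP; rewrite ?subr0.
Qed.
Lemma prat_is_monoid_morphism : monoid_morphism prat.
Proof. by split=> [|f g] //; rewrite /prat pmon0M rmorphM. Qed.
HB.instance Definition _ := GRing.isZmodMorphism.Build ratfun P prat prat_is_zmod_morphism.
HB.instance Definition _ := GRing.isMonoidMorphism.Build ratfun P prat prat_is_monoid_morphism.
HB.instance Definition _ := GRing.RMorphism.copy pconst (prat \o @ratc K).

Lemma ratder_ratc c : ratder (ratc c) = 0.
Proof.
have := @ratder_frac K c%:P 1 (oner_neq0 _).
by rewrite tofrac1 divr1 derivC -polyC1 derivC mul0r mulr0 subr0 tofrac0 mul0r.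
Qed.

Lemma cgamME r a k : (cgam hmu r * a) k = ratscale (mu ^- r) (a (k - r)).
Proof.
rewrite crossed_mulE (bigD1 r) //= big1 ?addr0 => [|i /negPf ir]; rewrite ffunE.
  by rewrite eqxx mul1r.
by rewrite ir mul0r.
Qed.
Lemma mul_cgamE r a k : (a * cgam hmu r) k = a (k - r).
Proof.
rewrite crossed_mulE (bigD1 (k - r)) //= big1 ?addr0 => [|i ir].
  by rewrite ffunE subKr eqxx ratscale1 ?mulr1 // muXV_neq0.
rewrite ffunE (_ : (k - i == r) = false) ?ratscale0 ?mulr0 ?muXV_neq0 //.
by apply: contra_neqF ir => /eqP <-; rewrite subKr.
Qed.

Lemma cdunkl_const a : (forall k, exists c, a k = ratc c) -> cdunkl tau kappa a = 0.
Proof.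
move=> ca; rewrite /cdunkl (_ : cder a = 0) ?mulr0 ?sub0r ?big1 ?oppr0 //.
  move=> r _; rewrite (_ : cgam hmu r * a = a * cgam hmu r) ?subrr ?mulr0 //.
  apply/ffunP => k; rewrite cgamME mul_cgamE; have [c ->] := ca (k - r).
  by rewrite ratscale_const // muXV_neq0.
by apply/ffunP => k; rewrite !ffunE; have [c ->] := ca k; exact: ratder_ratc.
Qed.

Lemma cthV_cemb f : cthV (cemb hmu f) = cemb hmu f.
Proof.
apply/ffunP => k; rewrite !ffunE; case: eqP => [->|_]; rewrite ?mulr0 //.
by rewrite expr0 invr1 ratc1 mul1r.
Qed.

Lemma ore_fixed_ratc c : ore_fixed S (cemb hmu (ratc c)).
Proof.
split; first exact: cthV_cemb.
apply: cdunkl_const => k; rewrite ffunE; case: ifP => _; first by exists c.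
by exists 0; rewrite rmorph0.
Qed.

(** Constants are fixed by Gamma and by theta and killed by D, hence central in P. *)
Lemma pconst_comm c F : F * pconst c = pconst c * F.
Proof.
apply: psdo_eq => z; rewrite mul_pmonE ?subr0; last exact: ore_fixed_ratc.
rewrite pmon0_mulE; apply/ffunP => k.
by rewrite crossed_cemb_mulE crossed_mul_cembE ratscale_const ?muXV_neq0 // mulrC.
Qed.

Lemma cepsE i k : ceps hmu i k = ratc (n.+1%:R^-1 * mu ^- (i * k)).
Proof.
rewrite /ceps sum_ffunE (bigD1 k) //= big1 ?addr0 => [|r rk]; rewrite crossed_cemb_mulE ffunE.
  by rewrite eqxx mulr1.
by rewrite eq_sym (negPf rk) mulr0.
Qed.

Lemma mu_inZp1 : mu ^+ (inZp 1 : 'I_n.+1) = mu.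
Proof. by rewrite /= (prim_expr_mod hmu). Qed.

Lemma cthV_ceps i : cthV (ceps hmu i) = ceps hmu (i + inZp 1).
Proof.
apply/ffunP => k; rewrite ffunE !cepsE -rmorphM mulrCA; congr (ratc (_ * _)).
by rewrite !exprM (muD hmu) mu_inZp1 exprMn invfM mulrC.
Qed.

Lemma cdunkl_ceps i : cdunkl tau kappa (ceps hmu i) = 0.
Proof. by apply: cdunkl_const => k; rewrite cepsE; eexists. Qed.

(** Orthogonality of the characters of Z/m, as a geometric sum. *)
Lemma sum_muX k : \sum_(i < n.+1) mu ^- (i * k) = if k == 0 then n.+1%:R else 0.
Proof.
case: eqP => [->|/eqP k0].
  under eq_bigr do rewrite muln0 expr0 invr1.
  by rewrite sumr_const card_ord.
have z1 : (mu ^- k) != 1.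
  rewrite invr_eq1 -(expr0 mu) (eq_prim_root_expr hmu).
  by rewrite !modn_small //; apply: contra k0 => /eqP e; apply/eqP/val_inj.
apply: (mulfI (x := mu ^- k - 1)); first by rewrite subr_eq0.
rewrite mulr0; under eq_bigr => i _ do rewrite mulnC exprM -exprVn.
by rewrite -subrX1 -!exprVn -exprM mulnC exprM exprVn (prim_expr_order hmu) invr1 expr1n subrr.
Qed.

Lemma ceps_mul i j : ceps hmu i * ceps hmu j = if i == j then ceps hmu i else 0.
Proof.
apply/ffunP => k; rewrite crossed_mulE.
have -> : \sum_l ceps hmu i l * ratscale (mu ^- l) (ceps hmu j (k - l))
    = ratc (n.+1%:R^-1 * (n.+1%:R^-1 * mu ^- (j * k) * \sum_(l < n.+1) mu ^- (l * (i - j)%R))).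
  rewrite !mulr_sumr rmorph_sum; apply: eq_bigr => l _.
  rewrite !cepsE ratscale_const ?muXV_neq0 // -rmorphM; congr ratc.
  have -> : mu ^- (j * (k - l)%R) = mu ^- (j * k) * mu ^+ (j * l).
    apply: (mulIf (x := mu ^- (j * l))); first by rewrite invr_eq0 expf_neq0 // (mu_neq0 hmu).
    rewrite mulfK ?expf_neq0 ?(mu_neq0 hmu) //.
    by rewrite ![(j * _)%N]mulnC !exprM -invfM -exprMn -(muD hmu) subrK.
  have -> : mu ^- (l * (i - j)%R) = mu ^- (i * l) * mu ^+ (j * l).
    rewrite [(l * _)%N]mulnC !exprM; have := muD hmu (i - j) j.
    rewrite subrK => ->; rewrite exprMn invfM -mulrA mulVf ?mulr1 //.
    by rewrite !expf_neq0 // (mu_neq0 hmu).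
  ring.
rewrite sum_muX subr_eq0; case: (i =P j) => [->|_].
  by rewrite cepsE [_ * n.+1%:R]mulrAC mulVf ?(prim_root_natf_neq0 hmu) // mul1r.
by rewrite !mulr0 rmorph0 ffunE.
Qed.

Lemma peps_mul i j : peps i * peps j = if i == j then peps i else 0.
Proof.
by rewrite /peps pmon0M ceps_mul; case: eqP.
Qed.
Lemma py_peps i : y * peps i = peps (i + inZp 1) * y.
Proof.
rewrite /peps psdo_y_mul [ore_sg _ _]cthV_ceps [ore_d _ _]cdunkl_ceps.
apply: psdo_eq => z; rewrite pmon0_mulE /=.
by rewrite if_same addr0; case: eqP; rewrite ?mulr1 ?mulr0.
Qed.
Lemma peps_x i : peps i * x = x * peps (i + inZp 1).
Proof.
rewrite /peps /prat !pmon0M; congr pmon; apply/ffunP => k.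
rewrite crossed_mul_cembE crossed_cemb_mulE ratscale_x ?muXV_neq0 // -cthV_ceps ffunE.
by rewrite mulrA mulrC [ceps _ _ _ * _]mulrC.
Qed.

(** As theta fixes x, the commutator is - D(x), that is - tau + \sum_r c_r (mu^-r - 1) s^r; the
    index r = 0, absent from D, has a vanishing factor. On the Fourier side, multiplying c_r by
    mu^-r shifts kappa by one index, which gives the difference in lambda_i. *)
Lemma px_py : x * y - y * x = \sum_i pconst (lambda tau kappa i) * peps i.
Proof.
have -> : \sum_i pconst (lambda tau kappa i) * peps i
    = pmon S 0 (\sum_i cemb hmu (ratc (lambda tau kappa i)) * ceps hmu i).
  have D : {morph pmon S 0 : a b / a + b} by exact: pmonDr.
  rewrite (big_morph _ D (erefl (pmon S 0 0 : P))); apply: eq_bigr => i _.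
  by rewrite /pconst /prat /peps pmon0M.
rewrite /prat psdo_y_mul [ore_sg _ _]cthV_cemb opprD.
have -> : pmon S 0 (cemb hmu (ratx K)) * y = pmon S 1 (cemb hmu (ratx K)).
  by apply: psdo_eq => z; rewrite pmon0_mulE /=; case: eqP; rewrite ?mulr1 ?mulr0.
rewrite addrA subrr sub0r; apply: psdo_eq => z.
rewrite -[LHS]/(- pmon S 0 _ z) /=; case: eqP => _; rewrite ?oppr0 //.
apply/ffunP => k; rewrite /cdunkl opprB.
have BE a b : (a - b) k = a k - b k by rewrite !ffunE.
rewrite BE !sum_ffunE crossed_cemb_mulE [cder _ k]ffunE [cemb _ _ k]ffunE.
under [RHS]eq_bigr => i _ do rewrite crossed_cemb_mulE cepsE -rmorphM.
have -> : \sum_(r | r != 0) (cemb hmu (ratc (dunklc mu kappa r)) * cemb hmu (ratx K)^-1 *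
        (cgam hmu r * cemb hmu (ratx K) - cemb hmu (ratx K) * cgam hmu r)) k
    = ratc (dunklc mu kappa k * (mu ^- k - 1)).
  transitivity (\sum_r if r == k then ratc (dunklc mu kappa k * (mu ^- k - 1)) else 0); last first.
    by rewrite -big_mkcond big_pred1_eq.
  rewrite big_mkcond; apply: eq_bigr => r _; rewrite cgam_def ratscale_x ?muXV_neq0 //.
  have xE : ratc (mu ^- r) * ratx K - ratx K = ratc (mu ^- r - 1) * ratx K.
    by rewrite rmorphB /= ratc1 mulrBl mul1r.
  rewrite -mulrBl -rmorphB xE mulrA -!rmorphM crossed_cemb_mulE ffunE.
  rewrite mulrACA mulVf ?ratx_neq0 // mulr1 -rmorphM.
  rewrite [k == r]eq_sym; case: (r =P k) => [->|_]; last by rewrite mulr0 if_same.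
  rewrite mulr1; case: eqP => //= ->.
  by rewrite expr0 invr1 subrr mulr0 rmorph0.
have -> : ratder (if k == 0 then ratx K else 0) = if k == 0 then 1 else 0.
  case: eqP => _; last exact: ratder0.
  have := @ratder_frac K 'X 1 (oner_neq0 _).
  have d1 : (1 : {poly K})^`() = 0 by rewrite -polyC1 derivC.
  by rewrite derivX d1 mul1r mulr0 subr0 expr1n !tofrac1 !divr1.
rewrite -rmorph_sum (_ : (if k == 0 then 1 else 0) = ratc (k == 0)%:R); last first.
  by case: eqP => _; rewrite ?rmorph1 ?rmorph0.
rewrite -rmorphM -rmorphB; congr ratc; rewrite /lambda.
under eq_bigr => i _ do rewrite mulrBl mulrBr mulrBl.
rewrite !sumrB -mulr_sumr -mulr_sumr sum_muX mulrBr mulr1 /dunklc.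
congr (_ - _ - _); last first.
  by case: eqP => _; rewrite ?mulr0 // mulVf ?(prim_root_natf_neq0 hmu).
rewrite [RHS](reindex_inj (addIr (inZp 1 : 'I_n.+1))) mulr_suml.
apply: eq_bigr => i _; rewrite addrK !exprM (muD hmu) mu_inZp1 exprMn invfM; ring.
Qed.
End CrossedProduct.

(** * Quiver representations as operators on V *)

Lemma sum_only1 (V : nmodType) (I : finType) (i : I) (F : I -> V) :
  (forall j, j != i -> F j = 0) -> \sum_j F j = F i.
Proof. by move=> F0; rewrite (bigD1 i) //= big1 ?addr0. Qed.

Lemma sum_shift n (c : 'I_n.+1) (V : nmodType) (F : 'I_n.+1 -> V) : \sum_i F i = \sum_i F (i + c).
Proof. by rewrite (reindex_inj (addIr c)). Qed.

Section QuiverTotals.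
Variables (K : fieldType) (n d : nat) (al : 'I_n.+1 -> nat).
Implicit Types (i j : 'I_n.+1) (p q : quiver_rep K d al).
Local Notation N := (\sum_i al i)%N.

(** The inclusion of V_i in V, followed by the projection onto V_i. Through them the total maps
    become products and sums without casts. *)
Definition vinj i : 'M[K]_(N, al i) := \mxcol_j (if j == i then conform_mx 0 (1%:M : 'M[K]_(al i)) else 0).
Definition vprj i : 'M[K]_(al i, N) := \mxrow_j (if j == i then conform_mx 0 (1%:M : 'M[K]_(al i)) else 0).
Definition vproj i : 'M[K]_N := vinj i *m vprj i.

Lemma vprjK i : vprj i *m vinj i = 1%:M.
Proof.
rewrite mul_mxrow_mxcol (bigD1 i) //= !eqxx !conform_mx_id mulmx1 big1 ?addr0 // => j /negPf ->.
by rewrite mul0mx.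
Qed.
Lemma vprj_inj0 i j : i != j -> vprj i *m vinj j = 0.
Proof.
move=> ij; rewrite mul_mxrow_mxcol big1 // => l _.
by case: (l =P i) => [->|_]; rewrite ?(negPf ij) ?mulmx0 ?mul0mx.
Qed.
Lemma sum_vproj : \sum_i vproj i = 1%:M.
Proof.
rewrite /vproj (eq_bigr _ (fun i _ => mul_mxcol_mxrow _ _)).
rewrite -mxblock_sum -mxdiagZ /mxdiag; apply/eq_mxblockP => i j.
have [<-|ij] := eqVneq i j.
  rewrite (bigD1 i) //= !eqxx !conform_mx_id mulmx1 big1 ?addr0 // => l /negPf li.
  by rewrite eq_sym li mul0mx.
rewrite big1 // => l _; have [<-|li] := eqVneq i l; last by rewrite mul0mx.
by rewrite eq_sym (negPf ij) mulmx0.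
Qed.

Lemma totXE p : totX p = \sum_i vinj (i + inZp 1) *m repX p i *m vprj i.
Proof.
rewrite /vinj /vprj [RHS](eq_bigr _ (fun i _ => congr1 (mulmx^~ _) (mxcol_mul _ _))).
rewrite [RHS](eq_bigr _ (fun i _ => mul_mxcol_mxrow _ _)).
rewrite -mxblock_sum; apply/eq_mxblockP => i j; rewrite (bigD1 j) //= big1 ?addr0; last first.
  by move=> l /negPf lj; rewrite [j == l]eq_sym lj mulmx0.
rewrite eqxx conform_mx_id mulmx1; case: eqP => [->|_]; last by rewrite mul0mx.
by rewrite !conform_mx_id mul1mx.
Qed.
Lemma totYE p : totY p = \sum_i vinj i *m repY p i *m vprj (i + inZp 1).
Proof.
rewrite /vinj /vprj [RHS](eq_bigr _ (fun i _ => congr1 (mulmx^~ _) (mxcol_mul _ _))).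
rewrite [RHS](eq_bigr _ (fun i _ => mul_mxcol_mxrow _ _)).
rewrite -mxblock_sum; apply/eq_mxblockP => i j; rewrite (bigD1 i) //= big1 ?addr0; last first.
  by move=> l /negPf lj; rewrite [i == l]eq_sym lj !mul0mx.
rewrite eqxx conform_mx_id mul1mx; case: eqP => [->|_]; last by rewrite mulmx0.
by rewrite !conform_mx_id mulmx1.
Qed.
Lemma totvE p i : totv p i = vinj i *m repv p i.
Proof.
rewrite /vinj mxcol_mul; apply/eq_mxcolP => j; case: eqP => [->|_]; last by rewrite mul0mx.
by rewrite !conform_mx_id mul1mx.
Qed.
Lemma totwE p i : totw p i = repw p i *m vprj i.
Proof.
rewrite /vprj mul_mxrow; apply/eq_mxrowP => j; case: eqP => [->|_]; last by rewrite mulmx0.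
by rewrite !conform_mx_id mulmx1.
Qed.

Lemma vprj_vproj i j : vprj i *m vproj j = if i == j then vprj i else 0.
Proof.
rewrite mulmxA; case: eqP => [<-|/eqP ij]; first by rewrite vprjK mul1mx.
by rewrite vprj_inj0 // mul0mx.
Qed.
Lemma vproj_vinj i j : vproj i *m vinj j = if i == j then vinj j else 0.
Proof.
rewrite -mulmxA; case: eqP => [<-|/eqP ij]; first by rewrite vprjK mulmx1.
by rewrite vprj_inj0 // mulmx0.
Qed.
Lemma vproj_mul i j : vproj i *m vproj j = if i == j then vproj i else 0.
Proof.
rewrite {1}/vproj -mulmxA vprj_vproj; case: eqP => // _; exact: mulmx0.
Qed.

Lemma sum_vinj_diag (B : forall i, 'M[K]_(al i)) (C : forall i, 'M[K]_(al i)) :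
  (\sum_i vinj i *m B i *m vprj i) *m (\sum_i vinj i *m C i *m vprj i)
  = \sum_i vinj i *m (B i *m C i) *m vprj i.
Proof.
rewrite mulmx_suml; apply: eq_bigr => i _; rewrite mulmx_sumr [LHS](@sum_only1 _ _ i).
  by rewrite !mulmxA -[_ *m vprj i *m vinj i]mulmxA vprjK mulmx1.
move=> j ji; rewrite !mulmxA -[_ *m vprj i *m vinj j]mulmxA vprj_inj0 1?eq_sym //.
by rewrite mulmx0 !mul0mx.
Qed.

Lemma totX_vproj p i : vproj (i + inZp 1) *m totX p = totX p *m vproj i.
Proof.
rewrite totXE mulmx_sumr mulmx_suml; apply: eq_bigr => j _.
rewrite !mulmxA vproj_vinj -!mulmxA vprj_vproj (inj_eq (addIr _)) eq_sym.
by case: eqP; rewrite ?mulmx0 ?mul0mx.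
Qed.
Lemma totY_vproj p i : totY p *m vproj (i + inZp 1) = vproj i *m totY p.
Proof.
rewrite totYE mulmx_sumr mulmx_suml; apply: eq_bigr => j _.
rewrite !mulmxA vproj_vinj -!mulmxA vprj_vproj (inj_eq (addIr _)) eq_sym.
by case: eqP; rewrite ?mulmx0 ?mul0mx.
Qed.
Lemma totv_vproj p i j : vproj i *m totv p j = if i == j then totv p j else 0.
Proof. by rewrite totvE mulmxA vproj_vinj; case: eqP => // _; rewrite mul0mx. Qed.
Lemma totw_vproj p i j : totw p i *m vproj j = if i == j then totw p i else 0.
Proof. by rewrite totwE -mulmxA vprj_vproj; case: eqP => // _; rewrite mulmx0. Qed.

Lemma totYX p : totY p *m totX p = \sum_i vinj i *m (repY p i *m repX p i) *m vprj i.
Proof.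
rewrite totYE totXE mulmx_suml; apply: eq_bigr => i _; rewrite mulmx_sumr [LHS](@sum_only1 _ _ i).
  by rewrite !mulmxA -[_ *m vprj _ *m vinj _]mulmxA vprjK mulmx1.
move=> j ji; rewrite !mulmxA -[_ *m vprj _ *m vinj _]mulmxA vprj_inj0 ?mulmx0 ?mul0mx //.
by rewrite (inj_eq (addIr _)) eq_sym.
Qed.
Lemma totXY p : totX p *m totY p
  = \sum_i vinj (i + inZp 1) *m (repX p i *m repY p i) *m vprj (i + inZp 1).
Proof.
rewrite totYE totXE mulmx_suml; apply: eq_bigr => i _; rewrite mulmx_sumr [LHS](@sum_only1 _ _ i).
  by rewrite !mulmxA -[_ *m vprj _ *m vinj _]mulmxA vprjK mulmx1.
by move=> j ji; rewrite !mulmxA -[_ *m vprj _ *m vinj _]mulmxA vprj_inj0 ?mulmx0 ?mul0mx // eq_sym.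
Qed.
Lemma totvw p i : totv p i *m totw p i = vinj i *m (repv p i *m repw p i) *m vprj i.
Proof. by rewrite totvE totwE !mulmxA. Qed.

(** Both sides are block diagonal on V, and the block at i + 1 is the equation at that vertex; it is
    extracted by composing with the projection and the inclusion. *)
Lemma moment_eqP (lam : 'I_n.+1 -> K) p : moment_eq lam p <->
  totY p *m totX p - totX p *m totY p - \sum_i totv p i *m totw p i = \sum_i lam i *: vproj i.
Proof.
rewrite totYX totXY (eq_bigr _ (fun i _ => totvw p i)).
rewrite (sum_shift (inZp 1) (fun i => vinj i *m (repY p i *m repX p i) *m vprj i)).
rewrite (sum_shift (inZp 1) (fun i => vinj i *m (repv p i *m repw p i) *m vprj i)).
rewrite (sum_shift (inZp 1) (fun i => lam i *: vproj i)) -!sumrB.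
have E i : vinj (i + inZp 1) *m (repY p (i + inZp 1) *m repX p (i + inZp 1)) *m vprj (i + inZp 1)
    - vinj (i + inZp 1) *m (repX p i *m repY p i) *m vprj (i + inZp 1)
    - vinj (i + inZp 1) *m (repv p (i + inZp 1) *m repw p (i + inZp 1)) *m vprj (i + inZp 1)
    = vinj (i + inZp 1) *m (repY p (i + inZp 1) *m repX p (i + inZp 1) - repX p i *m repY p i
       - repv p (i + inZp 1) *m repw p (i + inZp 1)) *m vprj (i + inZp 1).
  by rewrite !mulmxBr !mulmxBl.
rewrite (eq_bigr _ (fun i _ => E i)); split=> [h|h i].
  by apply: eq_bigr => i _; rewrite h mul_mx_scalar -scalemxAl.
have := congr1 (fun Z => vprj (i + inZp 1) *m Z *m vinj (i + inZp 1)) h.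
have D (F : forall j, 'M[K]_(al j)) : vprj (i + inZp 1) *m (\sum_j vinj (j + inZp 1)
    *m F (j + inZp 1) *m vprj (j + inZp 1)) *m vinj (i + inZp 1) = F (i + inZp 1).
  rewrite mulmx_sumr mulmx_suml [LHS](@sum_only1 _ _ i).
    by rewrite !mulmxA vprjK mul1mx -mulmxA vprjK mulmx1.
  move=> j ji; rewrite !mulmxA vprj_inj0 ?mul0mx //.
  by rewrite (inj_eq (addIr _)) eq_sym.
have -> : \sum_j lam (j + inZp 1) *: vproj (j + inZp 1)
    = \sum_j vinj (j + inZp 1) *m (lam (j + inZp 1))%:M *m vprj (j + inZp 1).
  by apply: eq_bigr => j _; rewrite mul_mx_scalar -scalemxAl.
rewrite (D (fun j => (lam j)%:M)) => <-.
rewrite mulmx_sumr mulmx_suml [RHS](@sum_only1 _ _ i).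
  by rewrite !mulmxA vprjK mul1mx -mulmxA vprjK mulmx1.
move=> j ji; rewrite !mulmxA vprj_inj0 ?mul0mx //.
by rewrite (inj_eq (addIr _)) eq_sym.
Qed.

Lemma diag_vinj j (C : forall i, 'M[K]_(al i)) :
  (\sum_i vinj i *m C i *m vprj i) *m vinj j = vinj j *m C j.
Proof.
rewrite mulmx_suml [LHS](@sum_only1 _ _ j); first by rewrite -!mulmxA vprjK mulmx1.
by move=> i ij; rewrite -mulmxA vprj_inj0 ?mulmx0.
Qed.
Lemma vprj_diag j (C : forall i, 'M[K]_(al i)) :
  vprj j *m (\sum_i vinj i *m C i *m vprj i) = C j *m vprj j.
Proof.
rewrite mulmx_sumr [LHS](@sum_only1 _ _ j); first by rewrite !mulmxA vprjK mul1mx.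
by move=> i ij; rewrite !mulmxA vprj_inj0 ?mul0mx // eq_sym.
Qed.

(** G and H are block diagonal, with blocks g_i and g_i^-1. *)
Lemma gl_equiv_tot p q : gl_equiv p q -> exists G H : 'M[K]_N,
  [/\ G *m H = 1%:M, H *m G = 1%:M, totX q = G *m totX p *m H, totY q = G *m totY p *m H
    & forall i, totv q i = G *m totv p i /\ totw q i = totw p i *m H].
Proof.
case=> g gu e.
have [G [Gi iG GE]] : exists G : 'M[K]_N, [/\ forall j, G *m vinj j = vinj j *m g j,
    forall j, vprj j *m G = g j *m vprj j & G = \sum_i vinj i *m g i *m vprj i].
  exists (\sum_i vinj i *m g i *m vprj i); split=> // j; [exact: diag_vinj | exact: vprj_diag].
have [H [Hi iH HE]] : exists H : 'M[K]_N, [/\ forall j, H *m vinj j = vinj j *m invmx (g j),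
    forall j, vprj j *m H = invmx (g j) *m vprj j & H = \sum_i vinj i *m invmx (g i) *m vprj i].
  exists (\sum_i vinj i *m invmx (g i) *m vprj i); split=> // j; [exact: diag_vinj | exact: vprj_diag].
exists G, H; split.
- rewrite GE HE sum_vinj_diag -[RHS]sum_vproj; apply: eq_bigr => i _.
  by rewrite mulmxV ?gu // mulmx1.
- rewrite GE HE sum_vinj_diag -[RHS]sum_vproj; apply: eq_bigr => i _.
  by rewrite mulVmx ?gu // mulmx1.
- rewrite !totXE mulmx_sumr mulmx_suml; apply: eq_bigr => i _.
  by have [-> _ _ _] := e i; rewrite !mulmxA Gi -!mulmxA iH.
- rewrite !totYE mulmx_sumr mulmx_suml; apply: eq_bigr => i _.
  by have [_ -> _ _] := e i; rewrite !mulmxA Gi -!mulmxA iH.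
- move=> i; have [_ _ ev ew] := e i; rewrite !totvE !totwE ev ew; split.
    by rewrite !mulmxA Gi.
  by rewrite -!mulmxA iH.
Qed.
End QuiverTotals.

(** * The wave operator *)

Section WaveOperator.
Variables (K : fieldType) (n d : nat) (mu : K) (hmu : n.+1.-primitive_root mu).
Variables (tau : K) (kappa : 'I_n.+1 -> K) (al : 'I_n.+1 -> nat).
Local Notation ratfun := {fraction {poly K}}.
Local Notation A := (crossed hmu).
Local Notation S := (cdata hmu tau kappa).
Local Notation P := (psdo S).
Local Notation N := (\sum_i al i)%N.
Local Notation prat := (prat hmu tau kappa).
Local Notation pconst := (pconst hmu tau kappa).
Local Notation peps := (peps hmu tau kappa).
Local Notation y := (pmon S 1 1 : P).
Local Notation x := (prat (ratx K)).
Implicit Types (i j : 'I_n.+1) (p : quiver_rep K d al).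

Definition kmx r c (C : 'M[K]_(r, c)) : 'M[P]_(r, c) := map_mx pconst C.

Lemma kmxM r c s (C : 'M[K]_(r, c)) (D : 'M[K]_(c, s)) : kmx (C *m D) = kmx C *m kmx D.
Proof. exact: map_mxM. Qed.
Lemma kmxD r c (C D : 'M[K]_(r, c)) : kmx (C + D) = kmx C + kmx D.
Proof. exact: map_mxD. Qed.
Lemma kmxN r c (C : 'M[K]_(r, c)) : kmx (- C) = - kmx C.
Proof. exact: map_mxN. Qed.
Lemma kmx0 r c : kmx (0 : 'M[K]_(r, c)) = 0.
Proof. exact: map_mx0. Qed.
Lemma kmx1 r : kmx (1%:M : 'M[K]_r) = 1%:M.
Proof. exact: map_mx1. Qed.
Lemma kmx_sum r c (I : Type) (s : seq I) (Q : pred I) (C : I -> 'M[K]_(r, c)) :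
  kmx (\sum_(i <- s | Q i) C i) = \sum_(i <- s | Q i) kmx (C i).
Proof. by apply: big_morph; [exact: kmxD | exact: kmx0]. Qed.

(** Since constants are central, every element of P commutes with linear maps over K; the two scalar
    matrices differ only in size. *)
Lemma kmx_comm r c F (C : 'M[K]_(r, c)) : F%:M *m kmx C = kmx C *m F%:M.
Proof.
apply/matrixP => i j; rewrite !mxE (bigD1 i) //= big1 ?addr0 => [|l li]; last first.
  by rewrite !mxE eq_sym (negPf li) mul0r.
rewrite [RHS](bigD1 j) //= [X in _ = _ + X]big1 ?addr0 => [|l /negPf lj]; last first.
  by rewrite !mxE lj mulr0.
by rewrite !mxE !eqxx !mulr1n pconst_comm.
Qed.

Definition yresolvent r (Y : 'M[K]_r) : 'M[P]_r :=
  \matrix_(a, b) - pnegser tau kappa (fun k => cemb hmu (ratc ((Y ^+ k) a b))).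

Lemma pnegser_neg (c : nat -> A) k : pnegser tau kappa c (Negz k) = c k.
Proof. by []. Qed.

(** Multiplication by y shifts -\sum_k Y^k y^(-k-1) by one: the term k = 0 lands on y^0 and gives -
    1, the others make up Y times the series. *)
Lemma yresolvent_y r (Y : 'M[K]_r) : yresolvent Y *m y%:M = kmx Y *m yresolvent Y - 1%:M.
Proof.
apply/matrixP => a b; rewrite !mxE (bigD1 b) //= big1 ?addr0 => [|l lb]; last first.
  by rewrite !mxE (negPf lb) mulr0.
rewrite !mxE eqxx mulr1n.
have -> : \sum_j kmx Y a j * yresolvent Y j b
    = - pnegser tau kappa (fun k => cemb hmu (ratc ((Y ^+ k.+1) a b))).
  apply: psdo_eq => z; rewrite -[RHS]/(- pnegser tau kappa _ z).
  have E (F : 'I_r -> P) : (\sum_j F j) z = \sum_j F j z.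
    by apply: (big_morph (fun G : P => G z)) => //=; rewrite if_same.
  rewrite E; under eq_bigr => j _ do rewrite !mxE [_ z]pmon0_mulE.
  case: z E => k E.
    by rewrite oppr0 big1 // => j _; rewrite -[X in _ * X]/(- 0) oppr0 mulr0.
  rewrite pnegser_neg exprS -mulmxE mxE !rmorph_sum /= -sumrN; apply: eq_bigr => j _.
  by rewrite -[X in _ * X]/(- _) mulrN !rmorphM.
apply: psdo_eq => z; rewrite mulNr.
rewrite -[LHS]/(- (pnegser tau kappa _ * y) z) mul_pmonE; last exact: ore_fixed1.
have dE : ((a == b)%:R : P) z = if z == 0 then (a == b)%:R else 0.
  by case: eqP => //= _; rewrite if_same.
rewrite mulr1 -[RHS]/(- pnegser tau kappa _ z - ((a == b)%:R : P) z) dE.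
case: z {dE} => [[|k]|k].
- rewrite /= oppr0 sub0r expr0 mxE; congr (- _).
  by case: eqP => _; rewrite ?rmorph1 ?rmorph0.
- have -> : k.+1%:Z - 1 = k by lia.
  by rewrite /= subr0.
- have -> : Negz k - 1 = Negz k.+1 by lia.
  by rewrite /= subr0.
Qed.
Lemma sum_psdoE (I : Type) (s : seq I) (F : I -> P) z : (\sum_(i <- s) F i) z = \sum_(i <- s) F i z.
Proof. by apply: (big_morph (fun G : P => G z)) => //=; rewrite if_same. Qed.

Lemma yresolventE r (Y : 'M[K]_r) a b z : yresolvent Y a b z
  = if z is Negz k then - cemb hmu (ratc ((Y ^+ k) a b)) else 0.
Proof. by rewrite mxE -[LHS]/(- pnegser tau kappa _ z); case: z => k //=; rewrite oppr0. Qed.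

Lemma y_yresolvent r (Y : 'M[K]_r) : y%:M *m yresolvent Y = yresolvent Y *m y%:M.
Proof.
apply/matrixP => a b; rewrite !mxE (bigD1 a) //= big1 ?addr0 => [|l la]; last first.
  by rewrite mxE eq_sym (negPf la) mul0r.
rewrite [RHS](bigD1 b) //= [X in _ = _ + X]big1 ?addr0 => [|l /negPf lb]; last first.
  by rewrite !mxE lb mulr0.
rewrite ![_%:M _ _]mxE !eqxx !mulr1n; apply: psdo_eq => z.
rewrite mul_pmonE ?mulr1; last exact: ore_fixed1.
apply: pmon_mulE => i; rewrite yresolventE; case: i => k.
  by rewrite -(rmorph0 (cemb hmu)) -(rmorph0 (@ratc K)); exact: ore_fixed_ratc.
by rewrite -!rmorphN; exact: ore_fixed_ratc.
Qed.

Lemma kmx_yresolvent r (Y C : 'M[K]_r) : C *m Y = Y *m C ->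
  kmx C *m yresolvent Y = yresolvent Y *m kmx C.
Proof.
move=> CY; apply/matrixP => a b; rewrite [LHS]mxE [RHS]mxE; apply: psdo_eq => z.
rewrite !sum_psdoE; under eq_bigr => j _ do rewrite [kmx C _ _]mxE [_ z]pmon0_mulE yresolventE.
under [RHS]eq_bigr => j _ do rewrite [kmx C _ _]mxE pconst_comm [_ z]pmon0_mulE yresolventE.
case: z => k; first by rewrite !big1 // => j _; rewrite mulr0.
have := congr1 (fun D : 'M[K]_r => D a b) (commrX k CY : C *m Y ^+ k = Y ^+ k *m C).
rewrite !mxE => e.
under eq_bigr => j _ do rewrite mulrN -!rmorphM.
under [RHS]eq_bigr => j _ do rewrite mulrN -!rmorphM mulrC.
by rewrite !sumrN -!rmorph_sum /= e.
Qed.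

Lemma yresolventK r (Y : 'M[K]_r) : (kmx Y - y%:M) *m yresolvent Y = 1%:M.
Proof. by rewrite mulmxBl y_yresolvent yresolvent_y subKr. Qed.
Lemma yresolventVK r (Y : 'M[K]_r) : yresolvent Y *m (kmx Y - y%:M) = 1%:M.
Proof. by rewrite mulmxBr yresolvent_y -kmx_yresolvent // subKr. Qed.

(** X - x is minus the characteristic matrix, so its determinant is up to sign the characteristic
    polynomial, which is monic. *)
Lemma det_resolvent r (X : 'M[K]_r) : \det (map_mx (@ratc K) X - (ratx K)%:M) != 0.
Proof.
have -> : map_mx (@ratc K) X - (ratx K)%:M = map_mx (@tofrac _) (- char_poly_mx X).
  rewrite map_mxN map_mxB opprB; congr (_ - _); last by rewrite map_scalar_mx.
  by apply/matrixP => a b; rewrite !mxE.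
rewrite det_map_mx tofrac_eq0 -scaleN1r detZ mulf_neq0 ?expf_neq0 ?oppr_eq0 ?oner_eq0 //.
by rewrite -/(char_poly X) monic_neq0 // char_poly_monic.
Qed.

Definition xresolvent p : 'M[P]_N := map_mx prat (resolventX p).

Lemma xdiffE p : kmx (totX p) - x%:M
  = map_mx prat (map_mx (@ratc K) (totX p) - (ratx K)%:M).
Proof. by rewrite map_mxB map_scalar_mx; congr (_ - _); apply/matrixP => a b; rewrite !mxE. Qed.
Lemma xresolventK p : (kmx (totX p) - x%:M) *m xresolvent p = 1%:M.
Proof. by rewrite xdiffE -map_mxM mulmxV ?map_mx1 // unitmxE unitfE det_resolvent. Qed.
Lemma xresolventVK p : xresolvent p *m (kmx (totX p) - x%:M) = 1%:M.
Proof. by rewrite xdiffE -map_mxM mulVmx ?map_mx1 // unitmxE unitfE det_resolvent. Qed.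
End WaveOperator.

Lemma comm_sub_expand (V : zmodType) (a b c e f g : V) :
  a - c - (b - e) - (f - b - (c - g)) = a - f - (g - e).
Proof.
rewrite !opprB addrACA !subrKA addrACA [RHS]addrACA; congr (_ + _); exact: addrC.
Qed.

Section ResolventCommutator.
Variables (R : pzRingType) (r : nat) (A B Ai Bi : 'M[R]_r).
Hypotheses (AAi : A *m Ai = 1%:M) (AiA : Ai *m A = 1%:M).
Hypotheses (BBi : B *m Bi = 1%:M) (BiB : Bi *m B = 1%:M).

(** Once V W has been replaced by [B, A], this and the next identity evaluate the quadratic terms of
    the products of M with the proposed inverse, in the two orders. *)
Lemma resolvents_comm :
  Ai *m Bi *m ((B *m A - A *m B) *m (Bi *m Ai)) = Bi *m Ai - Ai *m Bi.
Proof.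
rewrite mulmxBl mulmxBr; congr (_ - _).
  by rewrite !mulmxA -[Ai *m Bi *m B]mulmxA BiB mulmx1 AiA mul1mx.
by rewrite -!mulmxA [B *m _]mulmxA BBi mul1mx AAi mulmx1.
Qed.
Lemma resolvents_commV :
  Bi *m Ai *m ((B *m A - A *m B) *m (Ai *m Bi)) = Bi *m Ai - Ai *m Bi.
Proof.
rewrite mulmxBl mulmxBr; congr (_ - _).
  by rewrite -!mulmxA [A *m _]mulmxA AAi mul1mx BBi mulmx1.
by rewrite !mulmxA -[Bi *m Ai *m A]mulmxA AiA mulmx1 BiB mul1mx.
Qed.
End ResolventCommutator.

(** * The inverse of the wave operator *)

Section WaveInverse.
Variables (K : fieldType) (n d : nat) (mu : K) (hmu : n.+1.-primitive_root mu).
Variables (tau : K) (kappa : 'I_n.+1 -> K) (al : 'I_n.+1 -> nat).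
Local Notation S := (cdata hmu tau kappa).
Local Notation P := (psdo S).
Local Notation N := (\sum_i al i)%N.
Local Notation prat := (prat hmu tau kappa).
Local Notation pconst := (pconst hmu tau kappa).
Local Notation peps := (peps hmu tau kappa).
Local Notation kmx := (kmx hmu tau kappa).
Local Notation yres := (yresolvent hmu tau kappa).
Local Notation xres := (xresolvent hmu tau kappa).
Local Notation y := (pmon S 1 1 : P).
Local Notation x := (prat (ratx K)).
Implicit Types (i j c : 'I_n.+1) (p : quiver_rep K d al).

Lemma kmxZ r s a (C : 'M[K]_(r, s)) : kmx (a *: C) = (pconst a)%:M *m kmx C.
Proof. by rewrite mul_scalar_mx; apply/matrixP => i j; rewrite !mxE rmorphM. Qed.

(** The element e of the overview is the case c = 0. The shifted versions are needed because A^-1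
    lowers c by one and B^-1 raises it, so that neither commutes with e by itself. *)
Definition epsproj c : 'M[P]_N := \sum_i kmx (vproj K al (i + c)) *m (peps i)%:M.
Definition vtot p : 'M[P]_(N, d) := \sum_j kmx (totv p j) *m (peps j)%:M.
Definition wtot p : 'M[P]_(d, N) := \sum_i (peps i)%:M *m kmx (totw p i).

Lemma scalarM r (F G : P) : F%:M *m G%:M = (F * G)%:M :> 'M[P]_r.
Proof. by rewrite scalar_mxM. Qed.

Lemma scalarB r (F G : P) : (F - G)%:M = F%:M - G%:M :> 'M[P]_r.
Proof. exact: raddfB. Qed.
Lemma scalar_sum r (I : Type) (s : seq I) (F : I -> P) :
  (\sum_(i <- s) F i)%:M = \sum_(i <- s) (F i)%:M :> 'M[P]_r.
Proof. exact: raddf_sum. Qed.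

Lemma totX_epsproj p c : kmx (totX p) *m epsproj c = epsproj (c + inZp 1) *m kmx (totX p).
Proof.
rewrite mulmx_sumr mulmx_suml; apply: eq_bigr => i _.
by rewrite -[RHS]mulmxA kmx_comm !mulmxA -!kmxM addrA totX_vproj.
Qed.
Lemma x_epsproj c : x%:M *m epsproj c = epsproj (c + inZp 1) *m x%:M.
Proof.
rewrite mulmx_sumr mulmx_suml [RHS](@sum_shift _ (- inZp 1)); apply: eq_bigr => i _.
rewrite mulmxA kmx_comm -!mulmxA !scalarM.
have -> : i - inZp 1 + (c + inZp 1) = i + c by rewrite [c + _]addrC addrA subrK.
by have := peps_x hmu tau kappa (i - inZp 1); rewrite subrK => ->.
Qed.
Lemma totY_epsproj p c : kmx (totY p) *m epsproj (c + inZp 1) = epsproj c *m kmx (totY p).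
Proof.
rewrite mulmx_sumr mulmx_suml; apply: eq_bigr => i _.
by rewrite -[RHS]mulmxA kmx_comm !mulmxA -!kmxM addrA totY_vproj.
Qed.
Lemma y_epsproj c : y%:M *m epsproj (c + inZp 1) = epsproj c *m y%:M.
Proof.
rewrite mulmx_sumr mulmx_suml [RHS](@sum_shift _ (inZp 1)); apply: eq_bigr => i _.
rewrite mulmxA kmx_comm -!mulmxA !scalarM py_peps.
by have -> : i + inZp 1 + c = i + (c + inZp 1) by rewrite -addrA [inZp 1 + c]addrC.
Qed.
Lemma xres_epsproj p c : xres p *m epsproj (c + inZp 1) = epsproj c *m xres p.
Proof.
have e : (kmx (totX p) - x%:M) *m epsproj c = epsproj (c + inZp 1) *m (kmx (totX p) - x%:M).
  by rewrite mulmxBl mulmxBr totX_epsproj x_epsproj.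
rewrite -[LHS]mulmx1 -(xresolventK hmu tau kappa p) !mulmxA -[xres p *m _ *m _]mulmxA -e.
by rewrite !mulmxA xresolventVK mul1mx.
Qed.
Lemma yres_epsproj p c : yres (totY p) *m epsproj c = epsproj (c + inZp 1) *m yres (totY p).
Proof.
have e : (kmx (totY p) - y%:M) *m epsproj (c + inZp 1) = epsproj c *m (kmx (totY p) - y%:M).
  by rewrite mulmxBl mulmxBr totY_epsproj y_epsproj.
rewrite -[LHS]mulmx1 -(yresolventK hmu tau kappa (totY p)) !mulmxA -[yres _ *m _ *m _]mulmxA -e.
by rewrite !mulmxA yresolventVK mul1mx.
Qed.

Lemma epsproj_vtot p : epsproj 0 *m vtot p = vtot p.
Proof.
rewrite mulmx_sumr; apply: eq_bigr => j _; rewrite mulmx_suml [LHS](@sum_only1 _ _ j).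
  rewrite -mulmxA [_%:M *m _]mulmxA kmx_comm -[_ *m _ *m _%:M]mulmxA scalarM peps_mul eqxx.
  by rewrite mulmxA -kmxM addr0 totv_vproj eqxx.
move=> i ij; rewrite -mulmxA [_%:M *m _]mulmxA kmx_comm !mulmxA -kmxM addr0 totv_vproj (negPf ij).
by rewrite kmx0 !mul0mx.
Qed.

(** The orthogonality of the eps_i leaves only the products v_i w_i. *)
Lemma vtot_wtot p : vtot p *m wtot p = kmx (\sum_i totv p i *m totw p i) *m epsproj 0.
Proof.
rewrite mulmx_suml kmx_sum mulmx_suml; apply: eq_bigr => i _.
rewrite mulmx_sumr [LHS](@sum_only1 _ _ i); last first.
  move=> j ji; rewrite !mulmxA -[_ *m _ *m _%:M]mulmxA scalarM peps_mul eq_sym (negPf ji).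
  by rewrite (_ : (0 : P)%:M = 0) ?mulmx0 ?mulmx0 ?mul0mx //; apply/matrixP => a b; rewrite !mxE mul0rn.
rewrite mulmx_sumr [RHS](@sum_only1 _ _ i); last first.
  by move=> j ji; rewrite mulmxA -kmxM addr0 -mulmxA totw_vproj eq_sym (negPf ji) mulmx0 kmx0 mul0mx.
rewrite !mulmxA -[_ *m _ *m _%:M]mulmxA scalarM peps_mul eqxx addr0.
by rewrite -mulmxA kmx_comm !mulmxA -!kmxM -[_ *m vproj _ _ _]mulmxA totw_vproj eqxx.
Qed.

Variables (p : quiver_rep K d al).
Hypothesis momp : moment_eq (lambda tau kappa) p.
Local Notation X := (kmx (totX p)).
Local Notation Y := (kmx (totY p)).
Local Notation A := (X - x%:M).
Local Notation B := (Y - y%:M).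
Local Notation Ai := (xres p).
Local Notation Bi := (yres (totY p)).
Local Notation W := (wtot p).
Local Notation V := (vtot p).

(** Here [B, A] = [Y, X] - [x, y]. The moment map equation turns [Y, X] into \sum_i lambda_i 1_(V_i)
    + \sum_i v_i w_i, and its first part cancels [x, y] because 1_(V_i) e = eps_i e. *)
Lemma commBA : (B *m A - A *m B) *m epsproj 0 = V *m W.
Proof.
have -> : B *m A - A *m B = (Y *m X - X *m Y) - (x * y - y * x)%:M.
  rewrite !mulmxBl !mulmxBr !scalarM scalarB [y%:M *m X]kmx_comm [x%:M *m Y]kmx_comm.
  exact: comm_sub_expand.
rewrite mulmxBl -!kmxM -kmxN -kmxD vtot_wtot.
have -> : totY p *m totX p - totX p *m totY p
    = \sum_i lambda tau kappa i *: vproj K al i + \sum_i totv p i *m totw p i.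
  by rewrite -(proj1 (moment_eqP _ _) momp) subrK.
rewrite kmxD mulmxDl -[RHS]add0r addrAC; congr (_ + _); apply/eqP; rewrite subr_eq0; apply/eqP.
rewrite px_py scalar_sum kmx_sum mulmx_suml [RHS]mulmx_suml; apply: eq_bigr => i _.
rewrite mulmx_sumr [LHS](@sum_only1 _ _ i); last first.
  by move=> j ji; rewrite mulmxA -kmxM addr0 -scalemxAl vproj_mul eq_sym (negPf ji) scaler0 kmx0 mul0mx.
rewrite mulmx_sumr [RHS](@sum_only1 _ _ i); last first.
  move=> j ji; rewrite mulmxA kmx_comm -mulmxA scalarM -mulrA peps_mul eq_sym (negPf ji) mulr0.
  by rewrite (_ : (0 : P)%:M = 0) ?mulmx0 ?mul0mx //; apply/matrixP => a b; rewrite !mxE mul0rn.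
rewrite [RHS]mulmxA kmx_comm -[RHS]mulmxA scalarM -mulrA peps_mul eqxx addr0 mulmxA -kmxM -scalemxAl vproj_mul eqxx.
by rewrite kmxZ -scalarM kmx_comm mulmxA.
Qed.

Lemma epsproj_comm_xy : epsproj 0 *m (Ai *m Bi) = Ai *m Bi *m epsproj 0.
Proof. by rewrite -[RHS]mulmxA yres_epsproj [RHS]mulmxA xres_epsproj mulmxA. Qed.
Lemma epsproj_comm_yx : epsproj 0 *m (Bi *m Ai) = Bi *m Ai *m epsproj 0.
Proof.
(* The rule for moving A^-1 past [epsproj] applies to an index of the form c + 1. *)
have -> : epsproj 0 = epsproj (- inZp 1 + inZp 1) by rewrite addNr.
by rewrite -[RHS]mulmxA xres_epsproj [RHS]mulmxA yres_epsproj mulmxA.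
Qed.

Definition waveMi : 'M[P]_d := 1%:M + W *m (Bi *m Ai) *m V.

Lemma vtot_wtot_mul Z : epsproj 0 *m Z = Z *m epsproj 0 ->
  V *m W *m Z *m V = (B *m A - A *m B) *m Z *m V.
Proof. by move=> e; rewrite -commBA -!mulmxA [epsproj 0 *m _]mulmxA e -mulmxA epsproj_vtot. Qed.

Lemma waveK : (1%:M - W *m (Ai *m Bi) *m V) *m waveMi = 1%:M.
Proof.
rewrite /waveMi mulmxDr mulmx1 mulmxBl mul1mx.
have -> : W *m (Ai *m Bi) *m V *m (W *m (Bi *m Ai) *m V)
    = W *m (Ai *m Bi) *m (V *m W *m (Bi *m Ai) *m V) by rewrite !mulmxA.
rewrite (vtot_wtot_mul epsproj_comm_yx) [X in _ + (_ - X)]mulmxA -[X in _ + (_ - X *m _)]mulmxA.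
rewrite resolvents_comm ?(yresolventK, yresolventVK, xresolventK, xresolventVK) //.
rewrite mulmxBr mulmxBl opprB; set a := _ *m V; set b := _ *m V; clearbody a b.
by rewrite [b + (_ - _)]addrC subrK subrK.
Qed.

Lemma waveVK : waveMi *m (1%:M - W *m (Ai *m Bi) *m V) = 1%:M.
Proof.
rewrite /waveMi mulmxBr mulmx1 mulmxDl mul1mx.
have -> : W *m (Bi *m Ai) *m V *m (W *m (Ai *m Bi) *m V)
    = W *m (Bi *m Ai) *m (V *m W *m (Ai *m Bi) *m V) by rewrite !mulmxA.
rewrite (vtot_wtot_mul epsproj_comm_xy) [X in _ - (_ + X)]mulmxA -[X in _ - (_ + X *m _)]mulmxA.
rewrite resolvents_commV ?(yresolventK, yresolventVK, xresolventK, xresolventVK) //.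
by rewrite mulmxBr mulmxBl [X in _ - X]addrC subrK addrK.
Qed.
End WaveInverse.

(** * The map to the phase space of the hierarchy *)

Section LaxMapTheory.
Variables (K : fieldType) (n d : nat) (mu : K) (hmu : n.+1.-primitive_root mu).
Variables (tau : K) (kappa : 'I_n.+1 -> K) (al : 'I_n.+1 -> nat).
Local Notation S := (cdata hmu tau kappa).
Local Notation P := (psdo S).
Local Notation N := (\sum_i al i)%N.
Local Notation prat := (prat hmu tau kappa).
Local Notation pconst := (pconst hmu tau kappa).
Local Notation peps := (peps hmu tau kappa).
Local Notation kmx := (kmx hmu tau kappa).
Local Notation yres := (yresolvent hmu tau kappa).
Local Notation xres := (xresolvent hmu tau kappa).
Local Notation vtot := (vtot hmu tau kappa).
Local Notation wtot := (wtot hmu tau kappa).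
Local Notation waveM := (waveM hmu tau kappa).
Local Notation waveMi := (waveMi hmu tau kappa).
Local Notation laxL := (laxL hmu tau kappa).
Local Notation laxR := (laxR hmu tau kappa).
Local Notation y := (pmon S 1 1 : P).
Implicit Types (i j c : 'I_n.+1) (p q : quiver_rep K d al).

Lemma yres_kmx r s (Y : 'M[K]_r) (C : 'M[K]_(r, s)) a b z :
  (yres Y *m kmx C) a b z = if z is Negz k then - cemb hmu (ratc ((Y ^+ k *m C) a b)) else 0.
Proof.
rewrite mxE sum_psdoE; under eq_bigr => j _ do rewrite [kmx C _ _]mxE pconst_comm [_ z]pmon0_mulE yresolventE.
case: z => k; first by rewrite big1 // => j _; rewrite mulr0.
rewrite mxE !rmorph_sum /= -sumrN; apply: eq_bigr => j _.
by rewrite mulrN -!rmorphM mulrC.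
Qed.

Lemma prat_yres_kmx r s t (C : 'M[{fraction {poly K}}]_(t, r)) (Y : 'M[K]_r) (D : 'M[K]_(r, s)) a b z :
  (map_mx prat C *m (yres Y *m kmx D)) a b z
  = if z is Negz k then - cemb hmu ((C *m map_mx (@ratc K) (Y ^+ k *m D)) a b) else 0.
Proof.
rewrite mxE sum_psdoE.
under eq_bigr => l _ do rewrite [map_mx prat _ _ _]mxE [_ z]pmon0_mulE yres_kmx.
case: z => k; first by rewrite big1 // => l _; rewrite mulr0.
rewrite mxE rmorph_sum -sumrN; apply: eq_bigr => l _.
by rewrite mulrN rmorphM /= [map_mx _ (_ *m _) _ _]mxE.
Qed.

Lemma kmxE r s (C : 'M[K]_(r, s)) : kmx C = map_mx prat (map_mx (@ratc K) C).
Proof. by apply/matrixP => a b; rewrite !mxE. Qed.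

(** In this product the rational functions already stand to the left of the powers of y, and the
    remaining constants are central, so the coefficients can be read off directly. *)
Lemma wXYv_seriesE p i j : wXYv_series hmu tau kappa p i j
  = kmx (totw p i) *m (xres p *m yres (totY p)) *m kmx (totv p j).
Proof.
have -> : kmx (totw p i) *m (xres p *m yres (totY p)) *m kmx (totv p j)
    = map_mx prat (map_mx (@ratc K) (totw p i) *m resolventX p)
      *m (yres (totY p) *m kmx (totv p j)).
  by rewrite map_mxM -kmxE !mulmxA.
apply/matrixP => a b; apply: psdo_eq => z; rewrite prat_yres_kmx.
by rewrite mxE -[LHS]/(- pnegser tau kappa _ z); case: z => k //=; rewrite oppr0.
Qed.

Lemma waveME p : waveM p = 1%:M - wtot p *m (xres p *m yres (totY p)) *m vtot p.
Proof.
rewrite /waveM; congr (_ - _); rewrite /wtot !mulmx_suml; apply: eq_bigr => i _.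
rewrite /vtot mulmx_sumr; apply: eq_bigr => j _.
by rewrite wXYv_seriesE !mulmxA.
Qed.

Lemma mxinvE (M Mi : 'M[P]_d) : M *m Mi = 1%:M -> Mi *m M = 1%:M -> mxinv M = Mi.
Proof.
move=> MMi MiM; rewrite /mxinv; case: xgetP => [B _ [_ BM]|]; last first.
  by move=> /(_ Mi); case.
by rewrite -[B]mulmx1 -MMi mulmxA BM mul1mx.
Qed.

Lemma mxbounded_kmx r s (C : 'M[K]_(r, s)) : mxbounded 0 (kmx C).
Proof. by move=> a b; rewrite mxE; exact: pmon_bounded. Qed.
Lemma mxbounded_xres p : mxbounded 0 (xres p).
Proof. by move=> a b; rewrite mxE; exact: pmon_bounded. Qed.
Lemma mxbounded_yres r (Y : 'M[K]_r) : mxbounded (-1) (yres Y).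
Proof. by move=> a b z z0; rewrite yresolventE; case: z z0 => k //; rewrite NegzE; lia. Qed.
Lemma mxbounded_vtot p : mxbounded 0 (vtot p).
Proof.
apply: mxbounded_sum => i _; rewrite -[X in mxbounded X _]addr0; apply: mxboundedM.
  exact: mxbounded_kmx.
by apply: mxbounded_scalar; exact: pmon_bounded.
Qed.
Lemma mxbounded_wtot p : mxbounded 0 (wtot p).
Proof.
apply: mxbounded_sum => i _; rewrite -[X in mxbounded X _]addr0; apply: mxboundedM.
  by apply: mxbounded_scalar; exact: pmon_bounded.
exact: mxbounded_kmx.
Qed.
Lemma waveM_bounded p : mxbounded (-1) (waveM p - 1%:M).
Proof.
rewrite waveME addrAC subrr sub0r; apply: mxboundedN.
apply: (@mxbounded_le _ _ _ _ (0 + (0 + -1) + 0)) => //; apply: mxboundedM; last exact: mxbounded_vtot.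
apply: mxboundedM; first exact: mxbounded_wtot.
by apply: mxboundedM; [exact: mxbounded_xres | exact: mxbounded_yres].
Qed.
Lemma waveMi_bounded p : mxbounded (-1) (waveMi p - 1%:M).
Proof.
rewrite /waveMi addrAC subrr add0r.
apply: (@mxbounded_le _ _ _ _ (0 + (-1 + 0) + 0)) => //; apply: mxboundedM; last exact: mxbounded_vtot.
apply: mxboundedM; first exact: mxbounded_wtot.
by apply: mxboundedM; [exact: mxbounded_yres | exact: mxbounded_xres].
Qed.

Lemma one_coef (z : int) (b : bool) : ((b%:R : P) : int -> _) z = b%:R *+ (z == 0).
Proof. by case: b; rewrite /= ?if_same ?mul0rn //; case: eqP. Qed.

Lemma wave_form_bounded (M : 'M[P]_d) : mxbounded (-1) (M - 1%:M) -> wave_form M.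
Proof.
move=> h a b z z0; have /(_ z) := h a b; rewrite !mxE => h'.
have {h'} : M a b z - ((a == b)%:R : P) z = 0 by apply: h'; lia.
by move/eqP; rewrite subr_eq0 => /eqP ->; exact: one_coef.
Qed.

Section Level.
Variable p : quiver_rep K d al.
Hypothesis momp : moment_eq (lambda tau kappa) p.

Lemma waveM_Mi : waveM p *m waveMi p = 1%:M.
Proof. by rewrite waveME; exact: waveK. Qed.
Lemma waveMi_M : waveMi p *m waveM p = 1%:M.
Proof. by rewrite waveME; exact: waveVK. Qed.
Lemma mxinv_wave : mxinv (waveM p) = waveMi p.
Proof. by apply: mxinvE; [exact: waveM_Mi | exact: waveMi_M]. Qed.

Lemma laxLE : laxL p = waveM p *m y%:M *m waveMi p.
Proof. by rewrite /laxL mxinv_wave. Qed.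
Lemma laxRE g : laxR p g = waveM p *m delta_mx g g *m waveMi p.
Proof. by rewrite /laxR mxinv_wave. Qed.

Lemma wave_conjM (C D : 'M[P]_d) :
  (waveM p *m C *m waveMi p) *m (waveM p *m D *m waveMi p) = waveM p *m (C *m D) *m waveMi p.
Proof. by rewrite !mulmxA -[_ *m waveMi p *m waveM p]mulmxA waveMi_M mulmx1. Qed.

Lemma y_delta g : y%:M *m delta_mx g g = delta_mx g g *m y%:M :> 'M[P]_d.
Proof. by rewrite -(map_delta_mx pconst) -/(kmx _) kmx_comm. Qed.

(** Write M = 1 + U and M^-1 = 1 + U' with U and U' of order at most -1: only y, resp. E_g,
    contributes to the leading powers. The algebraic relations are those of y and the E_g,
    conjugated by M. *)
Lemma lax_hier_space : hier_space (laxL p) (laxR p).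
Proof.
have UM := waveM_bounded p; have UMi := waveMi_bounded p.
have ME : waveM p = 1%:M + (waveM p - 1%:M) by rewrite addrC subrK.
have MiE : waveMi p = 1%:M + (waveMi p - 1%:M) by rewrite addrC subrK.
move: (waveM p - 1%:M) (waveMi p - 1%:M) UM UMi ME MiE => U U' bU bU' ME MiE.
have yb : mxbounded 1 (y%:M : 'M[P]_d) by apply: mxbounded_scalar; exact: pmon_bounded.
split.
- move=> a b z z1.
  have -> : laxL p = y%:M + (y%:M *m U' + (U *m y%:M + U *m y%:M *m U')).
    by rewrite laxLE ME MiE mulmxDl mul1mx mulmxDl !mulmxDr !mulmx1 !addrA.
  have b0 : mxbounded 0 (y%:M *m U' + (U *m y%:M + U *m y%:M *m U')).
    apply: mxboundedD; first by apply: (@mxbounded_le _ _ _ _ (1 + -1)) => //; exact: mxboundedM.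
    apply: mxboundedD; first by apply: (@mxbounded_le _ _ _ _ (-1 + 1)) => //; exact: mxboundedM.
    apply: (@mxbounded_le _ _ _ _ (-1 + 1 + -1)) => //.
    by apply: mxboundedM => //; exact: mxboundedM.
  rewrite mxE -[LHS]/(_ z + _ z) b0 ?addr0; last by lia.
  rewrite mxE; case: (a == b) => /=; last by rewrite mul0rn if_same.
  by case: eqP.
- move=> g a b z z0; have E0 : mxbounded 0 (delta_mx g g : 'M[P]_d).
    by rewrite -(map_delta_mx pconst); exact: mxbounded_kmx.
  have -> : laxR p g = delta_mx g g + (delta_mx g g *m U' + (U *m delta_mx g g + U *m delta_mx g g *m U')).
    by rewrite laxRE ME MiE mulmxDl mul1mx mulmxDl !mulmxDr !mulmx1 !addrA.
  have b0 : mxbounded (-1) (delta_mx g g *m U' + (U *m delta_mx g g + U *m delta_mx g g *m U')).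
    apply: mxboundedD; first by apply: (@mxbounded_le _ _ _ _ (0 + -1)) => //; exact: mxboundedM.
    apply: mxboundedD; first by apply: (@mxbounded_le _ _ _ _ (-1 + 0)) => //; exact: mxboundedM.
    apply: (@mxbounded_le _ _ _ _ (-1 + 0 + -1)) => //.
    by apply: mxboundedM => //; exact: mxboundedM.
  rewrite mxE -[LHS]/(_ z + _ z) b0 ?addr0; last by lia.
  by rewrite mxE; exact: one_coef.
- by move=> g; rewrite /lie laxLE laxRE !wave_conjM y_delta subrr.
- move=> g b; rewrite !laxRE wave_conjM; case: eqP => [<-|/eqP gb].
    by rewrite mul_delta_mx.
  by rewrite mul_delta_mx_0 // mulmx0 mul0mx.
- under eq_bigr => g _ do rewrite laxRE.
  rewrite -mulmx_suml -mulmx_sumr.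
  have -> : \sum_i delta_mx i i = 1%:M :> 'M[P]_d.
    apply/matrixP => a b; rewrite summxE (bigD1 a) //= big1 ?addr0 => [|i ia].
      by rewrite !mxE eqxx eq_sym.
    by rewrite mxE eq_sym (negPf ia).
  by rewrite mulmx1 waveM_Mi.
Qed.
End Level.

Lemma resolventX_conj p q (G H : 'M[K]_N) : G *m H = 1%:M -> H *m G = 1%:M ->
  totX q = G *m totX p *m H ->
  resolventX q = map_mx (@ratc K) G *m resolventX p *m map_mx (@ratc K) H.
Proof.
move=> GH HG eX; rewrite /resolventX eX !map_mxM.
have rG : map_mx (@ratc K) H *m map_mx (@ratc K) G = 1%:M by rewrite -map_mxM HG map_mx1.
have rH : map_mx (@ratc K) G *m map_mx (@ratc K) H = 1%:M by rewrite -map_mxM GH map_mx1.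
have uX : map_mx (@ratc K) (totX p) - (ratx K)%:M \in unitmx.
  by rewrite unitmxE unitfE det_resolvent.
move: rG rH uX; move: (map_mx _ G) (map_mx _ H) (map_mx _ (totX p)) => G' H' X' rG rH uX.
have -> : G' *m X' *m H' - (ratx K)%:M = G' *m (X' - (ratx K)%:M) *m H'.
  by rewrite mulmxBr mulmxBl mul_mx_scalar -scalemxAl rH scalemx1.
move: uX; move: (X' - _) => A uA.
have uGAH : G' *m A *m H' \in unitmx.
  by rewrite !unitmx_mul uA andbT (proj1 (mulmx1_unit rH)) (proj1 (mulmx1_unit rG)).
rewrite -[RHS](mulKmx uGAH) -[LHS]mulmx1; congr (_ *m _).
rewrite !mulmxA -[_ *m H' *m G']mulmxA rG mulmx1.
rewrite -[G' *m A *m invmx A]mulmxA mulmxV; last exact: uA.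
by rewrite mulmx1; exact/esym.
Qed.

Lemma wXYv_equiv p q i j k : gl_equiv p q -> wXYv p i j k = wXYv q i j k.
Proof.
case/gl_equiv_tot => G [H [GH HG eX eY evw]]; rewrite /wXYv.
have [-> _] := evw j; have [_ ->] := evw i; rewrite (resolventX_conj GH HG eX).
have -> : totY q ^+ k = G *m totY p ^+ k *m H.
  rewrite eY; elim: k => [|k IH]; first by rewrite !expr0 mulmx1 GH.
  rewrite !exprS IH -!mulmxE !mulmxA -[_ *m H *m G]mulmxA HG mulmx1.
  by [].
have rG : map_mx (@ratc K) H *m map_mx (@ratc K) G = 1%:M by rewrite -map_mxM HG map_mx1.
have -> : G *m totY p ^+ k *m H *m (G *m totv p j) = G *m (totY p ^+ k *m totv p j).
  by rewrite !mulmxA -[_ *m H *m G]mulmxA HG mulmx1.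
rewrite [map_mx _ (totw p i *m H)]map_mxM [map_mx _ (G *m _)]map_mxM.
move: rG; move: (map_mx _ G) (map_mx _ H) (resolventX p) (map_mx _ (totw p i)).
move: (map_mx _ (_ *m totv p j)) => v G' H' A w rG.
by rewrite !mulmxA -[w *m H' *m G']mulmxA rG mulmx1 -[_ *m H' *m G']mulmxA rG mulmx1.
Qed.

Lemma waveM_equiv p q : gl_equiv p q -> waveM p = waveM q.
Proof.
move=> pq; have e : wXYv_series hmu tau kappa p = wXYv_series hmu tau kappa q.
  apply/funext => i; apply/funext => j; apply/matrixP => a b; rewrite [LHS]mxE [RHS]mxE.
  have e : wXYv p i j = wXYv q i j by apply/funext => k; exact: wXYv_equiv.
  by rewrite e.
by rewrite /waveM e.
Qed.

(** The map is defined through a chosen representative of the orbit; the invariance of M under the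
    group removes the dependence on the choice. *)
Lemma cm_lax_class (p : cm_level d al (lambda tau kappa)) :
  cm_space_lax hmu (cm_class p) = (laxL (val p), laxR (val p)).
Proof.
have e : waveM (val (repr (cm_class p))) = waveM (val p).
  apply: waveM_equiv; apply/asboolP.
  by have /eqP := reprK (cm_class p); rewrite eqmodE.
by rewrite /cm_space_lax /laxL /laxR e.
Qed.
End LaxMapTheory.

(** * The wave operator along the flow *)

Lemma sub_rearrange (V : zmodType) (f a s b e : V) :
  - (a - - s - (b + e)) + (f - b) = f - a + (e - s).
Proof.
rewrite opprK opprB addrC -[b + e - _]addrA subrKA opprD [e + (_ + _)]addrCA.
by rewrite [LHS]addrA.
Qed.

(** * The derivative of the wave operator, in an abstract ring *)

Section WaveFlow.
Variables (R : pzRingType) (r d : nat).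
Variables (A Ai B Bi Pi : 'M[R]_r) (V : 'M[R]_(r, d)) (W : 'M[R]_(d, r)) (F : 'M[R]_d).
Variables (c : nat -> 'M[R]_r) (k : nat) (dX : 'M[R]_r).
Hypotheses (AAi : A *m Ai = 1%:M) (AiA : Ai *m A = 1%:M).
Hypotheses (BBi : B *m Bi = 1%:M) (BiB : Bi *m B = 1%:M).
Hypothesis VW : V *m W *m (Bi *m Ai) *m V = (B *m A - A *m B) *m (Bi *m Ai) *m V.
Hypothesis Bc : forall a, B *m c a = c a *m B.
Hypothesis PiAB : Pi *m (Ai *m Bi *m V) = Ai *m Bi *m V.

(** In the application c a = y^(-1-a) Y^a, so that T j is y^-j Y^j; F is y^k E_b and Pi is e. Only
    the product of X' with e is prescribed. *)
Let U j := \sum_(a < j) c a.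
Let T j := 1%:M + B *m U j.
Let M := 1%:M - W *m (Ai *m Bi) *m V.
Let Mi := 1%:M + W *m (Bi *m Ai) *m V.

Hypothesis dX_Pi : dX *m Pi = - \sum_(a < k) c a *m V *m F *m W *m T (k - a - 1).

(** The commutator identity gives A^-1 B^-1 V M^-1 = B^-1 A^-1 V. The factor B in T j then cancels
    the infinite series B^-1, and only the finite sum U j is left. *)
Lemma cut_wave j : (1%:M - W *m T j *m (Ai *m Bi) *m V) *m Mi = 1%:M - W *m U j *m Ai *m V.
Proof.
have BU : B *m U j = U j *m B.
  by rewrite mulmx_sumr mulmx_suml; apply: eq_bigr => a _.
rewrite mulmxBl mul1mx [X in _ - X]mulmxDr mulmx1.
have -> : W *m T j *m (Ai *m Bi) *m V *m (W *m (Bi *m Ai) *m V)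
    = W *m T j *m (Bi *m Ai - Ai *m Bi) *m V.
  transitivity (W *m T j *m (Ai *m Bi) *m (V *m W *m (Bi *m Ai) *m V)); first by rewrite !mulmxA.
  by rewrite VW -(resolvents_comm AAi AiA BBi BiB) !mulmxA.
rewrite [W *m T j *m (_ - _)]mulmxBr [(_ - _) *m V]mulmxBl [_ + (_ - _)]addrC subrK.
have -> : W *m T j *m (Bi *m Ai) *m V = W *m (Bi *m Ai) *m V + W *m U j *m Ai *m V.
  rewrite /T mulmxDr mulmx1 2!mulmxDl; congr (_ + _).
  by rewrite BU !mulmxA -[_ *m B *m Bi]mulmxA BBi mulmx1.
by rewrite opprD addrA /Mi addrK.
Qed.

(** [dM] is the product rule for M with the flow inserted. M' + M F is first regrouped into
    multiples of 1 - W (T j) A^-1 B^-1 V, the form to which [cut_wave] applies. The term M F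
    supplies the summands F and - W A^-1 B^-1 V F that this regrouping needs. *)
Lemma wave_flow :
  let dM := - (F *m W *m T k *m (Ai *m Bi) *m V - W *m (Ai *m dX *m Ai *m Bi) *m V
     - W *m (Ai *m Bi) *m (T k *m V *m F)) in
  dM *m Mi + M *m F *m Mi
  = F *m (1%:M - W *m U k *m Ai *m V)
    + \sum_(a < k) W *m Ai *m c a *m V *m F *m (1%:M - W *m U (k - a - 1) *m Ai *m V).
Proof.
move=> dM; rewrite -mulmxDl.
have -> : dM + M *m F = F *m (1%:M - W *m T k *m (Ai *m Bi) *m V)
    + \sum_(a < k) W *m Ai *m c a *m V *m F *m (1%:M - W *m T (k - a - 1) *m (Ai *m Bi) *m V).
  have E1 : W *m (Ai *m dX *m Ai *m Bi) *m V
      = - \sum_(a < k) W *m Ai *m c a *m V *m F *m (W *m T (k - a - 1) *m (Ai *m Bi) *m V).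
    have -> : W *m (Ai *m dX *m Ai *m Bi) *m V = W *m Ai *m (dX *m Pi) *m (Ai *m Bi *m V).
      have e : dX *m Ai *m Bi *m V = dX *m Pi *m (Ai *m Bi *m V) by rewrite -[RHS]mulmxA PiAB !mulmxA.
      by rewrite -[RHS]mulmxA -e !mulmxA.
    rewrite dX_Pi mulmxN mulNmx mulmx_sumr mulmx_suml; congr (- _); apply: eq_bigr => a _.
    by rewrite !mulmxA.
  have E2 : W *m (Ai *m Bi) *m (T k *m V *m F) = W *m (Ai *m Bi) *m V *m F
      + \sum_(a < k) W *m Ai *m c a *m V *m F.
    have -> : \sum_(a < k) W *m Ai *m c a *m V *m F = W *m Ai *m U k *m V *m F.
      by rewrite mulmx_sumr !mulmx_suml.
    rewrite /T !mulmxDl mul1mx mulmxDr !mulmxA; congr (_ + _).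
    by rewrite -[W *m Ai *m Bi *m B]mulmxA BiB mulmx1.
  rewrite /dM E1 E2 /M mulmxBl mul1mx mulmxBr mulmx1.
  under [X in _ = _ + X]eq_bigr => a _ do rewrite mulmxBr mulmx1.
  rewrite sumrB.
  have -> : F *m W *m T k *m (Ai *m Bi) *m V = F *m (W *m T k *m (Ai *m Bi) *m V).
    by rewrite !mulmxA.
  exact: sub_rearrange.
rewrite mulmxDl -mulmxA cut_wave mulmx_suml; congr (_ + _); apply: eq_bigr => a _.
by rewrite -mulmxA cut_wave.
Qed.
End WaveFlow.

(** * Counting powers of y along the flow *)

Section WaveFlowTerms.
Variables (K : fieldType) (n d : nat) (mu : K) (hmu : n.+1.-primitive_root mu).
Variables (tau : K) (kappa : 'I_n.+1 -> K) (al : 'I_n.+1 -> nat).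
Local Notation S := (cdata hmu tau kappa).
Local Notation P := (psdo S).
Local Notation N := (\sum_i al i)%N.
Local Notation peps := (peps hmu tau kappa).
Local Notation kmx := (kmx hmu tau kappa).
Local Notation vtot := (vtot hmu tau kappa).
Local Notation wtot := (wtot hmu tau kappa).
Local Notation y a := (pmon S a%R 1 : P).
Implicit Types (i j l : 'I_n.+1).

Lemma inZpS k : inZp k.+1 = inZp k + inZp 1 :> 'I_n.+1.
Proof. by apply: val_inj; rewrite /= modnDm addn1. Qed.

Lemma ypow_peps (k : nat) i : y k%:Z * peps i = peps (i + inZp k) * y k%:Z.
Proof.
elim: k i => [|k IH] i.
  have -> : inZp 0 = 0 :> 'I_n.+1 by apply: val_inj.
  by rewrite addr0 -[y _]/(1 : P) mul1r mulr1.
have -> : y k.+1%:Z = y 1 * y k%:Z by rewrite pmonD -PoszD.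
by rewrite -mulrA IH mulrA py_peps (inZpS k) addrA mulrA.
Qed.
Lemma ypowN_peps (k : nat) i : y (- k%:Z) * peps (i + inZp k) = peps i * y (- k%:Z).
Proof.
have e : y (- k%:Z) * y k%:Z = 1 by rewrite pmonD addNr.
have e' : y k%:Z * y (- k%:Z) = 1 by rewrite pmonD subrr.
by rewrite -[LHS]mulr1 -e' mulrA -[_ * peps _ * _]mulrA -ypow_peps mulrA e mul1r.
Qed.
Lemma ypow_peps_ex (a : int) i : exists j, y a * peps i = peps j * y a.
Proof.
case: a => k; first by exists (i + inZp k); exact: ypow_peps.
rewrite NegzE; exists (i - inZp k.+1).
by rewrite -ypowN_peps subrK.
Qed.
Lemma pnneg_peps i (a : int) : 0 <= a -> pnneg (peps i * y a).
Proof. by move=> a0; apply: pnnegM; exact: pnneg_mon. Qed.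
Lemma pnneg_peps1 (a b : int) i : 0 <= a + b -> pnneg (y a * peps i * y b).
Proof.
by move=> ab; have [j ->] := ypow_peps_ex a i; rewrite -mulrA pmonD; exact: pnneg_peps.
Qed.
Lemma pnneg_peps2 (a b c : int) i j : 0 <= a + b + c ->
  pnneg (y a * peps i * y b * peps j * y c).
Proof.
move=> abc; have [i' ->] := ypow_peps_ex a i; rewrite -[peps i' * _ * _]mulrA pmonD.
rewrite -!mulrA [y _ * (_ * _)]mulrA; apply: pnnegM; last exact: pnneg_peps1.
exact: pnneg_mon.
Qed.

(** An element of P times a constant matrix: in products the two factors multiply independently, so
    the powers of y can be read off the first one. *)
Definition skmx r s (f : P) (C : 'M[K]_(r, s)) : 'M[P]_(r, s) := f%:M *m kmx C.

Lemma skmxM r s t f g (C : 'M[K]_(r, s)) (D : 'M[K]_(s, t)) :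
  skmx f C *m skmx g D = skmx (f * g) (C *m D).
Proof.
by rewrite /skmx -mulmxA [kmx C *m _]mulmxA -kmx_comm -[g%:M *m _ *m _]mulmxA -kmxM mulmxA scalarM.
Qed.
Lemma skmx0l r s (C : 'M[K]_(r, s)) : skmx 0 C = 0.
Proof.
rewrite /skmx (_ : (0 : P)%:M = 0) ?mul0mx //.
by apply/matrixP => a b; rewrite !mxE mul0rn.
Qed.
Lemma skmxN r s f (C : 'M[K]_(r, s)) : skmx f (- C) = - skmx f C.
Proof. by rewrite /skmx kmxN mulmxN. Qed.
Lemma mxnneg_skmx r s f (C : 'M[K]_(r, s)) : pnneg f -> mxnneg (skmx f C).
Proof.
move=> f0; apply: mxnnegM; first exact: mxnneg_scalar.
by move=> a b; rewrite mxE; exact: pnneg_mon.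
Qed.
Lemma kmx_skmx r s (C : 'M[K]_(r, s)) : kmx C = skmx 1 C.
Proof. by rewrite /skmx mul1mx. Qed.

Variable p : quiver_rep K d al.
Local Notation X := (totX p).
Local Notation Y := (totY p).
Local Notation V := (vtot p).
Local Notation W := (wtot p).

Lemma wtotE : W = \sum_i skmx (peps i) (totw p i).
Proof. by []. Qed.
Lemma vtotE : V = \sum_i skmx (peps i) (totv p i).
Proof. by rewrite /vtot; apply: eq_bigr => i _; rewrite -kmx_comm. Qed.

Lemma mxnneg_vtot : mxnneg V.
Proof. by rewrite vtotE; apply: mxnneg_sum => i _; apply: mxnneg_skmx; exact: pnneg_mon. Qed.
Lemma mxnneg_wtot : mxnneg W.
Proof. by rewrite wtotE; apply: mxnneg_sum => i _; apply: mxnneg_skmx; exact: pnneg_mon. Qed.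
Lemma mxnneg_xres : mxnneg (xresolvent hmu tau kappa p).
Proof. by move=> a b; rewrite mxE; exact: pnneg_mon. Qed.

Definition ycoef (a : nat) : 'M[P]_N := skmx (y (-1 - a%:Z)) (Y ^+ a).

Lemma ycoef_comm a : (kmx Y - (y 1)%:M) *m ycoef a = ycoef a *m (kmx Y - (y 1)%:M).
Proof.
have yE : (y 1)%:M = skmx (y 1) (1%:M : 'M[K]_N) by rewrite /skmx kmx1 mulmx1.
rewrite yE kmx_skmx mulmxBl mulmxBr /ycoef !skmxM !mul1mx !mulmx1 mul1r mulr1 !pmonD.
rewrite [1 + _]addrC; congr (skmx _ _ - _).
by rewrite -[Y *m _]/(Y * _) -[_ *m Y]/(_ * Y) -exprS exprSr.
Qed.

(** The sum telescopes, because (Y - y) y^(-1-a) Y^a = y^(-1-a) Y^(a+1) - y^-a Y^a. *)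
Lemma ycoef_sum (j : nat) : 1%:M + (kmx Y - (y 1)%:M) *m (\sum_(a < j) ycoef a) = skmx (y (- j%:Z)) (Y ^+ j).
Proof.
elim: j => [|j IH]; first by rewrite [\sum_(a < 0) _]big_ord0 mulmx0 addr0 /skmx expr0 kmx1 mulmx1.
rewrite [\sum_(a < j.+1) _]big_ord_recr /= mulmxDr addrA IH.
have yE : (y 1)%:M = skmx (y 1) (1%:M : 'M[K]_N) by rewrite /skmx kmx1 mulmx1.
rewrite yE kmx_skmx mulmxBl /ycoef !skmxM !mul1mx mul1r pmonD.
have -> : 1 + (-1 - j%:Z) = - j%:Z by lia.
have -> : -1 - j%:Z = - j.+1%:Z by lia.
by rewrite addrC subrK -[Y *m _]/(Y * _) -exprS.
Qed.

Variables (k : nat) (E : 'M[K]_d).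
Local Notation F := (skmx (y k%:Z) E).
Local Notation T j := (skmx (y (- j%:Z)) (Y ^+ j)).

Lemma ypow_conj (j : nat) i : y j%:Z * peps i * y (- j%:Z) = peps (i + inZp j).
Proof. by rewrite ypow_peps -mulrA pmonD subrr mulr1. Qed.
Lemma ypow_conjV (j : nat) i : y (- j%:Z) * peps (i + inZp j) * y j%:Z = peps i.
Proof. by rewrite ypowN_peps -mulrA pmonD addNr mulr1. Qed.

(** Conjugation by y^k shifts the index of eps_i by k; this accounts for the index i - k in the
    equation for w_i. *)
Lemma wtot_flow :
  \sum_i skmx (peps i) (E *m totw p (i - inZp k) *m Y ^+ k) = F *m W *m T k.
Proof.
rewrite wtotE mulmx_sumr mulmx_suml [LHS](@sum_shift _ (inZp k)); apply: eq_bigr => i _.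
by rewrite !skmxM addrK ypow_conj.
Qed.
Lemma vtot_flow :
  \sum_j skmx (peps j) (- (Y ^+ k *m totv p (j + inZp k) *m E)) = - (T k *m V *m F).
Proof.
rewrite vtotE mulmx_sumr mulmx_suml -sumrN [RHS](@sum_shift _ (inZp k)); apply: eq_bigr => i _.
by rewrite !skmxM skmxN ypow_conjV.
Qed.

Lemma totY_pow_vproj (j : nat) i : vproj K al i *m Y ^+ j = Y ^+ j *m vproj K al (i + inZp j).
Proof.
elim: j i => [|j IH] i.
  have -> : inZp 0 = 0 :> 'I_n.+1 by apply: val_inj.
  by rewrite addr0 expr0 mul1mx mulmx1.
rewrite exprS -[Y * _]/(Y *m _) mulmxA -totY_vproj -mulmxA IH mulmxA.
by rewrite -addrA [inZp 1 + _]addrC -inZpS.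
Qed.

Lemma totw_pow_vproj i l (j : nat) :
  totw p i *m Y ^+ j *m vproj K al l = if i + inZp j == l then totw p i *m Y ^+ j else 0.
Proof.
rewrite -[l in LHS](subrK (inZp j)) -mulmxA -totY_pow_vproj mulmxA totw_vproj.
rewrite -(inj_eq (addIr (inZp j))) subrK; case: eqP => // _.
by rewrite mul0mx.
Qed.

(** The product eps_l y^k eps_i vanishes unless l = i + k, and e selects for w_i Y^(k-a-1) the
    vertex i + k - a - 1 on which it is supported. Both sides thus become sums over i and a with
    equal terms. *)
Lemma totX_flow :
  kmx (- \sum_l \sum_(a < k) Y ^+ a *m totv p l *m E *m totw p (l - inZp k) *m Y ^+ (k - a - 1))
    *m epsproj hmu tau kappa al 0
  = - \sum_(a < k) ycoef a *m V *m F *m W *m T (k - a - 1).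
Proof.
rewrite kmxN mulNmx; congr (- _); rewrite exchange_big /= kmx_sum mulmx_suml.
apply: eq_bigr => a _; rewrite kmx_sum mulmx_suml [LHS](@sum_shift _ (inZp k)).
have -> : ycoef a *m V *m F *m W *m T (k - a - 1) = \sum_i ycoef a *m V *m F
    *m skmx (peps i) (totw p i) *m T (k - a - 1).
  by rewrite wtotE mulmx_sumr mulmx_suml.
apply: eq_bigr => i _; rewrite addrK.
have -> : ycoef a *m V *m F *m skmx (peps i) (totw p i) *m T (k - a - 1)
    = \sum_l ycoef a *m skmx (peps l) (totv p l) *m F *m skmx (peps i) (totw p i) *m T (k - a - 1).
  by rewrite vtotE mulmx_sumr !mulmx_suml.
rewrite [RHS](@sum_only1 _ _ (i + inZp k)); last first.
  move=> l li; rewrite !skmxM -[_ * peps l * _ * _]mulrA ypow_peps mulrA -[_ * peps l * _]mulrA.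
  by rewrite peps_mul (negPf li) mulr0 !mul0r skmx0l.
rewrite mulmx_sumr [LHS](@sum_only1 _ _ (i + inZp (k - a - 1))); last first.
  move=> l li; rewrite mulmxA -kmxM addr0 -[X in kmx X]mulmxA -[X in kmx X]mulmxA.
  by rewrite [X in kmx (_ *m X)]mulmxA totw_pow_vproj eq_sym (negPf li) mulmx0 kmx0 mul0mx.
rewrite mulmxA -kmxM addr0 -[X in kmx X]mulmxA -[X in kmx X]mulmxA.
rewrite [X in kmx (_ *m X)]mulmxA totw_pow_vproj eqxx -kmx_comm -/(skmx _ _) !skmxM !mulmxA.
suff -> : y (-1 - a%:Z) * peps (i + inZp k) * y k%:Z * peps i * y (- (k - a - 1)%N%:Z)
  = peps (i + inZp (k - a - 1)) by [].
rewrite -[_ * peps _ * y k]mulrA -ypow_peps mulrA pmonD -[_ * peps i * peps i]mulrA peps_mul eqxx.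
by have -> : -1 - a%:Z + k%:Z = (k - a - 1)%N by [have := ltn_ord a; lia]; exact: ypow_conj.
Qed.

(** The sum has no power of y below y^-j, and F carries y^k with j <= k. *)
Lemma mxnneg_flow (j : nat) : (j <= k)%N ->
  mxnneg (F *m (1%:M - W *m (\sum_(a < j) ycoef a) *m xresolvent hmu tau kappa p *m V)).
Proof.
move=> jk; rewrite mulmxBr mulmx1; apply: mxnnegD; first by apply: mxnneg_skmx; exact: pnneg_mon.
apply: mxnnegN; rewrite mulmxA; apply: mxnnegM; last exact: mxnneg_vtot.
rewrite mulmxA; apply: mxnnegM; last exact: mxnneg_xres.
rewrite mulmxA [_ *m (\sum_(a < j) _)]mulmx_sumr; apply: mxnneg_sum => a _; rewrite wtotE mulmx_sumr mulmx_suml.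
apply: mxnneg_sum => i _; rewrite !skmxM; apply: mxnneg_skmx; apply: pnneg_peps1.
by have := ltn_ord a; lia.
Qed.

(** The exponents are (-1 - a) + k + (-1 - e) with e < k - a - 1, so the smallest one is 0. *)
Lemma mxnneg_flow_term a : (a < k)%N ->
  mxnneg (W *m xresolvent hmu tau kappa p *m ycoef a *m V *m F *m
    (1%:M - W *m (\sum_(e < k - a - 1) ycoef e) *m xresolvent hmu tau kappa p *m V)).
Proof.
move=> ak; rewrite -4!mulmxA; apply: mxnnegM; first exact: mxnneg_wtot.
apply: mxnnegM; first exact: mxnneg_xres.
rewrite 2!mulmxA mulmxBr mulmx1; apply: mxnnegD.
  rewrite vtotE mulmx_sumr mulmx_suml; apply: mxnneg_sum => l _; rewrite !skmxM.
  by apply: mxnneg_skmx; apply: pnneg_peps1; lia.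
apply: mxnnegN; rewrite mulmxA; apply: mxnnegM; last exact: mxnneg_vtot.
rewrite mulmxA; apply: mxnnegM; last exact: mxnneg_xres.
rewrite mulmxA [_ *m (\sum_(e < _) _)]mulmx_sumr; apply: mxnneg_sum => e _; rewrite wtotE mulmx_sumr mulmx_suml.
apply: mxnneg_sum => i _; rewrite vtotE mulmx_sumr !mulmx_suml; apply: mxnneg_sum => l _.
rewrite !skmxM; apply: mxnneg_skmx; apply: pnneg_peps2.
by have := ltn_ord e; lia.
Qed.
End WaveFlowTerms.

(** * The wave operator of a moving point *)

Section FlowOfWave.
Variables (K : numClosedFieldType) (n d : nat) (mu : K) (hmu : n.+1.-primitive_root mu).
Variables (tau : K) (kappa : 'I_n.+1 -> K) (al : 'I_n.+1 -> nat).
Local Notation ratfun := {fraction {poly K}}.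
Local Notation S := (cdata hmu tau kappa).
Local Notation P := (psdo S).
Local Notation N := (\sum_i al i)%N.
Local Notation prat := (prat hmu tau kappa).
Local Notation peps := (peps hmu tau kappa).
Local Notation kmx := (kmx hmu tau kappa).
Local Notation yres := (yresolvent hmu tau kappa).
Local Notation xres := (xresolvent hmu tau kappa).
Local Notation vtot := (vtot hmu tau kappa).
Local Notation wtot := (wtot hmu tau kappa).
Local Notation waveM := (waveM hmu tau kappa).
Local Notation waveMi := (waveMi hmu tau kappa).
Local Notation laxL := (laxL hmu tau kappa).
Local Notation laxR := (laxR hmu tau kappa).

Definition fracdiff (F : K -> ratfun) (t0 : K) := exists dF, is_fracderive F t0 dF.

Lemma fracdiffM (t0 : K) (F G : K -> ratfun) : fracdiff F t0 -> fracdiff G t0 ->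
  fracdiff (fun t => F t * G t) t0.
Proof. by move=> [dF hF] [dG hG]; eexists; exact: is_fracderiveM hF hG. Qed.
Lemma fracdiff_sum (t0 : K) (I : finType) (Q : pred I) (F : I -> K -> ratfun) :
  (forall i, fracdiff (F i) t0) -> fracdiff (fun t => \sum_(i | Q i) F i t) t0.
Proof.
move=> h; have [dF hF] := choice h; eexists; apply: is_fracderive_sum => i _; exact: hF.
Qed.
Lemma fracdiff_cst (t0 : K) (f : ratfun) : fracdiff (fun=> f) t0.
Proof. by eexists; exact: is_fracderive_cst. Qed.
Lemma fracdiff_prod (t0 : K) (I : Type) (s : seq I) (Q : pred I) (F : I -> K -> ratfun) :
  (forall i, fracdiff (F i) t0) -> fracdiff (fun t => \prod_(i <- s | Q i) F i t) t0.
Proof.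
move=> h; elim: s => [|i s IH].
  by under eq_fun do rewrite big_nil; exact: fracdiff_cst.
under eq_fun do rewrite big_cons; case: (Q i) => //; exact: fracdiffM.
Qed.
Lemma fracdiff_det r (t0 : K) (F : K -> 'M[ratfun]_r) :
  (forall i j, fracdiff (fun t => F t i j) t0) -> fracdiff (fun t => \det (F t)) t0.
Proof.
move=> h; apply: fracdiff_sum => s; apply: fracdiffM; first exact: fracdiff_cst.
exact: fracdiff_prod.
Qed.
(** By Cramer's rule, the entries of the inverse are rational expressions in those of the matrix. *)
Lemma fracdiff_invmx r (t0 : K) (F : K -> 'M[ratfun]_r) : (forall t, \det (F t) != 0) ->
  (forall i j, fracdiff (fun t => F t i j) t0) ->
  forall i j, fracdiff (fun t => invmx (F t) i j) t0.
Proof.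
move=> d0 h i j.
have -> : (fun t => invmx (F t) i j) = fun t => (\det (F t))^-1 * cofactor (F t) j i.
  by apply/funext => t; rewrite /invmx unitmxE unitfE d0 !mxE.
apply: fracdiffM; first by have [dF hF] := fracdiff_det h; exact: is_fracderiveV hF.
apply: fracdiffM; first exact: fracdiff_cst.
by apply: fracdiff_det => a b; under eq_fun do rewrite !mxE.
Qed.

Lemma is_psderive_pmon0 (t0 : K) (F : K -> crossed hmu) dF : is_crderive F t0 dF ->
  is_psderive (fun t => pmon S 0 (F t)) t0 (pmon S 0 dF).
Proof.
move=> hF; split=> [|z]; first by exists 0 => t; exact: pmon_bounded.
by rewrite /=; case: eqP => // _; exact: is_crderive_cst.
Qed.
Lemma is_crderive_cemb (t0 : K) (F : K -> ratfun) dF : is_fracderive F t0 dF ->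
  is_crderive (fun t => cemb hmu (F t)) t0 (cemb hmu dF).
Proof.
move=> hF r; rewrite ffunE; under eq_fun do rewrite ffunE.
by case: eqP => // _; exact: is_fracderive_cst.
Qed.
Lemma is_psmxderive_kmx r c (t0 : K) (F : K -> 'M[K]_(r, c)) dF : is_mxderive F t0 dF ->
  is_psmxderive (fun t => kmx (F t)) t0 (kmx dF).
Proof.
move=> hF a b; rewrite mxE; under eq_fun do rewrite mxE.
by apply: is_psderive_pmon0; apply: is_crderive_cemb; exact: is_fracderive_ratc.
Qed.

Lemma is_psmxderive_yres r (t0 : K) (Y : K -> 'M[K]_r) : is_mxderive Y t0 0 ->
  is_psmxderive (fun t => yres (Y t)) t0 0.
Proof.
move=> hY a b; split=> [|z]; first by exists (-1) => t; exact: mxbounded_yres.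
have -> : (0 : 'M[P]_r) a b z = 0 by rewrite mxE /= if_same.
under eq_fun do rewrite yresolventE; case: z => j; first exact: is_crderive_cst.
rewrite -oppr0; apply: is_crderiveN; rewrite -[X in is_crderive _ _ X](rmorph0 (cemb hmu)).
apply: is_crderive_cemb; rewrite -[X in is_fracderive _ _ X](rmorph0 (@ratc K)).
apply: is_fracderive_ratc; have := is_mxderiveX j hY a b.
by rewrite big1 ?mxE // => e _; rewrite mulmx0 mul0mx.
Qed.

Variables (k : nat) (b : 'I_d) (p : K -> quiver_rep K d al) (t0 : K).
Hypothesis flow : rep_flow k b p t0.
Local Notation X := (totX (p t0)).
Local Notation Y := (totY (p t0)).
Local Notation V := (vtot (p t0)).
Local Notation W := (wtot (p t0)).
Local Notation v := (totv (p t0)).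
Local Notation w := (totw (p t0)).
Local Notation E := (delta_mx b b : 'M[K]_d).
Let dX := - \sum_l \sum_(a < k) Y ^+ a *m v l *m E *m w (l - inZp k) *m Y ^+ (k - a - 1).

Lemma is_psmxderive_xres :
  is_psmxderive (fun t => xres (p t)) t0 (- (xres (p t0) *m kmx dX *m xres (p t0))).
Proof.
have [hX _ _ _] := flow.
apply: (@is_psmxderiveV _ _ _ _ _ _ _ _ (fun t => kmx (totX (p t)) - (prat (ratx K))%:M)).
- by move=> t; exact: xresolventK.
- by move=> t; exact: xresolventVK.
- apply: (is_psmxderive_eq (is_psmxderiveD (is_psmxderive_kmx hX) (is_psmxderive_cst _ _))).
  by rewrite addr0.
have h a c : fracdiff (fun t => resolventX (p t) a c) t0.
  apply: fracdiff_invmx => [t|i j]; first exact: det_resolvent.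
  under eq_fun do rewrite mxE [map_mx _ _ _ _]mxE; eexists; apply: is_fracderiveD; last exact: is_fracderive_cst.
  exact: is_fracderive_ratc (hX i j).
have [dF hF] := choice (fun ac : 'I_N * 'I_N => h ac.1 ac.2).
exists (\matrix_(a, c) prat (dF (a, c))) => a c; rewrite mxE; under eq_fun do rewrite mxE.
by apply: is_psderive_pmon0; apply: is_crderive_cemb; exact: (hF (a, c)).
Qed.

Local Notation y a := (pmon S a%R 1 : P).
Local Notation F := (skmx (y k%:Z) E).
Local Notation T j := (skmx (y (- j%:Z)) (Y ^+ j)).

Lemma is_psmxderive_wtot : is_psmxderive (fun t => wtot (p t)) t0 (F *m W *m T k).
Proof.
rewrite -wtot_flow; have [_ _ hw _] := flow; apply: is_psmxderive_sum => i _.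
by apply: is_psmxderiveMl; apply: is_psmxderive_kmx; exact: hw.
Qed.
Lemma is_psmxderive_vtot : is_psmxderive (fun t => vtot (p t)) t0 (- (T k *m V *m F)).
Proof.
rewrite -vtot_flow; have [_ _ _ hv] := flow.
rewrite (_ : (fun t => _) = fun t => \sum_i skmx (peps i) (totv (p t) i)); last first.
  by apply/funext => t; rewrite vtotE.
apply: is_psmxderive_sum => i _.
by apply: is_psmxderiveMl; apply: is_psmxderive_kmx; exact: hv.
Qed.

Definition dwave : 'M[P]_d :=
  - (F *m W *m T k *m (xres (p t0) *m yres Y) *m V
     - W *m (xres (p t0) *m kmx dX *m xres (p t0) *m yres Y) *m V
     - W *m (xres (p t0) *m yres Y) *m (T k *m V *m F)).

Lemma is_psmxderive_wave : is_psmxderive (fun t => waveM (p t)) t0 dwave.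
Proof.
have [_ hY _ _] := flow.
rewrite (_ : (fun t => _) = fun t => 1%:M - wtot (p t) *m (xres (p t) *m yres (totY (p t))) *m vtot (p t)); last first.
  by apply/funext => t; rewrite waveME.
have hAB := is_psmxderiveM is_psmxderive_xres (is_psmxderive_yres hY).
have h := is_psmxderiveM (is_psmxderiveM is_psmxderive_wtot hAB) is_psmxderive_vtot.
have h1 := is_psmxderiveD (is_psmxderive_cst t0 1%:M) (is_psmxderiveMl (- 1%:M) h).
have -> : (fun t => 1%:M - wtot (p t) *m (xres (p t) *m yres (totY (p t))) *m vtot (p t))
    = fun t => 1%:M + - 1%:M *m (wtot (p t) *m (xres (p t) *m yres (totY (p t))) *m vtot (p t)).
  by apply/funext => t; rewrite mulNmx mul1mx.
apply: (is_psmxderive_eq h1); rewrite add0r mulNmx mul1mx /dwave; congr (- _).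
rewrite mulmx0 addr0 mulmxDl; congr (_ + _ + _); last by rewrite mulmxN.
by rewrite [(- _) *m yres _]mulNmx [W *m (- _)]mulmxN mulNmx.
Qed.
End FlowOfWave.

(** * The Lax equations along a flow *)

Section LaxFlow.
Variables (K : numClosedFieldType) (n d : nat) (mu : K) (hmu : n.+1.-primitive_root mu).
Variables (tau : K) (kappa : 'I_n.+1 -> K) (al : 'I_n.+1 -> nat).
Local Notation S := (cdata hmu tau kappa).
Local Notation P := (psdo S).
Local Notation N := (\sum_i al i)%N.
Local Notation kmx := (kmx hmu tau kappa).
Local Notation waveM := (waveM hmu tau kappa).
Local Notation waveMi := (waveMi hmu tau kappa).
Local Notation laxL := (laxL hmu tau kappa).
Local Notation laxR := (laxR hmu tau kappa).
Local Notation y a := (pmon S a%R 1 : P).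

Section Curve.
Variables (k : nat) (b : 'I_d) (p : K -> quiver_rep K d al) (t0 : K).
Hypothesis momp : forall t, moment_eq (lambda tau kappa) (p t).
Hypothesis flow : rep_flow k b p t0.
Local Notation F := (skmx (y k%:Z) (delta_mx b b)).
Local Notation M := (waveM (p t0)).
Local Notation Mi := (waveMi (p t0)).
Local Notation dM := (dwave hmu tau kappa k b p t0).
Local Notation B := (dM *m Mi + M *m F *m Mi).

Lemma flow_nneg : mxnneg B.
Proof.
have mom := momp t0.
have yE : 1%:M + (kmx (totY (p t0)) - (y 1)%:M) *m (\sum_(a < k) ycoef hmu tau kappa (p t0) a)
  = skmx (y (- k%:Z)) (totY (p t0) ^+ k) by exact: ycoef_sum.
have := @wave_flow P N d (kmx (totX (p t0)) - (prat hmu tau kappa (ratx K))%:M)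
  (xresolvent hmu tau kappa (p t0)) (kmx (totY (p t0)) - (y 1)%:M)
  (yresolvent hmu tau kappa (totY (p t0))) (epsproj hmu tau kappa al 0)
  (vtot hmu tau kappa (p t0)) (wtot hmu tau kappa (p t0)) F (ycoef hmu tau kappa (p t0)) k _
  (xresolventK _ _ _ _) (xresolventVK _ _ _ _) (yresolventK _ _ _ _) (yresolventVK _ _ _ _).
move=> /(_ (kmx (- \sum_l \sum_(a < k) totY (p t0) ^+ a *m totv (p t0) l *m delta_mx b b
  *m totw (p t0) (l - inZp k) *m totY (p t0) ^+ (k - a - 1)))) h.
have {h} := h (vtot_wtot_mul mom (epsproj_comm_yx _ _ _ _)) (ycoef_comm _ _ _ _).
have PiAB : epsproj hmu tau kappa al 0
    *m (xresolvent hmu tau kappa (p t0) *m yresolvent hmu tau kappa (totY (p t0)) *m vtot hmu tau kappa (p t0))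
  = xresolvent hmu tau kappa (p t0) *m yresolvent hmu tau kappa (totY (p t0)) *m vtot hmu tau kappa (p t0).
  by rewrite mulmxA epsproj_comm_xy -mulmxA epsproj_vtot.
have e : kmx (- \sum_l \sum_(a < k) totY (p t0) ^+ a *m totv (p t0) l *m delta_mx b b
      *m totw (p t0) (l - inZp k) *m totY (p t0) ^+ (k - a - 1)) *m epsproj hmu tau kappa al 0
    = - \sum_(a < k) ycoef hmu tau kappa (p t0) a *m vtot hmu tau kappa (p t0) *m F
      *m wtot hmu tau kappa (p t0) *m (1%:M + (kmx (totY (p t0)) - (y 1)%:M)
      *m (\sum_(e < k - a - 1) ycoef hmu tau kappa (p t0) e)).
  by rewrite totX_flow; congr (- _); apply: eq_bigr => a _; rewrite ycoef_sum.
move=> /(_ PiAB e) /=; rewrite yE -waveME -/(dwave _ _ _ _ _ _ _) => ->.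
apply: (mxnnegD (S := S)); first exact: (mxnneg_flow hmu tau kappa (p t0) (delta_mx b b) (leqnn k)).
by apply: (mxnneg_sum (S := S)) => a _; exact: mxnneg_flow_term.
Qed.

Lemma dwave_bounded : mxbounded (-1) dM.
Proof.
have h := is_psmxderiveD (is_psmxderive_wave hmu tau kappa flow) (is_psmxderive_cst t0 (- 1%:M)).
rewrite addr0 in h => a c; apply: is_psderive_bounded (h a c) => t; exact: waveM_bounded.
Qed.

Lemma wave_conj_flow_nneg : map_mx (@pplus _ S) (M *m F *m Mi) = B.
Proof.
rewrite -[X in map_mx _ X](addKr (dM *m Mi)) addrC.
apply: mxplus_nneg_add; first exact: flow_nneg.
apply: mxboundedN; apply: (@mxbounded_le _ _ _ _ (-1 + 0)) => //.
apply: mxboundedM; first exact: dwave_bounded.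
have -> : Mi = 1%:M + (Mi - 1%:M) by rewrite addrC subrK.
apply: mxboundedD; first by apply: mxbounded_scalar; exact: pmon_bounded.
exact: mxbounded_le (waveMi_bounded _ _ _ _).
Qed.

(** Used with C = y for L and with C = E_g for R_g. The part M' M^-1 of B comes from differentiating
    the conjugation; the part M F M^-1 drops out of the commutator because C commutes with F. *)
Lemma is_psmxderive_conj (C : 'M[P]_d) : C *m F = F *m C ->
  is_psmxderive (fun t => waveM (p t) *m C *m waveMi (p t)) t0 (lie B (M *m C *m Mi)).
Proof.
move=> CF; have hM := is_psmxderive_wave hmu tau kappa flow; have [_ hY _ _] := flow.
have hMi : is_psmxderive (fun t => waveMi (p t)) t0 (- (Mi *m dM *m Mi)).
  apply: is_psmxderiveV hM _ => [t|t|]; [exact: waveM_Mi | exact: waveMi_M |].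
  have hBA := is_psmxderiveM (is_psmxderive_yres hmu tau kappa hY) (is_psmxderive_xres hmu tau kappa flow).
  have hW := is_psmxderive_wtot hmu tau kappa flow; have hV := is_psmxderive_vtot hmu tau kappa flow.
  eexists; exact: (is_psmxderiveD (is_psmxderive_cst _ _) (is_psmxderiveM (is_psmxderiveM hW hBA) hV)).
apply: (is_psmxderive_eq (is_psmxderiveM (is_psmxderiveMr C hM) hMi)).
have MMi := waveM_Mi hmu (momp t0); have MiM := waveMi_M hmu (momp t0).
rewrite /lie mulmxDl mulmxDr opprD addrACA.
have -> : M *m F *m Mi *m (M *m C *m Mi) - M *m C *m Mi *m (M *m F *m Mi) = 0.
  by rewrite !(wave_conjM (momp t0)) CF subrr.
rewrite addr0 mulmxN; congr (_ - _); last by rewrite !mulmxA.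
by rewrite !mulmxA -[_ *m Mi *m M]mulmxA MiM mulmx1.
Qed.

Lemma lax_power : laxL (p t0) ^+ k *m laxR (p t0) b = M *m F *m Mi.
Proof.
have LX j : laxL (p t0) ^+ j = M *m (y j%:Z)%:M *m Mi.
  elim: j => [|j IH]; first by rewrite expr0 mulmx1 (waveM_Mi hmu (momp t0)).
  rewrite exprSr IH (laxLE hmu (momp t0)) -mulmxE (wave_conjM (momp t0)) scalarM pmonD.
  by rewrite -PoszD addn1.
rewrite LX (laxRE hmu (momp t0)) (wave_conjM (momp t0)) /skmx.
by rewrite /kmx map_delta_mx.
Qed.

Lemma lax_flow :
  let Bp := mxplus (laxL (p t0) ^+ k *m laxR (p t0) b) in
  is_psdoderive (fun t => laxL (p t)) t0 (lie Bp (laxL (p t0))) /\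
  forall g, is_psdoderive (fun t => laxR (p t) g) t0 (lie Bp (laxR (p t0) g)).
Proof.
move=> Bp; have -> : Bp = B by rewrite /Bp lax_power -wave_conj_flow_nneg.
split=> [|g]; apply: is_psmxderive_psdoderive.
  rewrite (laxLE hmu (momp t0)) (_ : (fun t => _) = fun t => waveM (p t) *m (y 1)%:M *m waveMi (p t)).
    apply: is_psmxderive_conj.
    by rewrite mulmxA scalarM -[RHS]mulmxA -kmx_comm mulmxA scalarM !pmonD addrC.
  by apply/funext => t; rewrite (laxLE hmu (momp t)).
rewrite (laxRE hmu (momp t0)) (_ : (fun t => _) = fun t => waveM (p t) *m delta_mx g g *m waveMi (p t)).
  apply: is_psmxderive_conj.
  have -> : delta_mx g g = kmx (delta_mx g g) by rewrite /kmx map_delta_mx.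
  rewrite /skmx mulmxA -kmx_comm -!mulmxA -!kmxM; congr (_ *m kmx _).
  by have [->|gb] := eqVneq g b; rewrite // !mul_delta_mx_0 // eq_sym.
by apply/funext => t; rewrite (laxRE hmu (momp t)).
Qed.
End Curve.

Lemma cm_flow_hier (k : nat) (b : 'I_d) (c : K -> cm_space d al (lambda tau kappa)) (t0 : K) :
  cm_flow k b c t0 -> hier_flow k b (fun t => cm_space_lax hmu (c t)) t0.
Proof.
case=> p cp flow.
have momp t : moment_eq (lambda tau kappa) (val (p t)) by exact/asboolP/(valP (p t)).
have [hL hR] := lax_flow momp flow.
rewrite /hier_flow (nbhs_singleton cp) cm_lax_class; split=> [|g].
  apply: is_psdoderive_near hL; near=> t.
  have -> : c t = cm_class (p t) by near: t.
  by rewrite cm_lax_class.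
apply: is_psdoderive_near (hR g); near=> t.
have -> : c t = cm_class (p t) by near: t.
by rewrite cm_lax_class.
Unshelve. all: by end_near. Qed.
End LaxFlow.

(** * Hamilton's equations *)

Lemma mulmx_swap (R : pzSemiRingType) r s t u (A C : 'M[R]_r) (B : 'M[R]_r)
    (D : 'M[R]_(r, s)) (E : 'M[R]_(s, t)) (G : 'M[R]_(t, u)) : A *m B = B *m C ->
  A *m (B *m D *m E *m G) = B *m (C *m D) *m E *m G.
Proof. by move=> e; rewrite !mulmxA e. Qed.

Lemma shift_eq (V : zmodType) (i a e s l : V) : (i + e + a == l) = (l - (a + e + s) + s == i).
Proof. by rewrite opprD addrA subrK subr_eq eq_sym addrA addrAC. Qed.

Section RepOfTotals.
Variables (K : fieldType) (n d : nat) (al : 'I_n.+1 -> nat).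
Local Notation N := (\sum_i al i)%N.
Local Notation vpr := (vproj K al).
Implicit Types (i l : 'I_n.+1) (p q : quiver_rep K d al).

(** Cuts the blocks of a representation out of operators on V; for operators of the right degree
    nothing is lost. *)
Definition rep_of (X Y : 'M[K]_N) (v : 'I_n.+1 -> 'M[K]_(N, d)) (w : 'I_n.+1 -> 'M[K]_(d, N)) :
    quiver_rep K d al :=
  QuiverRep (fun i => vprj K al (i + inZp 1) *m X *m vinj K al i)
            (fun i => vprj K al i *m Y *m vinj K al (i + inZp 1))
            (fun i => vprj K al i *m v i) (fun i => w i *m vinj K al i).

Lemma totX_of X Y v w : (forall i, vpr (i + inZp 1) *m X = X *m vpr i) ->
  totX (rep_of X Y v w) = X.
Proof.
move=> gX; rewrite totXE -[RHS]mulmx1 -(sum_vproj K al) mulmx_sumr; apply: eq_bigr => i _ /=.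
transitivity (vpr (i + inZp 1) *m X *m vpr i); first by rewrite !mulmxA.
by rewrite gX -mulmxA vproj_mul eqxx.
Qed.
Lemma totY_of X Y v w : (forall i, Y *m vpr (i + inZp 1) = vpr i *m Y) ->
  totY (rep_of X Y v w) = Y.
Proof.
move=> gY; rewrite totYE -[RHS]mul1mx -(sum_vproj K al) mulmx_suml; apply: eq_bigr => i _ /=.
transitivity (vpr i *m Y *m vpr (i + inZp 1)); first by rewrite !mulmxA.
by rewrite -mulmxA gY mulmxA vproj_mul eqxx.
Qed.
Lemma totv_of X Y v w i : vpr i *m v i = v i -> totv (rep_of X Y v w) i = v i.
Proof. by move=> gv; rewrite totvE /= mulmxA. Qed.
Lemma totw_of X Y v w i : w i *m vpr i = w i -> totw (rep_of X Y v w) i = w i.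
Proof. by move=> gw; rewrite totwE /= -mulmxA. Qed.

Lemma vinjK m i (C D : 'M[K]_(al i, m)) : vinj K al i *m C = vinj K al i *m D -> C = D.
Proof. by move=> e; rewrite -[C]mul1mx -(vprjK K al i) -mulmxA e mulmxA vprjK mul1mx. Qed.
Lemma vprjI m i (C D : 'M[K]_(m, al i)) : C *m vprj K al i = D *m vprj K al i -> C = D.
Proof. by move=> e; rewrite -[C]mulmx1 -(vprjK K al i) mulmxA e -mulmxA vprjK mulmx1. Qed.

Lemma repX_tot p i : repX p i = vprj K al (i + inZp 1) *m totX p *m vinj K al i.
Proof.
rewrite totXE mulmx_sumr mulmx_suml [RHS](@sum_only1 _ _ i).
  by rewrite !mulmxA vprjK mul1mx -mulmxA vprjK mulmx1.
by move=> j ji; rewrite -!mulmxA vprj_inj0 // !mulmx0.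
Qed.
Lemma repY_tot p i : repY p i = vprj K al i *m totY p *m vinj K al (i + inZp 1).
Proof.
rewrite totYE mulmx_sumr mulmx_suml [RHS](@sum_only1 _ _ i).
  by rewrite !mulmxA vprjK mul1mx -mulmxA vprjK mulmx1.
by move=> j ji; rewrite !mulmxA vprj_inj0 1?eq_sym // !mul0mx.
Qed.

Lemma tot_inj p q : totX p = totX q -> totY p = totY q ->
  (forall i, totv p i = totv q i) -> (forall i, totw p i = totw q i) -> p = q.
Proof.
move=> eX eY ev ew; case: p q eX eY ev ew => [X Y v w] [X' Y' v' w'] eX eY ev ew.
congr QuiverRep; apply: functional_extensionality_dep => i.
- by have := repX_tot (QuiverRep X Y v w) i; rewrite eX -repX_tot.
- by have := repY_tot (QuiverRep X Y v w) i; rewrite eY -repY_tot.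
- by apply: vinjK; have := ev i; rewrite !totvE.
- by apply: vprjI; have := ew i; rewrite !totwE.
Qed.

Lemma inZpD a e : inZp (a + e) = inZp a + inZp e :> 'I_n.+1.
Proof. by apply: val_inj; rewrite /= modnDm. Qed.

Section FlowGrading.
Variables (p : quiver_rep K d al) (k : nat) (E : 'M[K]_d).
Local Notation Y := (totY p).
Local Notation v := (totv p).
Local Notation w := (totw p).

Definition flowX : 'M[K]_N :=
  - \sum_l \sum_(a < k) Y ^+ a *m v l *m E *m w (l - inZp k) *m Y ^+ (k - a - 1).
Definition flowv i := - (Y ^+ k *m v (i + inZp k) *m E).
Definition floww i := E *m w (i - inZp k) *m Y ^+ k.

(** This degree condition, with its analogues for v and w, says that the displayed right-hand sides
    are tangent vectors to the space of representations: they are the totals of [flowrep]. *)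
Lemma flowX_graded i : vpr (i + inZp 1) *m flowX = flowX *m vpr i.
Proof.
rewrite /flowX mulmxN mulNmx mulmx_sumr mulmx_suml; congr (- _); apply: eq_bigr => l _.
rewrite mulmx_sumr mulmx_suml; apply: eq_bigr => a _.
have H (u : 'M[K]_(d, N)) : vpr (i + inZp 1) *m (Y ^+ a *m v l *m E *m u)
    = Y ^+ a *m (vpr (i + inZp 1 + inZp a) *m v l) *m E *m u.
  exact: mulmx_swap (totY_pow_vproj _ _ _).
rewrite -[_ *m w _ *m _]mulmxA H totv_vproj -[RHS]mulmxA totw_pow_vproj.
have -> : (i + inZp 1 + inZp a == l) = (l - inZp k + inZp (k - a - 1) == i).
  have -> : inZp k = inZp a + inZp 1 + inZp (k - a - 1) :> 'I_n.+1.
    by rewrite -!inZpD; congr inZp; have := ltn_ord a; lia.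
  exact: shift_eq.
by case: eqP => _; rewrite // !mulmx0 !mul0mx.
Qed.
Lemma flowv_graded i : vpr i *m flowv i = flowv i.
Proof.
by rewrite /flowv mulmxN mulmxA (mulmxA (vpr i)) totY_pow_vproj -[_ *m vpr _ *m v _]mulmxA totv_vproj eqxx.
Qed.
Lemma floww_graded i : floww i *m vpr i = floww i.
Proof. by rewrite /floww -!mulmxA [w _ *m _]mulmxA totw_pow_vproj subrK eqxx. Qed.

Definition flowrep := rep_of flowX 0 flowv floww.
Lemma flowrepE : [/\ totX flowrep = flowX, totY flowrep = 0,
  forall i, totv flowrep i = flowv i & forall i, totw flowrep i = floww i].
Proof.
split=> [||i|i]; first exact/totX_of/flowX_graded.
- by apply: totY_of => i; rewrite mul0mx mulmx0.
- exact/totv_of/flowv_graded.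
- exact/totw_of/floww_graded.
Qed.
End FlowGrading.

Lemma omegaE p q : omega p q = (\tr (totY p *m totX q) - \tr (totY q *m totX p))
  + (\sum_i \tr (totw p i *m totv q i) - \sum_i \tr (totw q i *m totv p i)).
Proof.
have YX r s : \tr (totY r *m totX s) = \sum_i \tr (repY r i *m repX s i).
  rewrite totYE totXE mulmx_suml raddf_sum; apply: eq_bigr => i _ /=.
  rewrite mulmx_sumr raddf_sum /= [LHS](@sum_only1 _ _ i).
    rewrite !mulmxA -[_ *m vprj _ _ _ *m vinj _ _ _]mulmxA vprjK mulmx1 mxtrace_mulC.
    by rewrite !mulmxA vprjK mul1mx.
  move=> j ji; rewrite !mulmxA -[_ *m vprj _ _ _ *m vinj _ _ _]mulmxA vprj_inj0.
    by rewrite mulmx0 !mul0mx mxtrace0.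
  by rewrite (inj_eq (addIr _)) eq_sym.
have wv r s i : totw r i *m totv s i = repw r i *m repv s i.
  by rewrite totwE totvE mulmxA -[_ *m vprj _ _ _ *m _]mulmxA vprjK mulmx1.
rewrite !YX -!sumrB -big_split /=; apply: eq_bigr => i _.
by rewrite !wv.
Qed.
End RepOfTotals.

Section HamiltonEquations.
Variables (K : numClosedFieldType) (n d : nat) (al : 'I_n.+1 -> nat).
Local Notation N := (\sum_i al i)%N.
Implicit Types (i l : 'I_n.+1) (p q xi : quiver_rep K d al).

Lemma totY_shift p s xi : totY (rep_shift p s xi) = totY p + s *: totY xi.
Proof.
rewrite !totYE scaler_sumr -big_split /=; apply: eq_bigr => i _.
by rewrite mulmxDr mulmxDl -scalemxAr -scalemxAl.
Qed.
Lemma totv_shift p s xi i : totv (rep_shift p s xi) i = totv p i + s *: totv xi i.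
Proof. by rewrite !totvE mulmxDr -scalemxAr. Qed.
Lemma totw_shift p s xi i : totw (rep_shift p s xi) i = totw p i + s *: totw xi i.
Proof. by rewrite !totwE mulmxDl -scalemxAl. Qed.

Lemma is_mxderive_line r c (C D : 'M[K]_(r, c)) (t0 : K) :
  is_mxderive (fun s : K => C + s *: D) t0 D.
Proof.
move=> a b; have -> : (fun s : K => (C + s *: D) a b) = fun s => C a b + s * D a b.
  by apply/funext => s; rewrite !mxE.
have h := is_derive_mulf (is_derive_id t0 1) (is_derive_cstf t0 (D a b)).
apply: (is_derive_eq (is_derive_addf (is_derive_cstf t0 (C a b)) h)).
by rewrite mulr0 addr0 mul1r add0r.
Qed.

(** The gradient of H_(k, b) has one part for each of w, Y and v. Cyclicity of the trace, and a
    shift of the vertex by k in the parts for Y and w, bring them into the form of omega. *)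
Lemma is_derive_ham k (b : 'I_d) p xi :
  is_derive (0 : K) 1 (fun s : K => ham k b (rep_shift p s xi))
    (- omega (flowrep p k (delta_mx b b)) xi).
Proof.
set E : 'M[K]_d := delta_mx b b.
have [eX eY ev ew] := flowrepE p k E.
have h i : is_derive (0 : K) 1 (fun s : K => \tr (E *m totw (rep_shift p s xi) i
    *m totY (rep_shift p s xi) ^+ k *m totv (rep_shift p s xi) (i + inZp k)))
   (\tr (E *m totw xi i *m totY p ^+ k *m totv p (i + inZp k)
     + E *m totw p i *m (\sum_(a < k) totY p ^+ a *m totY xi *m totY p ^+ (k - a - 1)) *m totv p (i + inZp k)
     + E *m totw p i *m totY p ^+ k *m totv xi (i + inZp k))).
  have hw := is_mxderive_line (totw p i) (totw xi i) 0.
  have hY := is_mxderiveX k (is_mxderive_line (totY p) (totY xi) 0).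
  have hv := is_mxderive_line (totv p (i + inZp k)) (totv xi (i + inZp k)) 0.
  have := is_mxderiveM (is_mxderiveM (is_mxderiveM (is_mxderive_cst 0 E) hw) hY) hv.
  rewrite mul0mx add0r !scale0r !addr0 => /is_derive_mxtrace h.
  under eq_fun do rewrite totw_shift totY_shift totv_shift.
  by apply: (is_derive_eq h); rewrite mulmxDl.
have H := is_derive_oppf (@is_derive_sumf K 0 _ (index_enum 'I_n.+1) xpredT _ _ (fun i _ => h i)).
apply: (is_derive_eq H).
rewrite omegaE eX eY mul0mx mxtrace0 sub0r.
have sp (C1 C2 C3 : 'I_n.+1 -> 'M[K]_d) : \sum_i \tr (C1 i + C2 i + C3 i)
    = \sum_i \tr (C2 i) + (\sum_i \tr (C3 i) + \sum_i \tr (C1 i)).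
  rewrite -!big_split /=; apply: eq_bigr => i _; rewrite !mxtraceD; ring.
congr (- _); rewrite [LHS]sp; congr (_ + _).
  rewrite /flowX mulmxN [\tr (- _)]raddfN opprK /= mulmx_sumr [RHS]raddf_sum /= [RHS](@sum_shift _ (inZp k)).
  apply: eq_bigr => i _; rewrite [in LHS]mulmx_sumr mulmx_suml raddf_sum /=.
  (* Cyclicity exchanges the powers of Y on the two sides of the variation of Y, so that a
     corresponds to k - 1 - a. *)
  rewrite [in RHS]mulmx_sumr raddf_sum /= (reindex_inj rev_ord_inj) /=.
  apply: eq_bigr => a _; rewrite addrK.
  have -> : (k - (k - a.+1) - 1 = a)%N by have := ltn_ord a; lia.
  have -> : (k - a.+1 = k - a - 1)%N by lia.
  transitivity (\tr ((E *m totw p i *m totY p ^+ (k - a - 1))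
    *m (totY xi *m totY p ^+ a *m totv p (i + inZp k)))); first by rewrite !mulmxA.
  by rewrite mxtrace_mulC !mulmxA.
congr (_ + _).
  rewrite [RHS](@sum_shift _ (inZp k)); apply: eq_bigr => i _.
  by rewrite ew /floww addrK.
rewrite -sumrN; apply: eq_bigr => i _.
by rewrite ev /flowv mulmxN raddfN opprK /= -!mulmxA mxtrace_mulC -!mulmxA.
Qed.

Lemma omegaDl p q xi (s : K) : omega (rep_shift p s q) xi = omega p xi + s * omega q xi.
Proof.
rewrite /omega mulr_sumr -big_split /=; apply: eq_bigr => i _.
rewrite !mulmxDl !mulmxDr -!scalemxAl -!scalemxAr !mxtraceD !mxtraceZ; ring.
Qed.

(** The trace is the squared Frobenius norm, the sum of the squared moduli of the entries. *)
Lemma mxtrace_adj_eq0 r c (C : 'M[K]_(r, c)) :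
  0 <= \tr (C *m (map_mx Num.conj C)^T) /\ (\tr (C *m (map_mx Num.conj C)^T) = 0 -> C = 0).
Proof.
have E : \tr (C *m (map_mx Num.conj C)^T) = \sum_i \sum_j `|C i j| ^+ 2.
  by apply: eq_bigr => i _; rewrite mxE; apply: eq_bigr => j _; rewrite !mxE normCK.
have P0 (i : 'I_r) (j : 'I_c) : 0 <= `|C i j| ^+ 2 by rewrite exprn_ge0.
rewrite E; split=> [|/eqP]; first by apply: sumr_ge0 => i _; apply: sumr_ge0.
rewrite psumr_eq0 => [/allP h|i _]; last by apply: sumr_ge0.
apply/matrixP => i j; rewrite mxE; apply/eqP.
have := h i (mem_index_enum i); rewrite implyTb psumr_eq0 // => /allP/(_ j (mem_index_enum j)).
by rewrite implyTb expf_eq0 normr_eq0.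
Qed.

(* [omega (p, xi)] is the squared norm of [p] for a suitable [xi] *)
Lemma omega_nondeg p : (forall xi, omega p xi = 0) ->
  forall i, [/\ repX p i = 0, repY p i = 0, repv p i = 0 & repw p i = 0].
Proof.
pose adj r c (C : 'M[K]_(r, c)) := (map_mx Num.conj C)^T.
move=> /(_ (QuiverRep (fun i => adj _ _ (repY p i)) (fun i => - adj _ _ (repX p i))
  (fun i => adj _ _ (repw p i)) (fun i => - adj _ _ (repv p i)))) /eqP.
have cyc r c (C : 'M[K]_(r, c)) : - \tr (- adj _ _ C *m C) = \tr (C *m adj _ _ C).
  by rewrite mulNmx raddfN opprK mxtrace_mulC.
have P0 r c (C : 'M[K]_(r, c)) : 0 <= \tr (C *m adj _ _ C) by have [] := mxtrace_adj_eq0 C.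
have Z r c (C : 'M[K]_(r, c)) : \tr (C *m adj _ _ C) = 0 -> C = 0 by have [] := mxtrace_adj_eq0 C.
rewrite /omega /=; under eq_bigr => i _ do rewrite !cyc.
rewrite psumr_eq0 => [/allP h i|i _]; last by rewrite !addr_ge0.
have := h i (mem_index_enum i); rewrite implyTb.
rewrite paddr_eq0 ?addr_ge0 // !paddr_eq0 // => /andP[/andP[/eqP/Z Y0 /eqP/Z X0] /andP[/eqP/Z w0 /eqP/Z v0]].
by [].
Qed.

Lemma rep_shiftN_eq p q : (forall xi, omega p xi = omega q xi) -> p = q.
Proof.
move=> e; have := @omega_nondeg (rep_shift p (-1) q).
have h xi : omega (rep_shift p (-1) q) xi = 0 by rewrite omegaDl e mulN1r subrr.
move=> /(_ h) /= {}h; case: p q h {e} => [X Y v w] [X' Y' v' w'] /= h.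
have sub0 r c (C D : 'M[K]_(r, c)) : C + -1 *: D = 0 -> C = D.
  by move/eqP; rewrite scaleN1r subr_eq0 => /eqP.
congr QuiverRep; apply: functional_extensionality_dep => i; have [? ? ? ?] := h i; exact: sub0.
Qed.

Lemma is_repderive_tot (p : K -> quiver_rep K d al) (t0 : K) V : is_repderive p t0 V ->
  [/\ is_mxderive (fun t => totX (p t)) t0 (totX V), is_mxderive (fun t => totY (p t)) t0 (totY V),
    forall i, is_mxderive (fun t => totw (p t) i) t0 (totw V i)
    & forall i, is_mxderive (fun t => totv (p t) i) t0 (totv V i)].
Proof.
move=> h.
have MlMr r c s u (C : 'M[K]_(r, c)) (D : 'M[K]_(s, u)) (F : K -> 'M[K]_(c, s)) dF :
    is_mxderive F t0 dF -> is_mxderive (fun t => C *m F t *m D) t0 (C *m dF *m D).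
  move=> hF; apply: (is_mxderive_eq (is_mxderiveM (is_mxderiveM (is_mxderive_cst t0 C) hF) (is_mxderive_cst t0 D))).
  by rewrite mulmx0 addr0 mul0mx add0r.
split=> [||i|i].
- rewrite totXE (_ : (fun t => _) = fun t => \sum_i vinj K al (i + inZp 1) *m repX (p t) i *m vprj K al i).
    by apply: is_mxderive_sum => i _; apply: MlMr; have [] := h i.
  by apply/funext => t; exact: totXE.
- rewrite totYE (_ : (fun t => _) = fun t => \sum_i vinj K al i *m repY (p t) i *m vprj K al (i + inZp 1)).
    by apply: is_mxderive_sum => i _; apply: MlMr; have [] := h i.
  by apply/funext => t; exact: totYE.
- rewrite totwE (_ : (fun t => _) = fun t => repw (p t) i *m vprj K al i); last first.
    by apply/funext => t; exact: totwE.
  have [_ _ _ hw] := h i; apply: (is_mxderive_eq (is_mxderiveM hw (is_mxderive_cst t0 _))).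
  by rewrite mulmx0 addr0.
- rewrite totvE (_ : (fun t => _) = fun t => vinj K al i *m repv (p t) i); last first.
    by apply/funext => t; exact: totvE.
  have [_ _ hv _] := h i; apply: (is_mxderive_eq (is_mxderiveM (is_mxderive_cst t0 _) hv)).
  by rewrite mul0mx add0r.
Qed.

Lemma hamilton_equations k (b : 'I_d) (p : K -> quiver_rep K d al) (t0 : K) V :
  is_repderive p t0 V ->
  rep_flow k b p t0 <->
  forall xi, is_derive (0 : K) 1 (fun s : K => ham k b (rep_shift (p t0) s xi)) (- omega V xi).
Proof.
move=> /is_repderive_tot [hX hY hw hv].
have [eX eY ev ew] := flowrepE (p t0) k (delta_mx b b).
split=> [[gX gY gw gv] xi|h].
  have -> : V = flowrep (p t0) k (delta_mx b b); last exact: is_derive_ham.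
  apply: tot_inj => [||i|i].
  - by rewrite eX; exact: is_mxderive_unique hX gX.
  - by rewrite eY; exact: is_mxderive_unique hY gY.
  - by rewrite ev; exact: is_mxderive_unique (hv i) (gv i).
  - by rewrite ew; exact: is_mxderive_unique (hw i) (gw i).
have VE : V = flowrep (p t0) k (delta_mx b b).
  apply: rep_shiftN_eq => xi; apply: oppr_inj.
  exact: is_derive_unique (h xi) (is_derive_ham _ _ _ _).
rewrite VE in hX hY hw hv; rewrite eX in hX; rewrite eY in hY.
split=> // i; [rewrite -/(floww _ _ _ _) -ew; exact: hw | rewrite -/(flowv _ _ _ _) -ev; exact: hv].
Qed.
End HamiltonEquations.

(** * Exponentials *)

Section LinearApproximation.
Variable K : numFieldType.

(** In this form, free of quotients, differentiability can be passed from the real exponential, sine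
    and cosine to the complex exponential. *)
Lemma is_derive_approx (f : K -> K) (z df : K) : is_derive z 1 f df <->
  forall e : K, 0 < e -> exists2 de : K, 0 < de &
    forall h, `|h| < de -> `|f (z + h) - f z - df * h| <= e * `|h|.
Proof.
split=> [[hf <-] e e0|h].
  have := hf; rewrite /derivable => /cvgrPdist_le /(_ e e0).
  rewrite /dnbhs /within nearE /= => /nbhs_ballP [de /= de0 hde]; exists de => // h hd.
  have [->|h0] := eqVneq h 0; first by rewrite addr0 subrr mulr0 subr0 normr0 mulr0.
  have := hde h; rewrite /= -ball_normE /= sub0r normrN => /(_ hd h0).
  rewrite -[X in _ -> is_true X]ler_pdivrMr ?normr_gt0 // -normfV -normrM => hh.
  apply: le_trans hh; rewrite -normrN opprB mulrBl mulfK //.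
  by rewrite /= -[_ *: (_ - _)]/(_ * _) -[_ *: 1]/(_ * 1) mulr1 [h + z]addrC mulrC.
have c : (fun t : K => t^-1 *: (f (t *: (1 : K) + z) - f z)) @ 0^' --> df.
  apply/cvgrPdist_le => e e0; have [de de0 hde] := h e e0.
  rewrite /dnbhs /within nearE /=; apply/nbhs_ballP; exists de => //= t.
  rewrite -ball_normE /= sub0r normrN => td t0.
  rewrite -normrN opprB -[_ *: (_ - _)]/(_ * _) -[_ *: 1]/(_ * 1) mulr1 [t + z]addrC.
  have := hde t td; rewrite -ler_pdivrMr ?normr_gt0 // -normfV -normrM mulrBl mulfK //.
  by rewrite mulrC.
apply: DeriveDef; first exact: cvgP c.
exact: cvg_lim c.
Qed.
End LinearApproximation.

Section ComplexExponential.
Variable R : realType.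
Local Notation C := (complexF R).

Definition cexp (z : C) : C :=
  Complex (expR (complex.Re z) * cos (complex.Im z)) (expR (complex.Re z) * sin (complex.Im z)).

Lemma cexp0 : cexp 0 = 1.
Proof. by rewrite /cexp /= expR0 cos0 sin0 mulr1 mulr0. Qed.
Lemma cexpD (z t : C) : cexp (z + t) = cexp z * cexp t.
Proof.
case: z t => [a b] [c e]; rewrite /cexp /= expRD cosD sinD.
by congr Complex; ring.
Qed.

Lemma norm_complex_le (a b : R) : `|Complex a b : C| <= real_complex R (`|a| + `|b|).
Proof.
rewrite normc_def /= lecR -[leRHS]ger0_norm ?addr_ge0 // -sqrtr_sqr ler_wsqrtr //.
rewrite -(real_normK (num_real a)) -(real_normK (num_real b)) sqrrD lerD2r lerDl.
by rewrite mulrn_wge0 // mulr_ge0.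
Qed.
Lemma Re_le_norm (a b : R) : real_complex R `|a| <= `|Complex a b : C|.
Proof. by rewrite normc_def /= lecR -sqrtr_sqr ler_wsqrtr // lerDl sqr_ge0. Qed.
Lemma Im_le_norm (a b : R) : real_complex R `|b| <= `|Complex a b : C|.
Proof. by rewrite normc_def /= lecR -sqrtr_sqr ler_wsqrtr // lerDr sqr_ge0. Qed.

Lemma cexp_approx0 (e : C) : 0 < e -> exists2 de : C, 0 < de &
  forall h : C, `|h| < de -> `|cexp h - 1 - h| <= e * `|h|.
Proof.
case: e => e ie; rewrite ltcE /= => /andP[/eqP -> e0].
(* The constant is 9 = (3 + 1) + (3 + 2), the sum of the coefficients in the bounds [hr] and [hi]
   below, once |a| and |b| are bounded by the modulus of a + i b. That e1 is at most 1 gives the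
   bounds on exp a and exp a - 1. *)
have [e1 [e10 e11 e1e]] : exists e1 : R, [/\ 0 < e1, e1 <= 1 & 9%:R * e1 <= e].
  exists (Num.min 1 (e / 9%:R)); split; first by rewrite lt_min ltr01 divr_gt0.
    by rewrite ge_min lexx.
  by rewrite mulrC -ler_pdivlMr // ge_min lexx orbT.
have [d1 d10 h1] := proj1 (is_derive_approx _ _ _) (is_derive_expR (0 : R)) e1 e10.
have [d2 d20 h2] := proj1 (is_derive_approx _ _ _) (is_derive_sin (0 : R)) e1 e10.
have [d3 d30 h3] := proj1 (is_derive_approx _ _ _) (is_derive_cos (0 : R)) e1 e10.
(* Including e1 in the minimum makes |a| < e1, so that the mixed term (exp a - 1) b is at most 2 e1
   |b|. *)
set de := Num.min (Num.min d1 d2) (Num.min d3 e1).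
exists (real_complex R de); first by rewrite ltcE /= eqxx !lt_min d10 d20 d30 e10.
case=> a b hd.
have ha : `|a| < de by rewrite -ltcR; exact: le_lt_trans (Re_le_norm a b) hd.
have hb : `|b| < de by rewrite -ltcR; exact: le_lt_trans (Im_le_norm a b) hd.
move: ha hb; rewrite !lt_min => /andP[/andP[ha1 _] /andP[_ ha]] /andP[/andP[_ hb2] /andP[hb3 _]].
have {h1} := h1 a ha1; rewrite add0r expR0 mul1r => h1.
have {h2} := h2 b hb2; rewrite add0r sin0 cos0 subr0 mul1r => h2.
have {h3} := h3 b hb3; rewrite add0r sin0 cos0 oppr0 mul0r subr0 => h3.
have h4 : `|expR a - 1| <= 2%:R * `|a|.
  rewrite -[expR a - 1](subrK a); apply: le_trans (ler_normD _ _) _.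
  rewrite mulr_natl mulr2n lerD2r; apply: le_trans h1 _.
  by rewrite ler_piMl.
have h5 : `|expR a| <= 3%:R.
  rewrite -[expR a](subrK 1); apply: le_trans (ler_normD _ _) _.
  rewrite normr1 -[3]/(2 + 1)%N%:R natrD lerD2r; apply: le_trans h4 _.
  by rewrite ler_piMr // (le_trans (ltW ha)).
have hr : `|expR a * cos b - 1 - a| <= 3%:R * (e1 * `|b|) + e1 * `|a|.
  have -> : expR a * cos b - 1 - a = expR a * (cos b - 1) + (expR a - 1 - a) by ring.
  apply: le_trans (ler_normD _ _) _; apply: lerD => //.
  by rewrite normrM; apply: ler_pM.
have hi : `|expR a * sin b - b| <= 3%:R * (e1 * `|b|) + 2%:R * e1 * `|b|.
  have -> : expR a * sin b - b = expR a * (sin b - b) + (expR a - 1) * b by ring.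
  apply: le_trans (ler_normD _ _) _; apply: lerD; rewrite normrM.
    by apply: ler_pM.
  apply: ler_pM => //; apply: le_trans h4 _.
  by rewrite ler_wpM2l // ltW.
have -> : cexp (Complex a b) - 1 - Complex a b = Complex (expR a * cos b - 1 - a) (expR a * sin b - b).
  by rewrite /cexp; apply/eqP; rewrite eq_complex /= ?subr0 !eqxx.
apply: le_trans (norm_complex_le _ _) _.
have nh : real_complex R (e * Num.sqrt (a ^+ 2 + b ^+ 2)) = (Complex e 0 : C) * `|Complex a b : C|.
  by rewrite normc_def; apply/eqP; rewrite eq_complex /= !(mulr0, mul0r, subr0, addr0) !eqxx.
rewrite -nh lecR; set s := Num.sqrt _.
have as' : `|a| <= s by rewrite -sqrtr_sqr ler_wsqrtr // lerDl sqr_ge0.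
have bs : `|b| <= s by rewrite -sqrtr_sqr ler_wsqrtr // lerDr sqr_ge0.
apply: le_trans (lerD hr hi) _.
have s0 : 0 <= s by rewrite sqrtr_ge0.
apply: (@le_trans _ _ (9%:R * e1 * s)); last by rewrite ler_wpM2r.
have -> : 9%:R * e1 * s = (3%:R * (e1 * s) + e1 * s) + (3%:R * (e1 * s) + 2%:R * e1 * s) by ring.
have E x : x <= s -> e1 * x <= e1 * s by move=> xs; rewrite ler_wpM2l // ltW.
rewrite -!mulrA; apply: lerD; apply: lerD; [|exact: E| |]; rewrite ler_wpM2l //; exact: E.
Qed.

Lemma is_derive_cexp (z : C) : is_derive z 1 cexp (cexp z).
Proof.
apply/is_derive_approx => e e0.
have n0 : 0 < `|cexp z| + 1 by rewrite ltr_wpDl.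
have [de de0 hde] := cexp_approx0 (divr_gt0 e0 n0); exists de => // h hd.
have -> : cexp (z + h) - cexp z - cexp z * h = cexp z * (cexp h - 1 - h).
  by rewrite cexpD; ring.
rewrite normrM; apply: (@le_trans _ _ ((`|cexp z| + 1) * (e / (`|cexp z| + 1) * `|h|))).
  by apply: ler_pM => //; [rewrite lerDl | exact: hde].
by rewrite mulrA mulrC [X in _ * X]mulrC divfK ?gt_eqF // mulrC.
Qed.
End ComplexExponential.

Lemma is_derive_comp_affine (K : numFieldType) (f : K -> K) (c a z df : K) :
  is_derive (c + a * z) 1 f df -> is_derive z 1 (fun t => f (c + a * t)) (a * df).
Proof.
move=> /is_derive_approx hf; apply/is_derive_approx => e e0.
(* Adding 1 keeps the divisor positive when a = 0. *)
have a0 : 0 < `|a| + 1 by rewrite ltr_wpDl.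
have [de de0 hde] := hf _ (divr_gt0 e0 a0); exists (de / (`|a| + 1)); first exact: divr_gt0.
move=> h; rewrite ltr_pdivlMr // => hd.
have ah : `|a * h| <= `|h| * (`|a| + 1) by rewrite normrM mulrC ler_wpM2l // lerDl.
have := hde (a * h) (le_lt_trans ah hd).
rewrite mulrDr addrA mulrA [df * a]mulrC => hh; apply: le_trans hh _.
apply: (@le_trans _ _ (e / (`|a| + 1) * (`|h| * (`|a| + 1)))).
  by rewrite ler_wpM2l // ltW ?divr_gt0.
by rewrite [`|h| * _]mulrC mulrA divfK // gt_eqF.
Qed.

(** * Partial fractions, the source of the spectral projectors *)

Section PartialFractions.
Variable K : fieldType.
Implicit Types (s : seq K) (a b : K).

Definition cofac s (m : nat) a : {poly K} := \prod_(b <- s | b != a) ('X - b%:P) ^+ m.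

Lemma prod_cofac s m a : uniq s -> a \in s ->
  ('X - a%:P) ^+ m * cofac s m a = \prod_(b <- s) ('X - b%:P) ^+ m.
Proof. by move=> us sa; rewrite [RHS](bigD1_seq a). Qed.

(** For nonempty s this is the partial fraction decomposition of 1 / \prod_(b <- s) (X - b)^m with
    the denominators cleared. In the induction, u (X - a)^m + v \prod_(b <- s) (X - b)^m = 1 gives
    the new coefficient v at a and multiplies the old ones by u. *)
Lemma cofac_bezout s m : uniq s -> exists q : K -> {poly K},
  \sum_(a <- s) q a * cofac s m a = (s != [::])%:R.
Proof.
elim: s => [|a s IH] /=; first by exists (fun=> 0); rewrite big_nil.
move=> /andP[as' us]; have [q hq] := IH us.
have cop : coprimep (('X - a%:P) ^+ m) (\prod_(b <- s) ('X - b%:P) ^+ m).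
  rewrite big_seq; apply: (big_rec (coprimep _)) => [|b p bs h]; first exact: coprimep1.
  rewrite coprimepMr h andbT; apply: coprimep_expl; apply: coprimep_expr.
  by apply: coprimep_XsubC2; rewrite subr_eq0; apply: contraNneq as' => <-.
have [[u v] /= uv] := Bezout_eq1_coprimepP _ _ cop.
exists (fun b => if b == a then (if s == [::] then 1 else v) else u * q b).
rewrite big_cons eqxx /cofac big_cons eqxx /=.
have E : \prod_(b <- s | b != a) ('X - b%:P) ^+ m = \prod_(b <- s) ('X - b%:P) ^+ m.
  rewrite big_seq_cond [RHS]big_seq; apply: eq_bigl => b.
  by case: (boolP (b \in s)) => //= bs; apply: contraNneq as' => <-.
rewrite E; case: eqP => [->|/eqP s0]; first by rewrite !big_nil mulr1 addr0.
have {}hq : \sum_(c <- s) q c * cofac s m c = 1 by rewrite hq s0.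
rewrite -[RHS]uv [RHS]addrC; congr (_ + _).
have -> : u * ('X - a%:P) ^+ m = u * (\sum_(c <- s) q c * cofac s m c) * ('X - a%:P) ^+ m.
  by rewrite hq mulr1.
rewrite mulr_sumr mulr_suml big_seq [RHS]big_seq.
apply: eq_bigr => b bs; have ba : b != a by apply: contraNneq as' => <-.
rewrite (negPf ba) big_cons eq_sym ba /cofac; ring.
Qed.
End PartialFractions.

(** * The exponential of a matrix, from a scalar function E with E' = E *)

Section MatrixExponential.
Variables (K : numClosedFieldType) (E : K -> K).
Hypotheses (E0 : E 0 = 1) (EV : forall z, E z * E (- z) = 1).
Hypothesis EE : forall z : K, is_derive z 1 E (E z).

Definition texp (m : nat) (t : K) : {poly K} := \poly_(j < m) (t ^+ j / j`!%:R).

Lemma texp0 m : texp m.+1 0 = 1.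
Proof.
apply/polyP => j; rewrite coef_poly coef1; case: j => [|j]; first by rewrite fact0 divr1.
by rewrite expr0n mul0r if_same.
Qed.

(** Below degree m the coefficients are (- t + t)^l / l!, expanded by the binomial theorem. *)
Lemma texp_mulN m t : exists q, texp m t * texp m (- t) = (0 < m)%:R + q * 'X^m.
Proof.
exists (drop_poly m (texp m t * texp m (- t))).
rewrite -[LHS](poly_take_drop m); congr (_ + _); apply/polyP => l.
rewrite coef_take_poly; case: ltnP => [lm|ml]; last first.
  by case: m ml => [|m] ml; rewrite ?coef0 // coef1; case: l ml.
have -> : (0 < m)%:R = 1 :> {poly K} by rewrite (leq_ltn_trans _ lm).
rewrite coefM coef1.
under eq_bigr => i _.
  have il : (i <= l)%N by rewrite -ltnS.
  rewrite !coef_poly (leq_ltn_trans il lm) (leq_ltn_trans (leq_subr _ _) lm); over.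
have -> : (l == 0)%:R = (- t + t) ^+ l / l`!%:R.
  by rewrite addNr expr0n; case: l {lm} => [|l]; rewrite /= ?mul0r // fact0 divr1.
rewrite exprDn mulr_suml; apply: eq_bigr => i _.
have il : (i <= l)%N by rewrite -ltnS.
have f0 j : (j`!%:R : K) != 0 by rewrite pnatr_eq0 -lt0n fact_gt0.
have c0 : ('C(l, i)%:R : K) != 0 by rewrite pnatr_eq0 -lt0n bin_gt0.
rewrite -(bin_fact il) !natrM -mulr_natr; field.
by rewrite !f0 c0.
Qed.

Lemma is_derive_texp_coef (j : nat) (t : K) :
  is_derive t 1 (fun t : K => t ^+ j / j`!%:R) (if j is j'.+1 then t ^+ j' / j'`!%:R else 0).
Proof.
case: j => [|j].
  have -> : (fun t : K => t ^+ 0 / 0`!%:R) = fun=> 1.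
    by apply/funext => z; rewrite expr0 fact0 divr1.
  exact: is_derive_cst.
have h : is_derive t 1 (fun t : K => t ^+ j.+1) (j.+1%:R * t ^+ j).
  elim: j => [|j IH]; first by rewrite mul1r expr0; under eq_fun do rewrite expr1; exact: is_derive_id.
  under eq_fun do rewrite exprS.
  apply: (is_derive_eq (is_derive_mulf (is_derive_id t 1) IH)).
  by rewrite mul1r mulrCA -exprS [j.+2%:R]mulrS mulrDl mul1r.
apply: (is_derive_eq (is_derive_mulf h (is_derive_cstf t _))).
have f0 : (j`!%:R : K) != 0 by rewrite pnatr_eq0 -lt0n fact_gt0.
have s0 : (j.+1%:R : K) != 0 by rewrite pnatr_eq0.
rewrite mulr0 addr0 factS natrM; field.
by rewrite f0 nat1r s0.
Qed.

Lemma is_mxderive_scale r c (f : K -> K) (t0 : K) df (C : 'M[K]_(r, c)) :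
  is_derive t0 1 f df -> is_mxderive (fun t => f t *: C) t0 (df *: C).
Proof.
move=> hf a b; rewrite mxE; under eq_fun do rewrite mxE.
apply: (is_derive_eq (is_derive_mulf hf (is_derive_cstf t0 _))).
by rewrite mulr0 addr0.
Qed.

Lemma is_mxderive_scalef r c (f : K -> K) (F : K -> 'M[K]_(r, c)) (t0 : K) df dF :
  is_derive t0 1 f df -> is_mxderive F t0 dF ->
  is_mxderive (fun t => f t *: F t) t0 (df *: F t0 + f t0 *: dF).
Proof.
by move=> hf hF a b; rewrite !mxE; under eq_fun do rewrite mxE; exact: is_derive_mulf.
Qed.

Section Nonempty.
Variables (r : nat) (A : 'M[K]_r.+1).

Lemma horner_mx_poly (N : 'M[K]_r.+1) m (c : nat -> K) :
  horner_mx N (\poly_(j < m) c j) = \sum_(j < m) c j *: N ^+ j.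
Proof.
rewrite poly_def rmorph_sum; apply: eq_bigr => j _ /=.
by rewrite horner_mxZ rmorphXn /= horner_mx_X.
Qed.

(** The correction is the term cut off by the truncation. For N = A - a it vanishes after
    multiplication by e_a, since N^(m+1) e_a = 0. *)
Lemma is_mxderive_texp (N : 'M[K]_r.+1) m t :
  is_mxderive (fun t => horner_mx N (texp m.+1 t)) t
    (N *m horner_mx N (texp m.+1 t) - (t ^+ m / m`!%:R) *: N ^+ m.+1).
Proof.
rewrite (_ : (fun t => _) = fun t => \sum_(j < m.+1) (t ^+ j / j`!%:R) *: N ^+ j); last first.
  by apply/funext => z; rewrite horner_mx_poly.
have h := @is_mxderive_sum K _ _ t _ (index_enum 'I_m.+1) xpredT _ _
  (fun j _ => is_mxderive_scale (N ^+ j) (is_derive_texp_coef j t)).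
apply: (is_mxderive_eq h).
rewrite horner_mx_poly mulmx_sumr [in RHS]big_ord_recr /= -scalemxAr.
rewrite -[N *m N ^+ m]/(N * N ^+ m) -exprS addrK big_ord_recl /= scale0r add0r.
by apply: eq_bigr => j _; rewrite -scalemxAr exprS.
Qed.

(* exp (t A) = \sum_a E (a t) exp (t (A - a)) e_a over the eigenvalues a of A, where
   the spectral projectors e_a come from partial fractions of the inverse of the
   characteristic polynomial; as A - a is nilpotent on the image of e_a, the middle
   factor is a polynomial. *)
Lemma matrix_exp_nonempty : exists G : K -> 'M[K]_r.+1,
  [/\ G 0 = 1%:M, forall t : K, is_mxderive G t (A *m G t),
      forall t, G t *m G (- t) = 1%:M
    & forall B t, B *m A = A *m B -> B *m G t = G t *m B].
Proof.
have [s cs] := closed_field_poly_normal (char_poly A).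
move: cs; rewrite (monicP (char_poly_monic A)) scale1r => cs.
pose u := undup s; have us : uniq u := undup_uniq s.
have s0 : (0 < size s)%N.
  have : size (char_poly A) = (size s).+1 by rewrite cs size_prod_XsubC.
  by rewrite size_char_poly => -[<-].
(* The number of roots with multiplicity is a crude bound for each multiplicity, so this single
   exponent serves all eigenvalues. *)
have [m mE] : exists m, size s = m.+1 by case: (size s) s0 => // m _; exists m.
have [q hq] := cofac_bezout m.+1 us.
have u0 : (u != [::]) = true.
  by apply/eqP => ue; move: s0; rewrite (undup_nil ue).
rewrite u0 in hq.
have Q0 : horner_mx A (\prod_(b <- u) ('X - b%:P) ^+ m.+1) = 0.
  have : char_poly A %| \prod_(b <- u) ('X - b%:P) ^+ m.+1.
    rewrite prodrXl -mE cs; have : {subset s <= u} by move=> z; rewrite mem_undup.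
    elim: (s) => [|z s' IH] sub; first by rewrite big_nil expr0 dvd1p.
    rewrite big_cons /= exprS; apply: dvdp_mul; last first.
      by apply: IH => x xs; apply: sub; rewrite inE xs orbT.
    by rewrite (bigD1_seq z) /= ?dvdp_mulr // sub // mem_head.
  case/dvdpP => g ->; rewrite rmorphM /=.
  by have /= -> := Cayley_Hamilton A; rewrite mulr0.
pose e a := horner_mx A (q a * cofac u m.+1 a).
have sume : \sum_(a <- u) e a = 1 by rewrite -rmorph_sum hq rmorph1.
have Ne a : a \in u -> (A - a%:M) ^+ m.+1 * e a = 0.
  move=> au; have -> : (A - a%:M) ^+ m.+1 = horner_mx A (('X - a%:P) ^+ m.+1).
    by rewrite rmorphXn rmorphB /= horner_mx_X horner_mx_C.
  by rewrite -rmorphM mulrCA prod_cofac // rmorphM /= Q0 mulr0.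
(* The cofactor of b contains (X - a)^(m+1), so e_a e_b is a multiple of the full product, which A
   annihilates. *)
have ee a b : a \in u -> b \in u -> a != b -> e a * e b = 0.
  move=> au bu ab; rewrite -rmorphM.
  have -> : cofac u m.+1 b = ('X - a%:P) ^+ m.+1 * cofac [seq c <- u | c != b] m.+1 a.
    by rewrite prod_cofac ?filter_uniq ?mem_filter ?ab // /cofac big_filter.
  have -> : q a * cofac u m.+1 a * (q b * (('X - a%:P) ^+ m.+1 * cofac [seq c <- u | c != b] m.+1 a))
    = \prod_(c <- u) ('X - c%:P) ^+ m.+1 * (q a * q b * cofac [seq c <- u | c != b] m.+1 a).
    by rewrite -(prod_cofac m.+1 us au); ring.
  by rewrite rmorphM /= Q0 mul0r.
have e2 a : a \in u -> e a * e a = e a.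
  move=> au; rewrite -[RHS]mulr1 -sume mulr_sumr (bigD1_seq a) //= big_seq_cond big1 ?addr0 //.
  by move=> b /andP[bu ba]; rewrite ee // eq_sym.
pose T a t := horner_mx (A - a%:M) (texp m.+1 t).
have Te a t : a \in u -> T a t * T a (- t) * e a = e a.
  move=> au; rewrite /T -rmorphM; have [g ->] := texp_mulN m.+1 t.
  rewrite rmorphD rmorph1 rmorphM rmorphXn /= horner_mx_X mulrDl mul1r -mulrA Ne // mulr0.
  by rewrite addr0.
have cA B a : B *m A = A *m B -> B * e a = e a * B.
  by move=> BA; apply: comm_mx_horner.
have eA a : e a *m A = A *m e a by exact: comm_horner_mx.
have cT B a t : B *m A = A *m B -> B * T a t = T a t * B.
  move=> BA; apply: comm_mx_horner; rewrite /comm_mx mulmxBr mulmxBl BA; congr (_ - _).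
  by rewrite scalar_mxC.
exists (fun t => \sum_(a <- u) E (a * t) *: (T a t * e a)); split.
- rewrite -[RHS]sume; apply: eq_bigr => a _.
  by rewrite mulr0 E0 scale1r /T texp0 rmorph1 mul1r.
- move=> t; rewrite mulmx_sumr [X in is_mxderive _ _ X]big_seq.
  rewrite (_ : (fun t => _) = fun t => \sum_(a <- u | a \in u) E (a * t) *: (T a t * e a)); last first.
    by apply/funext => z; rewrite big_seq.
  apply: is_mxderive_sum => a au.
  have hE : is_derive t 1 (fun t => E (a * t)) (a * E (a * t)).
    have := @is_derive_comp_affine _ E 0 a t _ (EE _).
    by under eq_fun do rewrite add0r; rewrite add0r.
  have hT := is_mxderiveM (is_mxderive_texp (A - a%:M) m t) (is_mxderive_cst t (e a)).
  apply: (is_mxderive_eq (is_mxderive_scalef hE hT)).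
  have N0 : (A - a%:M) ^+ m.+1 *m e a = 0 by exact: Ne.
  rewrite mulmx0 addr0 mulmxBl -scalemxAl N0 scaler0 subr0 -[horner_mx _ _]/(T a t).
  rewrite -scalerA [a *: _]scalerA mulrC -scalerA -scalerDr -scalemxAr; congr (_ *: _).
  by rewrite mulmxBl mulmxBl mul_scalar_mx -scalemxAl -[A *m T a t *m _]mulmxA addrC subrK.
- move=> t; rewrite -[RHS]sume -[LHS]/(_ * _) mulr_suml big_seq [RHS]big_seq.
  apply: eq_bigr => a au; rewrite mulr_sumr (bigD1_seq a) //= big_seq_cond big1 ?addr0.
    rewrite -scalerAl -scalerAr scalerA mulrN EV scale1r -mulrA [e a * _]mulrA (cT _ _ _ (eA a)).
    by rewrite -mulrA e2 // mulrA Te.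
  move=> b /andP[bu ba]; rewrite -scalerAl -scalerAr -[T a t * e a * _]mulrA [e a * _]mulrA (cT _ _ _ (eA a)).
  by rewrite -[T b _ * _ * _]mulrA ee // 1?eq_sym // !mulr0 !scaler0.
- move=> B t BA; rewrite -[LHS]/(B * _) -[RHS]/(_ * B) mulr_sumr mulr_suml; apply: eq_bigr => a _.
  by rewrite -scalerAr -scalerAl mulrA cT // -mulrA cA // mulrA.
Qed.
End Nonempty.

Lemma matrix_exp r (A : 'M[K]_r) : exists G : K -> 'M[K]_r,
  [/\ G 0 = 1%:M, forall t : K, is_mxderive G t (A *m G t),
      forall t, G t *m G (- t) = 1%:M
    & forall B t, B *m A = A *m B -> B *m G t = G t *m B].
Proof.
case: r A => [|r] A; last exact: matrix_exp_nonempty.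
exists (fun=> 1%:M); split=> // [t|t|B t _]; first by move=> [].
  by rewrite mul1mx.
by rewrite mulmx1 mul1mx.
Qed.
End MatrixExponential.

(** * Exponentials in several times and the dressing matrices *)

Section Dressing.
Variables (K : numClosedFieldType) (E : K -> K).
Hypotheses (E0 : E 0 = 1) (EV : forall z, E z * E (- z) = 1).
Hypothesis EE : forall z : K, is_derive z 1 E (E z).

Lemma is_mxderive_comp_affine r c (F : K -> 'M[K]_(r, c)) (b a z : K) dF :
  is_mxderive F (b + a * z) dF -> is_mxderive (fun t => F (b + a * t)) z (a *: dF).
Proof. by move=> hF i j; rewrite mxE; exact: is_derive_comp_affine (hF i j). Qed.

(** The powers of A commute, so the exponential of \sum_k t_k A^k is a product of exponentials in
    one variable. *)
Lemma multi_exp r (A : 'M[K]_r) m : exists G : ('I_m -> K) -> 'M[K]_r,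
  [/\ G (fun=> 0) = 1%:M,
      forall t (k : 'I_m),
        is_mxderive (fun s : K => G (fun j => t j + (j == k)%:R * s)) 0 (A ^+ k *m G t),
      forall t, G t *m G (fun j => - t j) = 1%:M
    & forall B t, B *m A = A *m B -> B *m G t = G t *m B].
Proof.
have [F hF] := choice (fun k : 'I_m => matrix_exp E0 EV EE (A ^+ k)).
have cA k z B : B *m A = A *m B -> B *m F k z = F k z *m B.
  by have [_ _ _ h] := hF k; move=> BA; apply: h; exact: (commrX k (BA : GRing.comm B A)).
have cF k l z z' : F k z *m F l z' = F l z' *m F k z.
  by apply: (cA l z' (F k z)); rewrite (cA k z A).
pose G t := \prod_(k < m) F k (t k).
have cG B t (s : seq 'I_m) : (forall k, B *m F k (t k) = F k (t k) *m B) ->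
    B *m (\prod_(k <- s) F k (t k)) = (\prod_(k <- s) F k (t k)) *m B.
  move=> BF; elim: s => [|k s IH]; first by rewrite big_nil mulmx1 mul1mx.
  by rewrite big_cons -[F k _ * _]/(F k _ *m _) mulmxA BF -mulmxA IH mulmxA.
exists G; split.
- by rewrite /G big1 // => k _; have [-> _ _ _] := hF k.
- move=> t k; rewrite /G.
  (* For an arbitrary list the derivative is weighted by the number of occurrences of k, which
     permits induction; in the enumeration of the indices k occurs once. *)
  suff H (s : seq 'I_m) : is_mxderive (fun z : K => \prod_(l <- s) F l (t l + (l == k)%:R * z)) 0
      ((A ^+ k *m \prod_(l <- s) F l (t l)) *+ count_mem k s).
    apply: (is_mxderive_eq (H (index_enum _))).
    by rewrite count_uniq_mem ?index_enum_uniq // mem_index_enum mulr1n.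
  elim: s => [|l s IH].
    rewrite big_nil; under eq_fun do rewrite big_nil.
    by rewrite mulr0n; exact: is_mxderive_cst.
  rewrite big_cons; under eq_fun do rewrite big_cons.
  have hl : is_mxderive (fun z : K => F l (t l + (l == k)%:R * z)) 0
      ((l == k)%:R *: (A ^+ l *m F l (t l))).
    apply: is_mxderive_comp_affine; rewrite mulr0 addr0.
    by have [_ h _ _] := hF l; exact: h.
  apply: (is_mxderive_eq (is_mxderiveM hl IH)); rewrite !mulr0 !addr0.
  under [X in _ *m X + _]eq_bigr => j _ do rewrite mulr0 addr0.
  rewrite -[F l _ * _]/(F l _ *m _) /= mulrnDr; congr (_ + _).
    case: eqP => [->|_]; last by rewrite scale0r mul0mx mulr0n.
    by rewrite scale1r mulr1n mulmxA.
  have -> : A ^+ k *m (F l (t l) *m \prod_(j <- s) F j (t j))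
     = F l (t l) *m (A ^+ k *m \prod_(j <- s) F j (t j)).
    by rewrite !mulmxA (cA l) //; exact/esym/(commrX k (erefl : GRing.comm A A)).
  exact: (raddfMn (mulmx (F l (t l)))).
- move=> t; rewrite /G; elim: (index_enum _) => [|k s IH]; first by rewrite !big_nil mulmx1.
  rewrite !big_cons -[F k _ * _]/(F k _ *m _) -[F k (- _) * _]/(F k _ *m _).
  rewrite mulmxA -[F k (t k) *m _ *m _]mulmxA -cG; last by move=> l; exact: cF.
  by rewrite mulmxA; have [_ _ -> _] := hF k; rewrite mul1mx.
- by move=> B t BA; apply: cG => k; exact: cA.
Qed.

(** The shape of the exponential of [[Y, Q], [0, Y]] follows from this commutation alone: the
    generator commutes with the nilpotent block, hence so does its exponential. *)
Lemma block_comm_nilp r (Z : 'M[K]_(r + r)) :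
  Z *m block_mx 0 1%:M 0 0 = block_mx 0 1%:M 0 0 *m Z ->
  Z = block_mx (ulsubmx Z) (ursubmx Z) 0 (ulsubmx Z).
Proof.
rewrite -{1 2}[Z]submxK !mulmx_block !mulmx0 !mulmx1 !mul0mx !mul1mx !addr0 !add0r.
by move=> /eq_block_mx [e1 e2 _ _]; rewrite -{1}[Z]submxK -e1 -e2.
Qed.

(** The upper right block is the derivative of Y^k in the direction Q, the same sum as in the
    equation for X. *)
Lemma block_pow r (Y Q : 'M[K]_r) k : block_mx Y Q 0 Y ^+ k
  = block_mx (Y ^+ k) (\sum_(a < k) Y ^+ a *m Q *m Y ^+ (k - a - 1)) 0 (Y ^+ k).
Proof.
elim: k => [|k IH]; first by rewrite !expr0 big_ord0 -scalar_mx_block.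
rewrite exprSr IH -mulmxE mulmx_block !mulmx0 !mul0mx !addr0 add0r -[Y ^+ k *m Y]/(Y ^+ k * Y) -exprSr.
congr block_mx; rewrite big_ord_recr /= addrC; congr (_ + _).
  by have -> : (k.+1 - k - 1 = 0)%N by [lia]; rewrite expr0 mulmx1.
rewrite mulmx_suml; apply: eq_bigr => a _.
have -> : (k.+1 - a - 1 = (k - a - 1).+1)%N by have := ltn_ord a; lia.
by rewrite exprSr -!mulmxA.
Qed.

Lemma mul_utblock r (A B C D : 'M[K]_r) :
  block_mx A B 0 A *m block_mx C D 0 C = block_mx (A *m C) (A *m D + B *m C) 0 (A *m C).
Proof. by rewrite mulmx_block !mulmx0 !mul0mx !addr0 add0r. Qed.

(* [g] is exp (\sum_k t_k Y^k), [h] its inverse, and the upper triangular block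
   matrix [[g, g W], [0, g]] is the same exponential for [[Y, Q], [0, Y]]. *)
Lemma dressing r (Y Q : 'M[K]_r) m : exists g h W : ('I_m -> K) -> 'M[K]_r,
  [/\ [/\ g (fun=> 0) = 1%:M, h (fun=> 0) = 1%:M & W (fun=> 0) = 0],
      forall t, [/\ h t *m g t = 1%:M, Y *m g t = g t *m Y, Y *m h t = h t *m Y
                  & Y *m W t - W t *m Y = Q - h t *m Q *m g t]
    & forall t (k : 'I_m), let d s := (fun j : 'I_m => t j + (j == k)%:R * s) in
      [/\ is_mxderive (fun s : K => g (d s)) 0 (Y ^+ k *m g t),
          is_mxderive (fun s : K => h (d s)) 0 (- (Y ^+ k *m h t))
        & is_mxderive (fun s : K => W (d s)) 0
            (\sum_(a < k) Y ^+ a *m (h t *m Q *m g t) *m Y ^+ (k - a - 1))]].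
Proof.
have [G [G0 dG GV cG]] := multi_exp (block_mx Y Q 0 Y) m.
have GE t : G t = block_mx (ulsubmx (G t)) (ursubmx (G t)) 0 (ulsubmx (G t)).
  apply: block_comm_nilp; apply/esym/cG.
  by rewrite !mulmx_block !mulmx0 !mulmx1 !mul0mx !mul1mx !addr0 ?add0r.
pose g t := ulsubmx (G t); pose f t := ursubmx (G t); pose h t := g (fun j => - t j).
have VV (t : 'I_m -> K) : (fun j => - - t j) = t by apply/funext => j; rewrite opprK.
have gh t : g t *m h t = 1%:M.
  have := GV t; rewrite (GE t) (GE (fun j => - t j)) mulmx_block mulmx0 addr0 scalar_mx_block.
  by move=> /eq_block_mx [].
have hg t : h t *m g t = 1%:M by have := gh (fun j => - t j); rewrite /h VV.
have [cg cf] : (forall t, Y *m g t = g t *m Y) /\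
    (forall t, Y *m f t - f t *m Y = g t *m Q - Q *m g t).
  (* The exponential commutes with its own generator; the upper right block of this relation is the
     commutator equation for [f]. *)
  have H t := cG _ t (erefl (block_mx Y Q 0 Y *m block_mx Y Q 0 Y)).
  have {}H t : Y *m g t = g t *m Y /\ Y *m f t + Q *m g t = g t *m Q + f t *m Y.
    have := H t; rewrite (GE t) !mulmx_block !mulmx0 !mul0mx !addr0 => /eq_block_mx [e1 e2 _ _].
    by split.
  split=> t; have [e1 e2] := H t => //.
  by apply/eqP; rewrite subr_eq addrAC eq_sym subr_eq e2.
have ch t : Y *m h t = h t *m Y by exact: cg.
exists g, h, (fun t => h t *m f t); split.
- split; rewrite /h /g /f ?oppr0 G0 scalar_mx_block ?block_mxKul //.
  by rewrite block_mxKur mulmx0.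
- move=> t; split=> //.
  rewrite mulmxA ch -!mulmxA -mulmxBr cf mulmxBr !mulmxA hg mul1mx.
  by rewrite -mulmxA.
move=> t k d.
have dGb : is_mxderive (fun s => G (d s)) 0 (block_mx (Y ^+ k *m g t)
    (Y ^+ k *m f t + (\sum_(a < k) Y ^+ a *m Q *m Y ^+ (k - a - 1)) *m g t) 0 (Y ^+ k *m g t)).
  by apply: (is_mxderive_eq (dG t k)); rewrite block_pow GE mul_utblock.
have dg : is_mxderive (fun s : K => g (d s)) 0 (Y ^+ k *m g t).
  move=> i j; have := dGb (lshift r i) (lshift r j); rewrite block_mxEul.
  rewrite (_ : (fun s : K => _) = fun s => g (d s) i j) //.
  by apply/funext => s; rewrite !mxE.
have df : is_mxderive (fun s : K => f (d s)) 0
    (Y ^+ k *m f t + (\sum_(a < k) Y ^+ a *m Q *m Y ^+ (k - a - 1)) *m g t).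
  move=> i j; have := dGb (lshift r i) (rshift r j); rewrite block_mxEur.
  rewrite (_ : (fun s : K => _) = fun s => f (d s) i j) //.
  by apply/funext => s; rewrite !mxE.
have dh : is_mxderive (fun s : K => h (d s)) 0 (- (Y ^+ k *m h t)).
  have h1 : is_mxderive (fun s : K => g (fun j => - t j + (j == k)%:R * s)) (0 + -1 * 0) (Y ^+ k *m h t).
    rewrite mulr0 addr0 => i j; have := dG (fun j => - t j) k (lshift r i) (lshift r j).
    rewrite block_pow (GE (fun j => - t j)) mul_utblock block_mxEul.
    rewrite (_ : (fun s : K => _) = fun s => g (fun j => - t j + (j == k)%:R * s) i j) //.
    by apply/funext => s; rewrite !mxE.
  have := is_mxderive_comp_affine h1; rewrite scaleN1r.
  rewrite (_ : (fun s : K => _) = fun s => h (d s)) //.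
  apply/funext => s; rewrite /h; congr (g _); apply/funext => j.
  by rewrite /d add0r mulN1r mulrN opprD.
split=> //; apply: (is_mxderive_eq (is_mxderiveM dh df)).
have d0 : d 0 = t by apply/funext => j; rewrite /d mulr0 addr0.
have Yh a : Y ^+ a *m h t = h t *m Y ^+ a.
  by apply/esym; apply: (commrX a (esym (ch t) : GRing.comm (h t) Y)).
have Yg a : Y ^+ a *m g t = g t *m Y ^+ a.
  by apply/esym; apply: (commrX a (esym (cg t) : GRing.comm (g t) Y)).
(* In h' f + h f' the two terms with Y^k cancel, and the sum conjugated by g is left. *)
rewrite d0 mulNmx mulmxDr [h t *m (Y ^+ k *m _)]mulmxA -Yh addKr.
rewrite mulmx_suml mulmx_sumr; apply: eq_bigr => a _.
by rewrite -[_ *m g t]mulmxA Yg !mulmxA -Yh.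
Qed.
End Dressing.

(** * Integration of the flows *)

Section Deformation.
Variables (K : numClosedFieldType) (n d : nat) (al : 'I_n.+1 -> nat).
Local Notation N := (\sum_i al i)%N.
Local Notation vpr := (vproj K al).
Implicit Types (i l : 'I_n.+1).

(** The dressing matrices need not be homogeneous; only the part that maps each V_i to V_(i+1) can
    be subtracted from X. *)
Definition degree1_part (Z : 'M[K]_N) : 'M[K]_N := \sum_i vpr (i + inZp 1) *m Z *m vpr i.

Lemma degree1_part_graded Z i : vpr (i + inZp 1) *m degree1_part Z = degree1_part Z *m vpr i.
Proof.
transitivity (vpr (i + inZp 1) *m Z *m vpr i).
  rewrite /degree1_part mulmx_sumr [LHS](@sum_only1 _ _ i).
    by rewrite -[_ *m vpr i]mulmxA mulmxA vproj_mul eqxx mulmxA.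
  move=> j ji; rewrite -[_ *m vpr j]mulmxA mulmxA vproj_mul (inj_eq (addIr _)) eq_sym.
  by rewrite (negPf ji) mul0mx.
rewrite /degree1_part mulmx_suml [RHS](@sum_only1 _ _ i); first by rewrite -[RHS]mulmxA vproj_mul eqxx.
by move=> j ji; rewrite -[LHS]mulmxA vproj_mul (negPf ji) mulmx0.
Qed.

Lemma degree1_part0 : degree1_part 0 = 0.
Proof. by rewrite /degree1_part [LHS]big1 // => i _; rewrite mulmx0 mul0mx. Qed.

(** Y has degree -1, so the commutator with Y takes the degree one part of Z to the degree zero
    part, that is the diagonal blocks, of [Y, Z]. *)
Lemma degree1_part_comm (Y Z : 'M[K]_N) : (forall i, Y *m vpr (i + inZp 1) = vpr i *m Y) ->
  Y *m degree1_part Z - degree1_part Z *m Y = \sum_i vpr i *m (Y *m Z - Z *m Y) *m vpr i.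
Proof.
move=> gY; under [RHS]eq_bigr => i _ do rewrite mulmxBr mulmxBl.
rewrite sumrB; congr (_ - _).
  rewrite /degree1_part mulmx_sumr; apply: eq_bigr => i _.
  by rewrite [LHS]mulmxA [Y *m (_ *m Z)]mulmxA gY -!mulmxA.
rewrite /degree1_part mulmx_suml [RHS](@sum_shift _ (inZp 1)); apply: eq_bigr => i _.
by rewrite -[LHS]mulmxA -gY [LHS]mulmxA; congr (_ *m _); rewrite -mulmxA.
Qed.

Lemma is_mxderive_degree1_part (F : K -> 'M[K]_N) (s : K) dF :
  is_mxderive F s dF -> is_mxderive (fun s => degree1_part (F s)) s (degree1_part dF).
Proof.
move=> hF; apply: is_mxderive_sum => i _.
have h := is_mxderiveM (is_mxderiveM (is_mxderive_cst s (vpr (i + inZp 1))) hF)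
  (is_mxderive_cst s (vpr i)).
by apply: (is_mxderive_eq h); rewrite mul0mx add0r mulmx0 addr0.
Qed.

Variable p : quiver_rep K d al.
Local Notation Y := (totY p).
Implicit Types (W : 'M[K]_N) (v : 'M[K]_(N, d)) (w : 'M[K]_(d, N)).

(** v and w carry all vertices at once, and their components at i become v_i and w_i. *)
Definition deform W v w : quiver_rep K d al :=
  rep_of (totX p - degree1_part W) Y (fun i => vpr i *m v) (fun i => w *m vpr i).

Lemma deformE W v w :
  [/\ totX (deform W v w) = totX p - degree1_part W, totY (deform W v w) = Y,
      forall i, totv (deform W v w) i = vpr i *m v
    & forall i, totw (deform W v w) i = w *m vpr i].
Proof.
split=> [||i|i].
- by apply: totX_of => i; rewrite mulmxBr mulmxBl totX_vproj degree1_part_graded.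
- by apply: totY_of => i; exact: totY_vproj.
- by apply: totv_of; rewrite mulmxA vproj_mul eqxx.
- by apply: totw_of; rewrite -mulmxA vproj_mul eqxx.
Qed.

Lemma vproj_sumv i : vpr i *m (\sum_l totv p l) = totv p i.
Proof.
rewrite mulmx_sumr [LHS](@sum_only1 _ _ i); first by rewrite totv_vproj eqxx.
by move=> l li; rewrite totv_vproj eq_sym (negPf li).
Qed.
Lemma sumw_vproj i : (\sum_l totw p l) *m vpr i = totw p i.
Proof.
rewrite mulmx_suml [LHS](@sum_only1 _ _ i); first by rewrite totw_vproj eqxx.
by move=> l li; rewrite totw_vproj (negPf li).
Qed.

Lemma deform0 : deform 0 (\sum_l totv p l) (\sum_l totw p l) = p.
Proof.
have [eX eY ev ew] := deformE 0 (\sum_l totv p l) (\sum_l totw p l).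
apply: tot_inj => // [|i|i]; first by rewrite eX degree1_part0 subr0.
- by rewrite ev vproj_sumv.
- by rewrite ew sumw_vproj.
Qed.

(** The diagonal blocks of the hypothesis state that the change of [Y, X] equals the change of
    \sum_i v_i w_i. *)
Lemma deform_moment (lam : 'I_n.+1 -> K) W v w :
  Y *m W - W *m Y = (\sum_l totv p l) *m (\sum_l totw p l) - v *m w ->
  moment_eq lam p -> moment_eq lam (deform W v w).
Proof.
move=> YW /moment_eqP mom; apply/moment_eqP; rewrite -mom.
have [-> -> ev ew] := deformE W v w.
have -> : \sum_i totv (deform W v w) i *m totw (deform W v w) i = \sum_i vpr i *m (v *m w) *m vpr i.
  by apply: eq_bigr => i _; rewrite ev ew !mulmxA.
have -> : \sum_i totv p i *m totw p i
    = \sum_i vpr i *m ((\sum_l totv p l) *m (\sum_l totw p l)) *m vpr i.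
  by apply: eq_bigr => i _; rewrite -{1}vproj_sumv -{1}sumw_vproj !mulmxA.
have C := degree1_part_comm W (totY_vproj p); rewrite YW in C.
have {C} : Y *m degree1_part W - degree1_part W *m Y + \sum_i vpr i *m (v *m w) *m vpr i
    = \sum_i vpr i *m ((\sum_l totv p l) *m (\sum_l totw p l)) *m vpr i.
  rewrite C -big_split; apply: eq_bigr => i _ /=.
  by rewrite -mulmxDl -mulmxDr subrK.
move=> <-; rewrite mulmxBr mulmxBl [in RHS]opprD [RHS]addrA; congr (_ - _).
by rewrite !opprD !opprK addrACA.
Qed.

Lemma mulmx_pass (P1 P2 Q1 Q2 A B : 'M[K]_N) v (F : 'M[K]_d) w :
  P1 *m A = A *m P2 -> B *m Q1 = Q2 *m B ->
  P1 *m (A *m (v *m F *m w) *m B) *m Q1 = A *m (P2 *m v) *m F *m (w *m Q2) *m B.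
Proof. by move=> e f; rewrite !mulmxA e -!mulmxA f. Qed.

(** The map Y^a v_l F w_l' Y^(k-a-1) goes from V_(l'+k-a-1) to V_(l-a), so it has degree one exactly
    when l' = l - k, whatever a is. *)
Lemma degree1_part_flow (k : nat) v (F : 'M[K]_d) w :
  degree1_part (\sum_(a < k) Y ^+ a *m (v *m F *m w) *m Y ^+ (k - a - 1))
  = \sum_l \sum_(a < k)
      Y ^+ a *m (vpr l *m v) *m F *m (w *m vpr (l - inZp k)) *m Y ^+ (k - a - 1).
Proof.
rewrite /degree1_part [RHS]exchange_big.
under [LHS]eq_bigr => i _ do rewrite mulmx_sumr mulmx_suml.
rewrite [LHS]exchange_big; apply: eq_bigr => a _ /=.
rewrite [RHS](@sum_shift _ (inZp 1 + inZp a)); apply: eq_bigr => i _.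
have -> : i + (inZp 1 + inZp a) - inZp k = i - inZp (k - a - 1).
  have -> : inZp k = inZp a + inZp 1 + inZp (k - a - 1) :> 'I_n.+1.
    by rewrite -!inZpD; congr inZp; have := ltn_ord a; lia.
  by rewrite [inZp 1 + _]addrC opprD addrA addrK.
set j := i - inZp (k - a - 1); have -> : i = j + inZp (k - a - 1) by rewrite /j subrK.
rewrite [_ + (inZp 1 + inZp a)]addrA; apply: mulmx_pass; last exact/esym/totY_pow_vproj.
exact: totY_pow_vproj.
Qed.

Lemma rep_flow_deform (k : nat) b (W : K -> 'M[K]_N) (v : K -> 'M[K]_(N, d))
    (w : K -> 'M[K]_(d, N)) (s : K) : let F := delta_mx b b in
  is_mxderive W s (\sum_(a < k) Y ^+ a *m (v s *m F *m w s) *m Y ^+ (k - a - 1)) ->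
  is_mxderive v s (- (Y ^+ k *m v s *m F)) -> is_mxderive w s (F *m w s *m Y ^+ k) ->
  rep_flow k b (fun s => deform (W s) (v s) (w s)) s.
Proof.
move=> F hW hv hw.
have E s' := deformE (W s') (v s') (w s').
have [_ eY ev ew] := E s; rewrite /rep_flow; cbv beta zeta; rewrite eY; split.
- rewrite (_ : (fun s => _) = fun s => totX p - degree1_part (W s)); last first.
    by apply/funext => s'; have [-> _ _ _] := E s'.
  apply: (is_mxderive_eq (is_mxderiveD (is_mxderive_cst s _) (is_mxderiveN (is_mxderive_degree1_part hW)))).
  rewrite add0r degree1_part_flow; congr (- _); apply: eq_bigr => l _; apply: eq_bigr => a _.
  by rewrite ev ew.
- rewrite (_ : (fun s => _) = fun=> Y); last by apply/funext => s'; have [_ -> _ _] := E s'.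
  exact: is_mxderive_cst.
- move=> i; rewrite (_ : (fun s => _) = fun s => w s *m vpr i); last first.
    by apply/funext => s'; have [_ _ _ ->] := E s'.
  apply: (is_mxderive_eq (is_mxderiveM hw (is_mxderive_cst s _))).
  rewrite mulmx0 addr0 ew -[i in LHS](subrK (inZp k : 'I_n.+1)).
  by rewrite -[LHS]mulmxA -totY_pow_vproj [LHS]mulmxA; congr (_ *m _); rewrite -[LHS]mulmxA.
move=> i; rewrite (_ : (fun s => _) = fun s => vpr i *m v s); last first.
  by apply/funext => s'; have [_ _ -> _] := E s'.
apply: (is_mxderive_eq (is_mxderiveM (is_mxderive_cst s _) hv)).
rewrite mul0mx add0r ev mulmxN; congr (- _).
by rewrite [LHS]mulmxA; congr (_ *m F); rewrite [LHS]mulmxA totY_pow_vproj -mulmxA.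
Qed.
End Deformation.

(** * Solutions through an arbitrary initial point *)

Section Integration.
Variables (K : numClosedFieldType) (E : K -> K).
Hypotheses (E0 : E 0 = 1) (EV : forall z, E z * E (- z) = 1).
Hypothesis EE : forall z : K, is_derive z 1 E (E z).
Variables (n d : nat) (al : 'I_n.+1 -> nat) (m : nat).
Implicit Types (T : 'M[K]_(m, d)) (b : 'I_d).

(** The column of T with index l contains the times of colour l, so moving t_kb changes only the
    summand with l = b. *)
Lemma is_mxderive_times r c (F : 'I_d -> ('I_m -> K) -> 'M[K]_(r, c)) T k b D :
  is_mxderive (fun s : K => F b (fun j => T j b + (j == k)%:R * s)) 0 D ->
  is_mxderive (fun s : K => \sum_l F l (fun j => (T + s *: delta_mx k b) j l)) 0 D.
Proof.
move=> hF; rewrite -[D]addr0.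
rewrite (_ : (fun s => _) = fun s : K => F b (fun j => T j b + (j == k)%:R * s)
    + \sum_(l | l != b) F l (fun j => T j l)); last first.
  apply/funext => s; rewrite (bigD1 b) //=; congr (_ + _).
    by congr (F b _); apply/funext => j; rewrite !mxE eqxx andbT mulrC.
  apply: eq_bigr => l lb; congr (F l _); apply/funext => j.
  by rewrite !mxE (negPf lb) andbF mulr0 addr0.
exact: is_mxderiveD hF (is_mxderive_cst _ _).
Qed.

Lemma delta_mul r (l b : 'I_d) (A : 'M[K]_(d, r)) :
  delta_mx l l *m (delta_mx b b *m A) = if l == b then delta_mx b b *m A else 0.
Proof.
rewrite mulmxA; case: eqP => [->|/eqP lb]; first by rewrite mul_delta_mx.
by rewrite mul_delta_mx_0 // mul0mx.
Qed.

(* With g_b = exp (\sum_k T_kb Y^k) the solution is v = \sum_b g_b^-1 v(0) E_b,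
   w = \sum_b E_b w(0) g_b, and X = X(0) minus the degree one part of \sum_b W_b,
   where [Y, W_b] = P_b - g_b^-1 P_b g_b for P_b = v(0) E_b w(0). *)
Lemma cm_integrate (lam : 'I_n.+1 -> K) (q0 : cm_space d al lam) :
  exists2 c : 'M[K]_(m, d) -> cm_space d al lam, c 0 = q0 &
    forall T (k : 'I_m) b, cm_flow k b (fun s : K => c (T + s *: delta_mx k b)) 0.
Proof.
pose p := val (repr q0); have mom : moment_eq lam p by exact/asboolP/(valP (repr q0)).
set Y := totY p; pose vh := \sum_l totv p l; pose wh := \sum_l totw p l.
have [g hg] := choice (fun b => dressing E0 EV EE Y (vh *m delta_mx b b *m wh) m).
have [h hh] := choice hg; have [W hW] := choice hh.
pose v T := \sum_b h b (fun j => T j b) *m vh *m delta_mx b b.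
pose w T := \sum_b delta_mx b b *m (wh *m g b (fun j => T j b)).
pose WW T := \sum_b W b (fun j => T j b).
have vE T b : v T *m delta_mx b b = h b (fun j => T j b) *m vh *m delta_mx b b.
  rewrite /v mulmx_suml [LHS](@sum_only1 _ _ b); first by rewrite -mulmxA mul_delta_mx.
  by move=> l lb; rewrite -mulmxA mul_delta_mx_0 // mulmx0.
have wE T b : delta_mx b b *m w T = delta_mx b b *m (wh *m g b (fun j => T j b)).
  rewrite /w mulmx_sumr [LHS](@sum_only1 _ _ b); first by rewrite delta_mul eqxx.
  by move=> l lb; rewrite delta_mul eq_sym (negPf lb).
have vw T b : v T *m delta_mx b b *m w T
    = h b (fun j => T j b) *m (vh *m delta_mx b b *m wh) *m g b (fun j => T j b).
  by rewrite -[LHS]mulmxA wE [LHS]mulmxA vE !mulmxA.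
have sumd : \sum_b delta_mx b b = 1%:M :> 'M[K]_d by rewrite scalar_mx_sum_delta; apply: eq_bigr => b _; rewrite scale1r.
have sumvw (A : 'M[K]_(\sum_i al i, d)) (B : 'M[K]_(d, \sum_i al i)) :
    A *m B = \sum_b A *m delta_mx b b *m B.
  by rewrite -mulmx_suml -mulmx_sumr sumd mulmx1.
(* The equations for the W_b are summed over b; since \sum_b E_b = 1, the sums of P_b and of g_b^-1
   P_b g_b are v(0) w(0) and v w, as [deform_moment] requires. *)
have cY T : Y *m WW T - WW T *m Y = vh *m wh - v T *m w T.
  rewrite (sumvw vh) (sumvw (v T)) -sumrB mulmx_sumr mulmx_suml -sumrB.
  apply: eq_bigr => b _; rewrite vw.
  by have [_ /(_ (fun j => T j b)) [_ _ _ ->] _] := hW b.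
have momT T : `[< moment_eq lam (deform p (WW T) (v T) (w T)) >].
  by apply/asboolP; apply: deform_moment => //; exact: cY.
pose P T : cm_level d al lam := exist (fun p => `[< moment_eq lam p >]) _ (momT T).
exists (fun T => cm_class (P T)).
  rewrite -[RHS]reprK; congr (cm_class _); apply: val_inj.
  rewrite /= -[RHS](deform0 p); congr deform.
  - rewrite /WW [LHS]big1 // => b _; have [[_ _ W0] _ _] := hW b.
    by rewrite -[RHS]W0; congr (W b _); apply/funext => j; rewrite mxE.
  - rewrite /v -[RHS]mulmx1 -sumd mulmx_sumr; apply: eq_bigr => b _.
    have [[_ h0 _] _ _] := hW b; rewrite (_ : (fun j => _) = fun=> 0) ?h0 ?mul1mx //.
    by apply/funext => j; rewrite mxE.
  rewrite /w -[RHS]mul1mx -sumd mulmx_suml; apply: eq_bigr => b _.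
  have [[g0 _ _] _ _] := hW b; rewrite (_ : (fun j => _) = fun=> 0) ?g0 ?mulmx1 //.
  by apply/funext => j; rewrite mxE.
move=> T k b; exists (fun s : K => P (T + s *: delta_mx k b)).
  by apply: (@nearW _ (nbhs (0 : K))).
have T0 : T + 0 *: delta_mx k b = T by rewrite scale0r addr0.
have [_ _ /(_ (fun j => T j b) k) [dg dh dW]] := hW b.
apply: rep_flow_deform; rewrite T0.
- by rewrite vw; exact: is_mxderive_times dW.
- rewrite -mulmxA vE.
  have := is_mxderiveM dh (is_mxderive_cst 0 (vh *m delta_mx b b)).
  rewrite mulmx0 addr0 mulNmx => hd.
  rewrite (_ : (fun s => _) = fun s : K => \sum_l h l (fun j => (T + s *: delta_mx k b) j l)
      *m (vh *m delta_mx l l)); last first.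
    by apply/funext => s; apply: eq_bigr => l _; rewrite mulmxA.
  have := @is_mxderive_times _ _ (fun l x => h l x *m (vh *m delta_mx l l)) T k b _ hd.
  by rewrite !mulmxA.
rewrite wE.
have := is_mxderiveM (is_mxderive_cst 0 (delta_mx b b *m wh)) dg.
have [_ /(_ (fun j => T j b)) [_ cg _ _] _] := hW b.
rewrite mul0mx add0r => hd.
rewrite (_ : (fun s => _) = fun s : K => \sum_l delta_mx l l *m wh *m g l (fun j => (T + s *: delta_mx k b) j l)); last first.
  by apply/funext => s; apply: eq_bigr => l _; rewrite mulmxA.
apply: (is_mxderive_eq (@is_mxderive_times _ _ (fun l x => delta_mx l l *m wh *m g l x) T k b _ hd)).
have gY : g b (fun j => T j b) *m Y ^+ k = Y ^+ k *m g b (fun j => T j b).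
  exact: (commrX k (esym cg : GRing.comm _ Y)).
by rewrite -gY !mulmxA.
Qed.
End Integration.

Theorem theorem6p5 (R : realType) (n d : nat) (hd : (0 < d)%N)
    (mu : complexF R) (hmu : n.+1.-primitive_root mu)
    (tau : complexF R) (htau : tau != 0) (kappa : 'I_n.+1 -> complexF R)
    (hreg : regular (lambda tau kappa)) (al : 'I_n.+1 -> nat) :
  let lam := lambda tau kappa in
  let lax := @cm_space_lax (complexF R) n d mu hmu tau kappa al in
  [/\ (* M = 1 + negative powers of y is invertible, and the map is well defined
         on the quotient with values in the phase space of the hierarchy *)
      forall p : cm_level d al lam,
        let M := waveM hmu tau kappa (val p) in
        [/\ wave_form M, M *m mxinv M = 1%:M, mxinv M *m M = 1%:M,
            lax (cm_class p) = (laxL hmu tau kappa (val p), laxR hmu tau kappa (val p))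
          & hier_space (lax (cm_class p)).1 (lax (cm_class p)).2],
      (* the displayed equations are Hamilton's equations of H_(k, b) *)
      forall (k : nat) (b : 'I_d) (p : complexF R -> quiver_rep (complexF R) d al)
          (t0 : complexF R) (V : quiver_rep (complexF R) d al), is_repderive p t0 V ->
        rep_flow k b p t0 <->
        forall xi : quiver_rep (complexF R) d al,
          is_derive (0 : complexF R) 1 (fun s : complexF R => ham k b (rep_shift (p t0) s xi))
            (- omega V xi),
      (* the map sends the Hamiltonian flows to the flows of the hierarchy *)
      forall (k : nat) (b : 'I_d) (c : complexF R -> cm_space d al lam) (t0 : complexF R),
        cm_flow k b c t0 -> hier_flow k b (fun t => lax (c t)) t0
    & (* integrating the flows from any initial point solves the hierarchy *)
      forall (N : nat) (q0 : cm_space d al lam),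
        exists2 c : 'M[complexF R]_(N, d) -> cm_space d al lam, c 0 = q0 &
          forall (T : 'M[complexF R]_(N, d)) (k : 'I_N) (b : 'I_d),
            cm_flow k b (fun s : complexF R => c (T + s *: delta_mx k b)) 0 /\
            hier_flow k b (fun s : complexF R => lax (c (T + s *: delta_mx k b))) 0].
Proof.
move=> lam lax; split.
- move=> p M; have mom : moment_eq lam (val p) by exact/asboolP/(valP p).
  have e : lax (cm_class p) = (laxL hmu tau kappa (val p), laxR hmu tau kappa (val p)).
    exact: cm_lax_class.
  split.
  + exact/wave_form_bounded/waveM_bounded.
  + by rewrite /M (mxinv_wave hmu mom) (waveM_Mi hmu mom).
  + by rewrite /M (mxinv_wave hmu mom) (waveMi_M hmu mom).
  + exact: e.
  + by rewrite e; exact: lax_hier_space.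
- by move=> k b p t0 V; exact: hamilton_equations.
- by move=> k b c t0; exact: cm_flow_hier.
move=> N q0.
have EV (z : complexF R) : cexp z * cexp (- z) = 1 by rewrite -cexpD subrr cexp0.
have [c c0 hc] := cm_integrate (@cexp0 R) EV (@is_derive_cexp R) N q0.
exists c; first exact: c0.
move=> T k b; split; first exact: hc.
by apply: cm_flow_hier; exact: hc.
Qed.
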